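(* Let $(W,S)$ be a finite Coxeter system. Let $v,w\in W$ be such that $v\leq w$. Let $s_{\beta_1}\cdots s_{\beta_\ell}$ be a reduced expression of $w_ov$. Let $\alpha_i=s_{\beta_\ell}\cdots s_{\beta_{i+1}}(\beta_i)$ and $y_i=x_{\alpha_i}$ for all $1\leq i\leq\ell$. Then, in $\mathscr B_W$, \[ x_{w/v}^\circ=\sum_J\prod_{j\in J}y_j, \] where the sum ranges over all subsets $J$ of $\{1,\ldots,\ell\}$ such that the product $\prod_{j\in\bar J}s_{\beta_j}$ is a reduced expression of $w_ow$. Here $\bar J$ denotes the complement of $J$ in $\{1,\ldots,\ell\}$.
   Context: Coxeter setup. $(W,S)$ is a Coxeter system with $W$ finite; $m(s,s')$ is the order of $ss'$. $\mathfrak h_{\mathbb R}$ is a real vector space with basis $\Delta$ (the simple roots), in bijection with $S$ via $\beta\mapsto s_\beta$, with symmetric bilinear form $B(\beta,\beta')=-\cos(\pi/m(s_\beta,s_{\beta'}))$. $W$ acts by $s_\beta(x)=x-2B(x,\beta)\beta$. $R=\{u(\beta):u\in W,\beta\in\Delta\}$ is the root system, $R^+$ the set of roots that are nonnegative linear combinations of $\Delta$. For $\alpha=u(\beta)\in R$, $s_\alpha=us_\beta u^{-1}$. $\leq$ is the (strong) Bruhat order, $w_o$ the longest element of $W$. Products $\prod_{j\in J}$ over a finite set $J$ of integers are taken in increasing order of the index (empty product $=1$). Nichols algebra $\mathscr B_W$. $V_W$ is the complex vector space spanned by symbols $x_\alpha$ ($\alpha\in R$) modulo $x_{-\alpha}=-x_\alpha$;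 $\{x_\alpha:\alpha\in R^+\}$ is a basis. $W$ acts by $ux_\alpha=x_{u(\alpha)}$, and $V_W$ is $W$-graded with $x_\alpha$ of degree $s_\alpha$. The braiding is $\Psi(x_\alpha\otimes y)=s_\alpha y\otimes x_\alpha$ on $V_W^{\otimes 2}$. For $\sigma$ in the symmetric group $\mathbb S_m$ with reduced expression $s_{i_1}\cdots s_{i_k}$, $\Psi_\sigma=\Psi_{i_1}\cdots\Psi_{i_k}$ on $V_W^{\otimes m}$, where $\Psi_i$ is $\Psi$ applied to factors $i,i+1$; the braided factorial is $[m]!=\sum_{\sigma\in\mathbb S_m}\Psi_\sigma$. $\mathscr B_W=T(V_W)/\bigoplus_m\ker[m]!$. $T(V_W)$, with multiplicatively extended $W$-action and $W$-grading, is a braided Hopf algebra: $\Delta$ is the algebra homomorphism to $T(V_W)\otimes T(V_W)$ with twisted multiplication $(a\otimes b)\cdot(c\otimes d)=a(gc)\otimes bd$ for $b$ of $W$-degree $g$, and $\Delta(x)=x\otimes1+1\otimes x$ for $x\in V_W$. This structure descends to $\mathscr B_W$. Elements. For $w\in W$ with reduced expression $s_{\gamma_1}\cdots s_{\gamma_k}$, $x_w=x_{\gamma_1}\cdots x_{\gamma_k}\in\mathscr B_W$ (well defined; the $x_w$, $w\in W$, are linearly independent). The elements $x_{w/v}\in\mathscr B_W$ for $v\leq w$ are uniquely determined by $\Delta(x_w)=\sum_{v\leq w}x_{w/v}\otimes x_v$; $x_{w/v}=0$ if $v\not\leq w$. $\rho:\mathscr B_W\to\mathscr B_W$ is the anti-algebra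 involution with $\rho(x_{\alpha_1}\cdots x_{\alpha_m})=x_{\alpha_m}\cdots x_{\alpha_1}$, and $x_{w/v}^\circ=\rho(x_{w^{-1}/v^{-1}})$. *)

(* Defs.v *)
From HB Require Import structures.
From mathcomp Require Import all_boot all_order all_algebra all_fingroup.
From mathcomp Require Import complex.
From mathcomp Require Import boolp classical_sets reals trigo.
From mathcomp Require Import finmap monalg.
From mathcomp Require Import generic_quotient ring_quotient.

Set Implicit Arguments.
Unset Strict Implicit.
Unset Printing Implicit Defensive.

Import Order.TTheory GRing.Theory Num.Theory.
Local Open Scope ring_scope.
Local Open Scope quotient_scope.

Section Words.
Context (G : finGroupType) (I : finType) (g : I -> G).

Definition wprod (u : seq I) : G := (\prod_(i <- u) g i)%g.

(* No strictly shorter word has the same product. *)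
Definition reduced (u : seq I) : bool :=
  [forall k : 'I_(size u), forall t : k.-tuple I, wprod t != wprod u].

Definition reduced_expr (x : G) (u : seq I) : bool :=
  (wprod u == x) && reduced u.

(* A chosen reduced expression of x; the junk value [::] is taken only when x *)
(* is not a product of the g i.                                               *)
Definition rword (x : G) : seq I :=
  xget [::] [set u | reduced_expr x u]%classic.

Definition wlen (x : G) : nat := size (rword x).

End Words.

(* The relations (s s')^m(s,s') = 1, s, s' \in S, with m(s,s') = #[s * s'],   *)
(* present the group W: this is the universal property of the presentation.   *)
Record coxeter_system (W : finGroupType) (S : {set W}) : Prop := CoxeterSystem {
  cox_gen : (<<S>> = [set: W])%g;
  cox_involution : {in S, forall s, #[s]%g = 2%N};
  cox_presentation : forall (G : groupType) (f : W -> G),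
    {in S &, forall s t, ((f s * f t) ^+ #[(s * t)%g]%g = 1)%g} ->
    exists2 phi : W -> G,
      {morph phi : x y / (x * y)%g} & {in S, phi =1 f}
}.

Section CoxeterGroup.
Context (W : finGroupType) (S : {set W}).

Definition simple (i : 'I_#|S|) : W := enum_val i.

Definition clen (w : W) : nat := wlen simple w.

Definition longest : W := [arg max_(w > 1%g) clen w]%N.

(* v -> w when w = v t for a reflection t (a conjugate of an element of S)    *)
(* and the length increases.                                                  *)
Definition bruhat_step : rel W := fun v w =>
  [exists t in class_support S [set: W], w == (v * t)%g]
  && (clen v < clen w)%N.

Definition bruhat : rel W := connect bruhat_step.

End CoxeterGroup.

Section RootSystem.
Context (R : realType) (W : finGroupType) (S : {set W}).

Local Notation n := #|S|.
Local Notation hR := 'rV[R]_n.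
Local Notation s := (@simple W S).

Definition sroot (i : 'I_n) : hR := delta_mx 0 i.

Definition gram : 'M[R]_n :=
  \matrix_(i, j) - cos (trigo.pi / #[(s i * s j)%g]%g%:R).

Definition bform (x y : hR) : R := (x *m gram *m y^T) 0 0.

Definition sreflection (i : 'I_n) (x : hR) : hR :=
  x - (2%:R * bform x (sroot i)) *: sroot i.

(* The W-action is evaluated along a reduced expression; for a Coxeter system *)
(* the result does not depend on it.                                          *)
Definition wact (u : W) (x : hR) : hR := foldr sreflection x (rword s u).

Definition is_root (a : hR) : bool :=
  [exists u : W, exists i : 'I_n, a == wact u (sroot i)].

Definition is_posroot (a : hR) : bool :=
  is_root a && [forall i : 'I_n, 0 <= a 0 i].

Definition posroot := {a : hR | is_posroot a}.

(* s_a = u s_b u^-1 for a = u(b), with u and b chosen; 1 if a is not a root.  *)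
Definition root_reflection (a : hR) : W :=
  if [pick p : W * 'I_n | a == wact p.1 (sroot p.2)] is Some p
  then (p.1 * s p.2 * p.1^-1)%g else 1%g.

End RootSystem.

Section LinearExtension.
Context (K : choiceType) (C : nzRingType) (V : lmodType C).

Definition linext (f : K -> V) (a : {malg C[K]}) : V :=
  \sum_(k <- msupp a) a@_k *: f k.

Lemma linextEw (f : K -> V) (d : {fset K}) (a : {malg C[K]}) :
  (msupp a `<=` d)%fset -> linext f a = \sum_(k <- d) a@_k *: f k.
Proof.
move=> le; rewrite [LHS](big_fset_incl _ le) => //= x xd /mcoeff_outdom ->.
by rewrite scale0r.
Qed.

Lemma linext_is_zmod_morphism (f : K -> V) : zmod_morphism (linext f).
Proof.
move=> a b /=; pose d := (msupp a `|` msupp b `|` msupp (a - b))%fset.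
have [sa sb sab] : [/\ msupp a `<=` d, msupp b `<=` d & msupp (a - b) `<=` d]%fset.
  by split; apply/fsubsetP => x xin; rewrite !inE xin ?orbT.
rewrite !(@linextEw f d) // -sumrB; apply: eq_bigr => k _.
by rewrite mcoeffB scalerBl.
Qed.

HB.instance Definition _ (f : K -> V) :=
  GRing.isZmodMorphism.Build {malg C[K]} V (linext f)
    (linext_is_zmod_morphism f).

End LinearExtension.

(* Adjacent transpositions of 'S_m. The product of 'S_m is composition in the *)
(* opposite order, which is harmless: reduced words of a permutation for one  *)
(* convention are reduced words of its inverse for the other, and [bfact]     *)
(* sums over all permutations.                                                *)
Definition adj_tperm (m : nat) (i : 'I_m.-1) : 'S_m :=
  tperm (widen_ord (leq_pred m) i)
        (Ordinal (etrans (esym (ltn_predRL i m)) (ltn_ord i))).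

Section TensorAlgebra.
Context (R : realType) (W : finGroupType) (S : {set W}).

Local Notation n := #|S|.
Local Notation hR := 'rV[R]_n.
Local Notation C := (R[i]%C).
Local Notation P := (posroot R S).

(* T(V_W), as the free algebra on the basis {x_a, a \in R^+} of V_W, and its  *)
(* tensor square, with basis the pairs of words.                              *)
Definition tensor_alg := {malg C[{fmonom P}]}.
Definition tensor_alg2 := {malg C[({fmonom P} * {fmonom P})%type]}.


Local Notation T := tensor_alg.
Local Notation TT := tensor_alg2.

Definition tword (k : {fmonom P}) : T := << k >>.

Definition tgen (a : P) : T := tword (fmu a).

(* x_a for an arbitrary root a, using x_(-a) = - x_a. *)
Definition xroot (a : hR) : T :=
  if (insub a : option P) is Some p then tgen p
  else if (insub (- a) : option P) is Some p then - tgen p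
  else 0.

Definition tact (u : W) : T -> T :=
  linext (fun k : {fmonom P} =>
    \prod_(a <- fmonom_val k) xroot (wact u (val a)) : T).

Definition wdeg (k : {fmonom P}) : W :=
  (\prod_(a <- fmonom_val k) root_reflection (val a))%g.

(* The braiding on the tensor factors i and i+1 (counted from 0); words with  *)
(* less than i+2 letters are irrelevant.                                      *)
Definition braid_word (i : nat) (k : {fmonom P}) : T :=
  if drop i (fmonom_val k) is a :: b :: k' then
    tword (FMonom (take i (fmonom_val k)))
    * xroot (wact (root_reflection (val a)) (val b)) * tgen a
    * tword (FMonom k')
  else tword k.

Definition braid (i : nat) : T -> T := linext (braid_word i).

Definition braid_perm (m : nat) (sigma : 'S_m) (a : T) : T :=
  foldr (fun i : 'I_m.-1 => braid i) a (rword (@adj_tperm m) sigma).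

Definition bfact (m : nat) (a : T) : T :=
  \sum_(sigma : 'S_m) braid_perm sigma a.

Definition hcomp (m : nat) : T -> T :=
  linext (fun k : {fmonom P} => if size k == m then tword k else 0).

Definition nichols_ideal : {pred T} :=
  fun a => `[< forall m, bfact m (hcomp m a) = 0 >].

Definition tens (a b : T) : TT :=
  linext (fun k : {fmonom P} =>
    linext (fun l : {fmonom P} => << (k, l) >> : TT) b) a.

(* (a (x) b) . (c (x) d) = a (g c) (x) b d, b of degree g. *)
Definition twisted_mul (p q : TT) : TT :=
  linext (fun k : {fmonom P} * {fmonom P} =>
    linext (fun l : {fmonom P} * {fmonom P} =>
      tens (tword k.1 * tact (wdeg k.2) (tword l.1)) (tword k.2 * tword l.2))
    q) p.

Definition coprod : T -> TT :=
  linext (fun k : {fmonom P} =>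
    foldr (fun a => twisted_mul (tens (tgen a) 1 + tens 1 (tgen a)))
      (tens 1 1) (fmonom_val k)).

Definition trev : T -> T :=
  linext (fun k : {fmonom P} => tword (FMonom (rev (fmonom_val k)))).

(* I (x) T + T (x) I for I = nichols_ideal. *)
Definition nichols_ideal2 : {pred TT} := fun c =>
  `[< exists2 r : seq (T * T),
        {in r, forall p, (p.1 \in nichols_ideal) || (p.2 \in nichols_ideal)}
        & c = \sum_(p <- r) tens p.1 p.2 >].

Lemma braid_permB m (sigma : 'S_m) : zmod_morphism (braid_perm sigma).
Proof.
move=> a b; rewrite /braid_perm; elim: (rword _ _) => //= i u ->.
exact: raddfB.
Qed.

Lemma nichols_ideal_closed : zmod_closed nichols_ideal.
Proof.
have bfactB m : zmod_morphism (bfact m).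
  by move=> a b; rewrite /bfact -sumrB; apply: eq_bigr => ? _; apply: braid_permB.
have bfact0 m : bfact m 0 = 0 by rewrite -{1}(subrr 0) bfactB subrr.
split=> [|a b /asboolP Ia /asboolP Ib]; apply/asboolP => m.
  by rewrite /hcomp raddf0 bfact0.
by rewrite /hcomp raddfB bfactB -/(hcomp m) Ia Ib subrr.
Qed.

HB.instance Definition _ :=
  GRing.isZmodClosed.Build T nichols_ideal nichols_ideal_closed.

Lemma nichols_ideal2_closed : zmod_closed nichols_ideal2.
Proof.
split=> [|a b /asboolP[r Ir ->] /asboolP[r' Ir' ->]]; apply/asboolP.
  by exists [::]; rewrite ?big_nil.
exists (r ++ [seq (- p.1, p.2) | p <- r']) => [p|].
  rewrite mem_cat => /orP[/Ir //|/mapP[q /Ir' Iq -> /=]].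
  by rewrite rpredN.
rewrite big_cat big_map /= -sumrN; congr (_ + _).
by apply: eq_bigr => p _; rewrite /tens raddfN.
Qed.

HB.instance Definition _ :=
  GRing.isZmodClosed.Build TT nichols_ideal2 nichols_ideal2_closed.

End TensorAlgebra.

(* The Nichols algebra and its tensor square                                  *)
(*   T(V_W) (x) T(V_W) / (I (x) T(V_W) + T(V_W) (x) I).                       *)
(* Products, coproduct, tensors and reversal are those of T(V_W), computed on *)
(* representatives.                                                           *)
Definition nichols (R : realType) (W : finGroupType) (S : {set W}) : Type :=
  Quotient.quot (@nichols_ideal R W S).
Definition nichols2 (R : realType) (W : finGroupType) (S : {set W}) : Type :=
  Quotient.quot (@nichols_ideal2 R W S).


Section Nichols.
Context (R : realType) (W : finGroupType) (S : {set W}).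

Local Notation T := (tensor_alg R S).
Local Notation B := (nichols R S).
Local Notation BB := (nichols2 R S).

Definition nunit : B := \pi_B 1.
Definition nmul : B -> B -> B := fun a b => \pi_B (repr a * repr b : T).
Definition ntens (a b : B) : BB := \pi_BB (tens (repr a) (repr b)).
Definition ncoprod (a : B) : BB := \pi_BB (coprod (repr a)).
Definition nrev (a : B) : B := \pi_B (trev (repr a)).

Definition nroot (a : 'rV[R]_#|S|) : B := \pi_B (xroot a).

Definition nelt (w : W) : B :=
  \big[nmul/nunit]_(i <- rword (@simple W S) w) nroot (sroot R i).

Definition is_nquot (w : W) (q : {ffun W -> B}) : Prop :=
  ncoprod (nelt w) = \sum_(v | bruhat S v w) ntens (q v) (nelt v)
  /\ (forall v, ~~ bruhat S v w -> q v = 0).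

(* x_(w/v) and x_(w/v)^o; the family (x_(w/v))_v is the one characterized by  *)
(* [is_nquot].                                                                *)
Definition nquot (w v : W) : B :=
  xget ([ffun=> 0] : {ffun W -> B}) [set q | is_nquot w q]%classic v.

Definition nquot_op (w v : W) : B := nrev (nquot w^-1 v^-1)%g.

End Nichols.

(* Main.v *)
(** The Nichols ideal consists of the tensors killed by all products of the skew
    derivations dual to the letters, followed by the counit. This criterion gives
    the relations x_a^2 = 0 and the braid relations, and shows that the products of
    skew derivations along reduced words are functionals dual to the x_w. Expanding
    the coproduct of x_w along a reduced word of w therefore determines x_{w/v}, and
    f(w,v) = x_{w/v}^o satisfies, for s = s_alpha with sw > w,
      f(sw,v) = x_{v^-1 alpha} f(w,v) + [sv < v] f(w,sv).
    Since x_{v^-1 alpha}^2 = 0, this can be inverted: for sv > v,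
      f(w,v) = x_{v^-1 alpha} f(w,sv) + [sw > w] f(sw,sv).
    As s w_o = w_o s' for a simple reflection s', the last recursion is the one that
    the sum over J satisfies when the first letter of the reduced word of w_o v is
    put into J or into its complement. *)
From Pilot Require Import Defs.
From HB Require Import structures.
From mathcomp Require Import all_boot all_order all_algebra all_fingroup.
From mathcomp Require Import cyclic complex boolp reals trigo.
From mathcomp Require Import finmap monalg generic_quotient.
From mathcomp Require Import zify ring.
From mathcomp Require classical_sets.

Set Implicit Arguments.
Unset Strict Implicit.
Unset Printing Implicit Defensive.

Import Order.TTheory GRing.Theory Num.Theory.
Local Open Scope ring_scope.
Local Open Scope quotient_scope.

(** * Words, the exchange condition and Matsumoto's theorem *)

(** Operations on [nichols] are computed on chosen representatives, and [braid_perm], [wact] and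
    [nelt] use chosen reduced words. So the ideal has to be stable under product, action, reversal
    and coproduct, and independence of reduced words is needed three times: for W on the geometric
    representation, for W inside the Nichols algebra, and for the symmetric groups on tensors. The
    exchange condition and Matsumoto's theorem are therefore proved for any group with a mod 2
    reflection cocycle [eta], which comes from inversions in 'S_m and from the presentation in W.
    The criterion for the ideal holds because the coefficient of a head letter in [m+1]! b is [m]!
    applied to a skew derivative of b; the braided factorial does not occur after [nichols_idealP].
    Rules on the right (right ideal, reversal) are harder than those on the left: a letter removed
    at the right end is moved by the W-degree of what precedes it, which forces a splitting into
    W-degrees. In the tensor square, membership is tested by functionals on the left factor only,
    and this rests on rank reduction. *)

Section WordLength.
Local Open Scope nat_scope.
Local Open Scope group_scope.
Context (G : finGroupType) (I : finType) (g : I -> G).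

Lemma wprod_nil : wprod g [::] = 1. Proof. exact: big_nil. Qed.

Lemma wprod_cons i u : wprod g (i :: u) = g i * wprod g u.
Proof. exact: big_cons. Qed.

Lemma wprod_cat u v : wprod g (u ++ v) = wprod g u * wprod g v.
Proof. exact: big_cat. Qed.

Lemma wprod_rcons u i : wprod g (rcons u i) = wprod g u * g i.
Proof. by rewrite -cats1 wprod_cat wprod_cons wprod_nil mulg1. Qed.

Lemma reducedP u :
  reflect (forall v, wprod g v = wprod g u -> size u <= size v)%N (reduced g u).
Proof.
apply: (iffP forallP) => [red v eqv | red k].
  rewrite leqNgt; apply/negP => ltv.
  have /forallP/(_ (in_tuple v))/eqP := red (Ordinal ltv); exact.
apply/forallP => t; apply/eqP => /red; rewrite size_tuple leqNgt; by rewrite ltn_ord.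
Qed.

Hypothesis ggen : forall x, exists u, wprod g u = x.

(** Generation makes the set of words for x nonempty, and a word of minimal size in it is reduced;
    so the default value of [rword] is never reached. *)
Lemma rwordP x : reduced_expr g x (rword g x).
Proof.
rewrite /rword; case: classical_sets.xgetP => [u -> //|no] /=.
have [u0 u0x] := ggen x.
have ex : exists n, [exists t : n.-tuple I, wprod g t == x].
  by exists (size u0); apply/existsP; exists (in_tuple u0); apply/eqP.
case: (ex_minnP ex) => n /existsP[t /eqP tx] min.
case: (no (t : seq I)); rewrite /= /reduced_expr tx eqxx /=.
apply/reducedP => v; rewrite size_tuple tx => vx; apply: min.
by apply/existsP; exists (in_tuple v); apply/eqP.
Qed.

Lemma wprod_rword x : wprod g (rword g x) = x.
Proof. by have /andP[/eqP] := rwordP x. Qed.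

Lemma reduced_rword x : reduced g (rword g x).
Proof. by have /andP[] := rwordP x. Qed.

Lemma wlen_le u : (wlen g (wprod g u) <= size u)%N.
Proof. by have /reducedP := reduced_rword (wprod g u); apply; rewrite wprod_rword. Qed.

Lemma reducedE u : reduced g u = (size u == wlen g (wprod g u)).
Proof.
apply/reducedP/eqP => [red|eqs v eqv]; last by rewrite eqs -eqv wlen_le.
by apply/eqP; rewrite eqn_leq wlen_le red ?wprod_rword.
Qed.

Lemma reduced_exprE x u :
  reduced_expr g x u = (wprod g u == x) && (size u == wlen g x).
Proof. by rewrite /reduced_expr reducedE; case: eqP => // ->. Qed.

Lemma wlen1 : wlen g 1 = 0%N.
Proof. by apply/eqP; rewrite -leqn0 -wprod_nil wlen_le. Qed.

Lemma wlenM x y : (wlen g (x * y) <= wlen g x + wlen g y)%N.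
Proof.
rewrite -{1}(wprod_rword x) -{1}(wprod_rword y) -wprod_cat.
by rewrite (leq_trans (wlen_le _)) ?size_cat.
Qed.

Lemma wlen_eq0 x : (wlen g x == 0%N) = (x == 1).
Proof.
apply/idP/eqP => [|->]; last by rewrite wlen1.
by move=> /eqP/size0nil eq0; rewrite -(wprod_rword x) eq0 wprod_nil.
Qed.

Lemma wlen_gen i : (wlen g (g i) <= 1)%N.
Proof. by rewrite -[g i]mulg1 -wprod_nil -wprod_cons wlen_le. Qed.

Hypothesis ginvol : forall i, g i * g i = 1.

Lemma ginv i : (g i)^-1 = g i.
Proof. by apply/eqP; rewrite eq_invg_mul ginvol. Qed.

Lemma mulgg i x : g i * (g i * x) = x.
Proof. by rewrite mulgA ginvol mul1g. Qed.

Lemma wprod_rev u : wprod g (rev u) = (wprod g u)^-1.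
Proof.
elim: u => [|i u IH]; first by rewrite wprod_nil invg1.
by rewrite rev_cons wprod_rcons IH wprod_cons invMg ginv.
Qed.

Lemma wlenV x : wlen g x^-1 = wlen g x.
Proof.
have le y : (wlen g y^-1 <= wlen g y)%N.
  by rewrite -{1}(wprod_rword y) -wprod_rev (leq_trans (wlen_le _)) ?size_rev.
by apply/eqP; rewrite eqn_leq le -{1}(invgK x) le.
Qed.

Lemma reduced_rev u : reduced g (rev u) = reduced g u.
Proof. by rewrite !reducedE size_rev wprod_rev wlenV. Qed.

Lemma reduced_behead i u : reduced g (i :: u) -> reduced g u.
Proof.
rewrite !reducedE wprod_cons /= => /eqP eqs; rewrite eqn_leq wlen_le andbT.
have := wlenM (g i) (wprod g u); rewrite -eqs.
by have := wlen_gen i; lia.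
Qed.

End WordLength.

(* eta x t tells whether the reflection t shortens x from the left. *)
Record reflection_cocycle (G : finGroupType) (I : finType) (g : I -> G)
    (eta : G -> G -> bool) : Prop := ReflectionCocycle {
  cocycle_gen : forall x, exists u, wprod g u = x;
  cocycle_invol : forall i, (g i * g i = 1)%g;
  cocycleM : forall x y t, eta (x * y)%g t = eta x t (+) eta y (t ^ x)%g;
  cocycleE : forall i t, eta (g i) t = (t == g i)
}.

Section Exchange.
Local Open Scope nat_scope.
Local Open Scope group_scope.
Context (G : finGroupType) (I : finType) (g : I -> G) (eta : G -> G -> bool).
Hypothesis geta : reflection_cocycle g eta.

Let ggen := cocycle_gen geta.
Let ginvol := cocycle_invol geta.
Let etaM := cocycleM geta.
Let etaE := cocycleE geta.
Local Notation len := (wlen g).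

Lemma cocycle1 t : eta 1 t = false.
Proof. by have := etaM 1 1 t; rewrite mulg1 conjg1; case: (eta 1 t). Qed.

Lemma cocycleV x t : eta x^-1 t = eta x (t ^ x^-1).
Proof. by have := etaM x^-1 x t; rewrite mulVg cocycle1; do 2 case: (eta _ _). Qed.

(** Unfolding [cocycleM] along u writes [eta (wprod g u) t] as a sum mod 2 over the letters, a
    letter counting when it equals the conjugate of t by the prefix before it. If the sum is odd
    some letter counts, and multiplying by t deletes the first such letter. *)
Lemma exchange u t : eta (wprod g u) t ->
  exists u1 i u2, u = u1 ++ i :: u2 /\ t * wprod g u = wprod g (u1 ++ u2).
Proof.
elim: u t => [|i u IH] t; first by rewrite wprod_nil cocycle1.
rewrite wprod_cons etaM etaE; case: eqP => [-> _|_ /= /IH].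
  by exists [::], i, u; rewrite mulgg.
case=> u1 [j [u2 [-> eqt]]]; exists (i :: u1), j, u2; split=> //=.
by rewrite !wprod_cons -eqt conjgE !mulgA mulgV mul1g.
Qed.

Lemma cocycle_lt x t : eta x t -> (len (t * x) < len x)%N.
Proof.
rewrite -{1}(wprod_rword ggen x) => /exchange[u1 [i [u2 [eqx]]]].
rewrite wprod_rword // => ->; rewrite /wlen eqx -/(wlen g _).
by rewrite (leq_ltn_trans (wlen_le ggen _)) // !size_cat /= addnS.
Qed.

Lemma cocycle_refl i x : eta (g i ^ x) (g i ^ x).
Proof.
have E : forall y, g i ^ y = y^-1 * (g i * y) by move=> y; rewrite conjgE.
rewrite {1}E !etaM cocycleV conjgK etaE eqxx conjgE mulKg.
by case: (eta _ _).
Qed.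

(** Converse of [cocycle_lt]: for a reflection t, [eta t t] is true, so exactly one of [eta z t] and
    [eta (t * z) t] holds, and the latter would make z shorter than t z. Hence lengths determine
    [eta] on reflections. *)
Lemma cocycle_ltE i x z : eta z (g i ^ x) = (len (g i ^ x * z) < len z)%N.
Proof.
apply/idP/idP => [/cocycle_lt //|lt]; apply/negPn/negP => neta.
have : eta (g i ^ x * z) (g i ^ x).
  by rewrite etaM cocycle_refl conjgE mulKg (negbTE neta).
move=> /cocycle_lt; rewrite mulgA -conjMg ginvol conj1g mul1g.
by move=> /(ltn_trans lt); rewrite ltnn.
Qed.

Lemma refl_leNgt i x z :
  (len (g i ^ x * z) < len z)%N = ~~ (len z < len (g i ^ x * z))%N.
Proof.
have E : g i ^ x * (g i ^ x * z) = z by rewrite mulgA -conjMg ginvol conj1g mul1g.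
have -> : (len z < len (g i ^ x * z))%N = eta (g i ^ x * z) (g i ^ x).
  by rewrite cocycle_ltE E.
have selfJ (t : G) : t ^ t = t by rewrite conjgE mulKg.
by rewrite -cocycle_ltE etaM cocycle_refl selfJ; case: (eta _ _).
Qed.

Lemma simple_ltE i z : eta z (g i) = (len (g i * z) < len z)%N.
Proof. by have := cocycle_ltE i 1 z; rewrite conjg1. Qed.

Lemma simple_leNgt i z : (len (g i * z) < len z)%N = ~~ (len z < len (g i * z))%N.
Proof. by have := refl_leNgt i 1 z; rewrite conjg1. Qed.

Lemma len_lt_simple i z : (len z < len (g i * z))%N = (len (g i * z) == (len z).+1).
Proof.
by have := wlenM ggen (g i) z; have := wlen_gen ggen i; lia.
Qed.

Lemma len_gt_simple i z : (len (g i * z) < len z)%N = (len z == (len (g i * z)).+1).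
Proof. by rewrite -{2 4}[z](mulgg ginvol i) len_lt_simple mulgg. Qed.

Lemma len_simpleP i z :
  len (g i * z) = (len z).+1 \/ len z = (len (g i * z)).+1.
Proof.
case: (boolP (len z < len (g i * z))%N); first by rewrite len_lt_simple => /eqP; left.
by rewrite -simple_leNgt len_gt_simple => /eqP; right.
Qed.

Lemma len_simplerP i z :
  len (z * g i) = (len z).+1 \/ len z = (len (z * g i)).+1.
Proof.
have := len_simpleP i z^-1.
by rewrite -(wlenV ggen ginvol (_ * _)) invMg invgK ginv // wlenV.
Qed.

Lemma len_simple i : len (g i) = 1%N.
Proof. by have [] := len_simpleP i 1; rewrite mulg1 wlen1. Qed.

Lemma reduced_cons i u :
  reduced g (i :: u) = reduced g u && (len (wprod g u) < len (wprod g (i :: u)))%N.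
Proof.
apply/idP/andP => [red|[red lt]].
  have redu := reduced_behead ggen red; split=> //.
  by move: red redu; rewrite !reducedE // => /eqP <- /eqP <-.
move: red lt; rewrite !reducedE // wprod_cons len_lt_simple => /eqP red /eqP ->.
by rewrite /= red.
Qed.

Lemma exists_descent z : z != 1 -> exists i, (len (g i * z) < len z)%N.
Proof.
move=> nz; case eqz: (rword g z) (wprod_rword ggen z) => [|i u] zE.
  by rewrite -zE wprod_nil eqxx in nz.
exists i; rewrite -zE wprod_cons mulgg // (leq_ltn_trans (wlen_le ggen u)) //.
by have := reduced_rword ggen z; rewrite eqz reducedE // wprod_cons => /eqP <-.
Qed.

Section Longest.
Local Open Scope nat_scope.
Local Open Scope group_scope.
Context (w0 : G).
Hypothesis w0max : forall x, (len x <= len w0)%N.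

Lemma longest_cocycle i x : eta w0 (g i ^ x).
Proof. by rewrite cocycle_ltE refl_leNgt -leqNgt. Qed.

(** Every reflection shortens [w0], so by [cocycleM] the value of [eta] at w0 z is the negation of
    its value at z, once the reflection is conjugated through w0. *)
Lemma longest_ltE i z :
  (len (w0 * (g i * z)) < len (w0 * z))%N = (len z < len (g i * z))%N.
Proof.
have -> : w0 * (g i * z) = g i ^ w0^-1 * (w0 * z) by rewrite conjgE invgK !mulgA mulgKV.
rewrite -cocycle_ltE etaM longest_cocycle -conjgM mulVg conjg1 simple_ltE.
by rewrite simple_leNgt /= negbK.
Qed.

Lemma longest_len z : (len (w0 * z) + len z = len w0)%N.
Proof.
apply/eqP; rewrite eqn_leq; apply/andP; split; last first.
  have := wlenM ggen (w0 * z) z^-1; rewrite mulgK wlenV //.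
rewrite -(wprod_rword ggen z); move: (reduced_rword ggen z).
elim: (rword g z) => [|i u IH]; first by rewrite wprod_nil mulg1 wlen1 ?addn0.
rewrite reduced_cons => /andP[/IH le]; rewrite wprod_cons => lt.
have := lt; rewrite -longest_ltE => lt'.
by move: lt; rewrite len_lt_simple => /eqP ->; lia.
Qed.

(** The formula of [longest_len] gives length 0 to w0 w0, so w0 is an involution; used again, it
    gives length 1 to w0 s w0, which is therefore a generator. *)
Lemma longest_conj i : exists j, w0^-1 * (g i * w0) = g j.
Proof.
have w0V : w0^-1 = w0.
  have : len (w0 * w0) == 0%N by have := longest_len w0; lia.
  by rewrite wlen_eq0 // => /eqP w2; apply/eqP; rewrite eq_invg_mul w2.
have lenVi : len (g i * w0) = len (w0 * g i).
  by rewrite -(wlenV ggen ginvol (g i * w0)) invMg (ginv ginvol) w0V.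
have l1 : len (w0 * (g i * w0)) = 1%N.
  have := longest_len (g i * w0); have := longest_len (g i).
  by rewrite lenVi len_simple; lia.
have := wprod_rword ggen (w0 * (g i * w0)); move: l1; rewrite w0V /wlen.
case: (rword g _) => [|j [|? ?]] // _ <-.
by exists j; rewrite wprod_cons wprod_nil mulg1.
Qed.

End Longest.

End Exchange.

Section Matsumoto.
Local Open Scope nat_scope.
Local Open Scope group_scope.
Context (G : finGroupType) (I : finType) (g : I -> G) (eta : G -> G -> bool).
Hypothesis geta : reflection_cocycle g eta.
Let ggen := cocycle_gen geta.
Let ginvol := cocycle_invol geta.

Fixpoint alt (i j : I) (k : nat) : seq I :=
  if k is k'.+1 then i :: alt j i k' else [::].

Lemma size_alt i j k : size (alt i j k) = k.
Proof. by elim: k i j => //= k IH i j; rewrite IH. Qed.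

Lemma alt_cat i j k l :
  alt i j (k + l) = alt i j k ++ (if odd k then alt j i l else alt i j l).
Proof. by elim: k i j => //= k IH i j; rewrite IH if_neg. Qed.

Lemma alt_ratio i j k :
  wprod g (alt i j k) * (wprod g (alt j i k))^-1 = (g i * g j) ^+ k.
Proof.
have swap n : g i * (g j * g i) ^+ n = (g i * g j) ^+ n * g i.
  elim: n => [|n IH]; first by rewrite mulg1 mul1g.
  by rewrite [in RHS]expgS -[RHS]mulgA -IH expgS !mulgA.
elim: k i j swap => [|k IH] i j swap; first by rewrite !wprod_nil mulgV.
rewrite /= !wprod_cons invMg ginv // -mulgA [X in _ * X]mulgA IH.
  by rewrite mulgA swap -mulgA expgSr.
move=> n; elim: n => [|n IHn]; first by rewrite mulg1 mul1g.
by rewrite [in RHS]expgS -[RHS]mulgA -IHn expgS !mulgA.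
Qed.

Lemma alt_eqP i j k :
  (wprod g (alt i j k) == wprod g (alt j i k)) = (#[g i * g j] %| k)%N.
Proof. by rewrite order_dvdn -alt_ratio eq_mulgV1. Qed.

(** The alternating prefix a, b, ... grows by one letter at a time: the exchange condition for the
    descent b puts b in front and deletes one letter. Each round swaps the two letters, so only the
    unordered pair is controlled. *)
Lemma alt_prefix z i j k :
    (wlen g (g i * z) < wlen g z)%N -> (wlen g (g j * z) < wlen g z)%N ->
    (k <= #[g i * g j])%N ->
  exists a b r, (a, b) \in [:: (i, j); (j, i)] /\ reduced_expr g z (alt a b k ++ r).
Proof.
move=> lti ltj; elim: k => [_|k IH ltk].
  by exists i, j, (rword g z); rewrite inE eqxx; split=> //; apply: rwordP.
have [a [b [r [ab]]]] := IH (ltnW ltk).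
rewrite reduced_exprE // => /andP[/eqP zE /eqP lenE].
have [ltb ordE] : (wlen g (g b * z) < wlen g z)%N /\ #[g a * g b] = #[g i * g j].
  move: ab; rewrite !inE => /orP[] /eqP[-> ->] //.
  by rewrite -(orderV (g i * g j)) invMg !ginv.
exists b, a; have := ltb; rewrite -(simple_ltE geta) -{1}zE => /(exchange geta).
case=> u1 [x [u2 [eqw eqz]]]; rewrite zE in eqz.
(* If the deleted letter lies beyond the first k, the prefix has grown. Otherwise the two
   alternating words of some positive length at most k have the same product, which the order of g i
   g j forbids. *)
have [lep|ltp] := leqP k (size u1).
  exists (drop k u1 ++ u2); split.
    by move: ab; rewrite !inE => /orP[] /eqP[-> ->]; rewrite eqxx ?orbT.
  have eu1 : u1 = alt a b k ++ drop k u1.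
    rewrite -{1}(cat_take_drop k u1); congr (_ ++ _).
    by rewrite -(takel_cat (x :: u2) lep) -eqw -{1}(size_alt a b k) take_size_cat.
  have ew : b :: u1 ++ u2 = alt b a k.+1 ++ (drop k u1 ++ u2).
    by rewrite [in LHS]eu1 -catA.
  rewrite reduced_exprE // -ew /= wprod_cons -eqz mulgg // eqxx -lenE eqw.
  by rewrite !size_cat /= addnS eqxx.
set p := size u1 in ltp.
have eu1 : u1 = alt a b p.
  have : u1 = take p (u1 ++ x :: u2) by rewrite take_size_cat.
  rewrite -eqw takel_cat ?size_alt ?(ltnW ltp) // => ->.
  by rewrite -(subnKC (ltnW ltp)) alt_cat take_size_cat ?size_alt.
have eu1x : rcons u1 x = alt a b p.+1.
  have : rcons u1 x = take p.+1 (rcons u1 x ++ u2).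
    by rewrite take_size_cat ?size_rcons.
  rewrite cat_rcons -eqw takel_cat ?size_alt // => ->.
  by rewrite -{1}(subnKC ltp) alt_cat take_size_cat ?size_alt.
have : wprod g (alt a b p.+1) == wprod g (alt b a p.+1).
  rewrite -eu1x /= wprod_rcons wprod_cons -eu1.
  move: eqz; rewrite -zE eqw !wprod_cat wprod_cons !mulgA => /mulIg eqz.
  by rewrite -{1}eqz -!mulgA ginvol mulg1.
rewrite alt_eqP ordE => /(dvdn_leq (ltn0Sn _)) le.
by have := leq_trans ltk (leq_trans le ltp); rewrite ltnn.
Qed.

(** Monoid form: the maps [f i] need not be invertible, and the braid relations are required only on
    an invariant subset [Q]. Words with first letters i and j are each compared with a reduced word
    of z that begins with an alternating word of length m(i,j); each comparison shares its first
    letter and falls under the induction hypothesis, and the braid relation links the two. *)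
Theorem matsumoto (X : Type) (f : I -> X -> X) (Q : X -> Prop) :
    (forall i x, Q x -> Q (f i x)) ->
    (forall i j x, Q x ->
       foldr f x (alt i j #[g i * g j]) = foldr f x (alt j i #[g i * g j])) ->
  forall u u', reduced g u -> reduced g u' -> wprod g u = wprod g u' ->
  forall x, Q x -> foldr f x u = foldr f x u'.
Proof.
move=> Qf fbraid u u' redu redu' equ.
have [n] := ubnP (size u); elim: n => // n IH in u u' redu redu' equ * => ltn x Qx.
have Qfoldr v : Q (foldr f x v) by elim: v => //= i v; apply: Qf.
have sE : size u = size u'.
  by move: redu redu'; rewrite !reducedE // equ => /eqP-> /eqP->.
case: u u' => [|i u] [|j u'] // in redu redu' equ ltn sE *.
have same a v v' : reduced g (a :: v) -> reduced g (a :: v') ->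
    (size (a :: v) <= n)%N -> wprod g (a :: v) = wprod g (a :: v') ->
    foldr f x (a :: v) = foldr f x (a :: v').
  rewrite /= !wprod_cons => /(reduced_behead ggen) rv /(reduced_behead ggen) rv' le.
  by move=> /mulgI eqv; congr (f a _); apply: (IH).
have [z zE] : exists z, z = wprod g (i :: u) by eexists.
have zE' : z = wprod g (j :: u') by rewrite zE.
have sz : size (i :: u) = wlen g z by apply/eqP; rewrite zE -reducedE.
have lti : (wlen g (g i * z) < wlen g z)%N.
  by rewrite zE wprod_cons mulgg // -wprod_cons -zE -sz ltnS wlen_le.
have ltj : (wlen g (g j * z) < wlen g z)%N.
  by rewrite zE' wprod_cons mulgg // -wprod_cons -zE' -sz sE ltnS wlen_le.
set m := #[g i * g j]; have m0 : (0 < m)%N := order_gt0 _.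
have [a [b [r [ab]]]] := alt_prefix lti ltj (leqnn _); rewrite -/m.
rewrite reduced_exprE // => /andP[/eqP rz /eqP rl].
have altE : wprod g (alt i j m) = wprod g (alt j i m).
  by apply/eqP; rewrite alt_eqP.
have [wi wj] : wprod g (alt i j m ++ r) = z /\ wprod g (alt j i m ++ r) = z.
  by move: ab rz; rewrite !inE !wprod_cat altE => /orP[] /eqP[-> ->]; rewrite ?altE.
have ls : size r + m = wlen g z by rewrite -rl size_cat size_alt addnC.
have ri : reduced g (alt i j m ++ r).
  by rewrite reducedE // wi size_cat size_alt addnC ls.
have rj : reduced g (alt j i m ++ r).
  by rewrite reducedE // wj size_cat size_alt addnC ls.
have step c d v : reduced g (c :: v) -> wprod g (c :: v) = z ->
    (size (c :: v) <= n)%N -> reduced g (alt c d m ++ r) ->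
    wprod g (alt c d m ++ r) = z -> foldr f x (c :: v) = foldr f x (alt c d m ++ r).
  move=> rcv cvz le; rewrite -(prednK m0) /= => rr rrz; apply: same => //.
  by rewrite cvz.
rewrite (step i j u) // (step j i u') // -?sE //.
by rewrite !foldr_cat fbraid.
Qed.

End Matsumoto.

(** * The symmetric group as a Coxeter group *)

Section SymmetricGroup.
Local Open Scope nat_scope.
Local Open Scope group_scope.

Definition inversion m (s t : 'S_m) : bool :=
  [exists a : 'I_m, exists b : 'I_m, [&& (a < b)%N, t == tperm a b & (s b < s a)%N]].

Lemma inversion_tperm m (s : 'S_m) (a b : 'I_m) :
  (a < b)%N -> inversion s (tperm a b) = (s b < s a)%N.
Proof.
move=> ltab; apply/existsP/idP => [[a' /existsP[b' /and3P[lt' /eqP eqt ltb]]]|lts].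
  have Ea : tperm a b a' = b' by rewrite eqt tpermL.
  move: lt' ltb; rewrite -Ea; case: tpermP => [-> //|->|_ _]; first by lia.
  by rewrite ltnn.
by exists a; apply/existsP; exists b; rewrite ltab eqxx.
Qed.

(** For t the transposition of a < b, t ^ s exchanges s a and s b, and the product reverses the pair
    exactly when one, but not both, of s and s' reverses the pair that it meets. If t is no
    transposition, all three terms are false. *)
Lemma inversionM m (s s' t : 'S_m) :
  inversion (s * s') t = inversion s t (+) inversion s' (t ^ s).
Proof.
have inj (r : 'S_m) (a b : 'I_m) : (a < b)%N -> ((r a : nat) == r b) = false.
  by move=> lt; rewrite val_eqE (inj_eq perm_inj); apply/eqP => e; rewrite e ltnn in lt.
have [[a b] /= /andP[lt /eqP ->]|none] :=
    pickP [pred p : 'I_m * 'I_m | (p.1 < p.2)%N && (t == tperm p.1 p.2)].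
  rewrite tpermJ (inversion_tperm _ lt) (inversion_tperm s lt) !permM.
  have [lts|lts|/eqP] := ltngtP (s b) (s a); last by rewrite eq_sym inj.
    rewrite tpermC inversion_tperm //=.
    by have := inj s' _ _ lts; case: ltngtP.
  by rewrite inversion_tperm.
have noninv (r : 'S_m) : inversion r t = false.
  apply/existsP => -[a /existsP[b /and3P[lt /eqP et _]]].
  by have := none (a, b); rewrite /= lt et eqxx.
rewrite !noninv; apply/esym/existsP => -[a /existsP[b /and3P[lt /eqP et _]]].
have {}et : t = tperm (s^-1 a) (s^-1 b) by rewrite -tpermJ -et conjgK.
have [lt'|lt'|/eqP] := ltngtP (s^-1 a) (s^-1 b); last by rewrite inj.
  by have := none (s^-1 a, s^-1 b); rewrite /= lt' et eqxx.
by have := none (s^-1 b, s^-1 a); rewrite /= lt' et tpermC eqxx.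
Qed.

(** Used in two roles: the upper point i+1 moved by [adj_tperm i], and the renumbering of the
    generators of 'S_m as the generators of 'S_m.+1 that fix the point 0. *)
Definition ord_shift m (i : 'I_m.-1) : 'I_m :=
  Ordinal (etrans (esym (ltn_predRL i m)) (ltn_ord i)).

Lemma adj_tpermE m (i : 'I_m.-1) (x : 'I_m) :
  adj_tperm i x =
    (if x == i :> nat then i.+1 else if x == i.+1 :> nat then i : nat else x) :> nat.
Proof.
rewrite /adj_tperm; case: tpermP => [->|->|/eqP nx /eqP nx'] /=.
- by rewrite eqxx.
- by rewrite eqxx; case: eqP => //; lia.
by move: nx nx'; rewrite -!val_eqE /= => /negPf-> /negPf->.
Qed.

Lemma inversionE m (i : 'I_m.-1) (t : 'S_m) :
  inversion (adj_tperm i) t = (t == adj_tperm i).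
Proof.
apply/existsP/eqP => [[c /existsP[d /and3P[lt /eqP -> ]]]|->].
  rewrite !adj_tpermE => ltc; have [ci di] : c = i :> nat /\ d = i.+1 :> nat.
    by move: ltc; case: (@eqP _ (c : nat) i); case: (@eqP _ (c : nat) i.+1);
       case: (@eqP _ (d : nat) i); case: (@eqP _ (d : nat) i.+1); lia.
  by congr tperm; apply/val_inj.
exists (widen_ord (leq_pred m) i); apply/existsP; exists (ord_shift i).
apply/and3P; split; [exact: ltnSn|exact: eqxx|by rewrite tpermR tpermL /=].
Qed.

Lemma adj_tperm_invol m (i : 'I_m.-1) : adj_tperm i * adj_tperm i = 1.
Proof. exact: tperm2. Qed.

Lemma lift_adj_tperm m (i : 'I_m.-1) :
  lift_perm ord0 ord0 (adj_tperm i) = @adj_tperm m.+1 (ord_shift i).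
Proof.
apply/permP => x; case: (unliftP ord0 x) => [j|] ->; last first.
  by rewrite lift_perm_id tpermD // -val_eqE.
rewrite lift_perm_lift; apply/val_inj; rewrite /= !adj_tpermE /= /bump /=.
by case: (@eqP _ (j : nat) i); case: (@eqP _ (j : nat) i.+1);
   case: (@eqP _ (1 + j) i.+1); case: (@eqP _ (1 + j) i.+2); lia.
Qed.

Lemma lift_wprod m (u : seq 'I_m.-1) :
  wprod (@adj_tperm m.+1) (map (@ord_shift m) u)
  = lift_perm ord0 ord0 (wprod (@adj_tperm m) u).
Proof.
elim: u => [|i u IH]; first by rewrite !wprod_nil lift_perm1.
by rewrite /= !wprod_cons IH -lift_adj_tperm lift_permM.
Qed.

(** The letters 0, 1, ..., j-1 (for j at most m): a reduced word of the permutation that sends 0 to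
    j and is increasing on the other points. These permutations represent the cosets of 'S_m in
    'S_m.+1. *)
Fixpoint cycle_word m j : seq 'I_m :=
  match m, j with
  | m'.+1, j'.+1 => ord0 :: map (lift ord0) (cycle_word m' j')
  | _, _ => [::]
  end.

Lemma ord_shiftE m (i : 'I_m) : @ord_shift m.+1 i = lift ord0 i.
Proof. exact/val_inj. Qed.

Lemma wprod_cycle_word m (j : 'I_m.+1) :
  wprod (@adj_tperm m.+1) (cycle_word m j) = lift_perm ord0 j 1.
Proof.
elim: m j => [|m IH] j.
  by rewrite ord1 wprod_nil lift_perm1.
case: (unliftP ord0 j) => [j'|] ->; last by rewrite wprod_nil lift_perm1.
rewrite /= -(eq_map (@ord_shiftE m)) wprod_cons lift_wprod IH.
apply/permP => x; rewrite permM.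
have t0 : @adj_tperm m.+2 ord0 ord0 = lift ord0 ord0.
  by apply/val_inj; rewrite /= adj_tpermE.
have t1 : @adj_tperm m.+2 ord0 (lift ord0 ord0) = ord0.
  by apply/val_inj; rewrite /= adj_tpermE.
have t2 z : @adj_tperm m.+2 ord0 (lift ord0 (lift ord0 z)) = lift ord0 (lift ord0 z).
  by apply/val_inj; rewrite /= adj_tpermE.
case: (unliftP ord0 x) => [y|] ->; last by rewrite t0 lift_perm_lift !lift_perm_id.
rewrite lift_perm_lift perm1; case: (unliftP ord0 y) => [z|] ->.
  rewrite t2 !lift_perm_lift perm1.
  by apply/val_inj; rewrite /= /bump /=; lia.
by rewrite t1 lift_perm_id; apply/val_inj.
Qed.

Lemma lift_perm_cycle m (s : 'S_m) (j : 'I_m.+1) :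
  lift_perm ord0 ord0 s * lift_perm ord0 j 1 = lift_perm ord0 j s.
Proof. by rewrite lift_permM mulg1. Qed.

Lemma lift_perm_bij m :
  bijective (fun p : 'S_m * 'I_m.+1 => lift_perm ord0 p.2 p.1).
Proof.
apply: inj_card_bij => [[s j] [s' j'] /= eqp|]; last first.
  by rewrite card_prod !card_Sn card_ord factS mulnC.
have ej : j = j' by have := congr1 (fun p : 'S_m.+1 => p ord0) eqp; rewrite !lift_perm_id.
congr pair => //; apply/permP => x; rewrite -ej in eqp.
have := congr1 (fun p : 'S_m.+1 => p (lift ord0 x)) eqp.
by rewrite !lift_perm_lift => /lift_inj.
Qed.

Lemma adj_tperm_gen m (s : 'S_m) : exists u, wprod (@adj_tperm m) u = s.
Proof.
elim: m s => [|m IH] s.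
  by exists [::]; apply/permP => -[].
have [f _ fK] := lift_perm_bij m; have [u uE] := IH (f s).1.
exists (map (@ord_shift m) u ++ cycle_word m (f s).2).
by rewrite wprod_cat lift_wprod wprod_cycle_word uE lift_perm_cycle fK.
Qed.

Lemma inversion_cocycle m : reflection_cocycle (@adj_tperm m) (@inversion m).
Proof.
split; [exact: adj_tperm_gen|exact: adj_tperm_invol|exact: inversionM|exact: inversionE].
Qed.

Lemma reduced_cons_inversion m i u :
  reduced (@adj_tperm m) (i :: u) =
  reduced (@adj_tperm m) u && ~~ inversion (wprod (@adj_tperm m) u) (adj_tperm i).
Proof.
rewrite (reduced_cons (inversion_cocycle m)) (simple_ltE (inversion_cocycle m)).
by rewrite (simple_leNgt (inversion_cocycle m)) negbK wprod_cons.
Qed.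

Lemma inversion_adj m (s : 'S_m) (i : 'I_m.-1) :
  inversion s (adj_tperm i)
  = (s (ord_shift i) < s (widen_ord (leq_pred m) i))%N.
Proof. by rewrite /adj_tperm inversion_tperm. Qed.

Lemma lift_ltn m (h : 'I_m.+1) (i j : 'I_m) : (lift h i < lift h j)%N = (i < j)%N.
Proof. by rewrite /= /bump; lia. Qed.

(** Lengths add because [lift j] is increasing: a pair of nonzero points is inverted by the product
    exactly when the 'S_m factor inverts the corresponding pair. *)
Lemma reduced_lift_cat m (u : seq 'I_m.-1) (j : 'I_m.+1) :
  reduced (@adj_tperm m) u -> reduced (@adj_tperm m.+1) (cycle_word m j) ->
  reduced (@adj_tperm m.+1) (map (@ord_shift m) u ++ cycle_word m j).
Proof.
elim: u => //= i u IH redu redj; move: redu; rewrite reduced_cons_inversion.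
case/andP => /IH-/(_ redj) red ninv; rewrite reduced_cons_inversion red /=.
rewrite wprod_cat lift_wprod wprod_cycle_word lift_perm_cycle.
move: ninv; rewrite !inversion_adj.
rewrite (_ : @ord_shift m.+1 _ = lift ord0 (ord_shift i)); last exact/val_inj.
rewrite (_ : widen_ord (leq_pred m.+1) (ord_shift i) =
   lift ord0 (widen_ord (leq_pred m) i)); last exact/val_inj.
by rewrite !lift_perm_lift lift_ltn.
Qed.

Lemma reduced_nil (G : finGroupType) (I : finType) (g : I -> G) : reduced g [::].
Proof. exact/reducedP. Qed.

Lemma reduced_cycle_word m (j : 'I_m.+1) :
  reduced (@adj_tperm m.+1) (cycle_word m j).
Proof.
elim: m j => [|m IH] j; first exact: reduced_nil.
case: (unliftP ord0 j) => [j'|] ->; last exact: reduced_nil.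
rewrite /= -(eq_map (@ord_shiftE m)) reduced_cons_inversion.
have := @reduced_lift_cat m.+1 _ ord0 (IH j') (reduced_nil _).
rewrite cats0 => -> /=.
rewrite lift_wprod inversion_adj -leqNgt.
rewrite (_ : widen_ord _ _ = ord0); last exact/val_inj.
by rewrite lift_perm_id.
Qed.

Lemma order_adj_tperm m (i j : 'I_m.-1) :
  (i <= j)%N ->
  #[adj_tperm i * adj_tperm j] = (if i == j then 1 else if i.+1 < j then 2 else 3)%N.
Proof.
move=> leij; case: eqP => [<-|/eqP]; first by rewrite adj_tperm_invol order1.
rewrite -val_eqE /= => neij.
have ne1 : adj_tperm i * adj_tperm j != 1.
  apply/eqP => /permP/(_ (widen_ord (leq_pred m) i))/(congr1 val) /=.
  rewrite permM perm1 !adj_tpermE /= eqxx.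
  by case: (@eqP _ i.+1 (j : nat)); case: (@eqP _ i.+1 j.+1) => //; lia.
pose sw (a n : nat) := if n == a then a.+1 else if n == a.+1 then a else n.
have swE (k : 'I_m.-1) (x : 'I_m) : adj_tperm k x = sw k x :> nat by rewrite adj_tpermE.
have swP a n : [\/ n = a /\ sw a n = a.+1, n = a.+1 /\ sw a n = a
    | [/\ n <> a, n <> a.+1 & sw a n = n]].
  rewrite /sw; case: eqP => [->|ne]; first by constructor 1.
  by case: eqP => [->|ne']; [constructor 2|constructor 3].
(* 2 and 3 are prime, so it remains to see that the square or the cube fixes every point, by running
   through the positions of x. *)
case: ifP => cmp; apply: nt_prime_order => //; apply/permP => x; apply/val_inj;
  rewrite !expgS expg0 mulg1 !permM perm1 /= !swE;
  repeat match goal with |- context [sw ?a ?n] =>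
    lazymatch n with context [sw _ _] => fail | _ => idtac end;
    case: (swP a n) => [[? ->]|[? ->]|[? ? ->]]; try (exfalso; lia) end;
  lia.
Qed.

End SymmetricGroup.

(** * The reflection cocycle of a Coxeter system *)

Section CoxeterCocycle.
Local Open Scope nat_scope.
Local Open Scope group_scope.
Context (W : finGroupType) (S : {set W}) (coxS : coxeter_system S).

Local Notation s := (@simple W S).

Lemma simple_invol i : s i * s i = 1.
Proof.
have := expg_order (s i); rewrite (cox_involution coxS (enum_valP i)).
by rewrite expgS expg1.
Qed.

Lemma simple_gen x : exists u, wprod s u = x.
Proof.
have : x \in <<S>> by rewrite (cox_gen coxS) inE.
case/gen_prodgP => n [c cS ->].
exists [seq enum_rank_in (cS i) (c i) | i <- index_enum 'I_n].
rewrite /wprod big_map; apply: eq_bigr => i _.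
by rewrite /simple enum_rankK_in.
Qed.

(* x acts on W * bool; the bit is flipped at t = x. For simple x this is the  *)
(* action on pairs (reflection, sign), i.e. on abstract roots.                *)
Definition sign_act (x : W) (p : W * bool) : W * bool := (p.1 ^ x, p.2 (+) (p.1 == x)).

Lemma sign_act_inj x : injective (sign_act x).
Proof.
by move=> [t e] [t' e'] [/conjg_inj -> /addIb ->].
Qed.

Definition sign_perm x : {perm W * bool} := perm (@sign_act_inj x).

(** With c = x y, k rounds flip the bit of (r, e) once for each i < 2k such that r = c^i x. For k
    the order of c, the indices i and k + i give the same condition, so the number of flips is
    even. *)
Lemma sign_perm_braid : {in S &, forall x y,
  (sign_perm x * sign_perm y) ^+ #[x * y] = 1}.
Proof.
move=> x y xS yS; set c := x * y.
have inv z : z \in S -> z^-1 = z.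
  move=> zS; apply/eqP; rewrite eq_invg_mul -{2}[z]expg1 -expgS.
  by rewrite -(cox_involution coxS zS) expg_order.
have xcV k : x * c ^- k = c ^+ k * x.
  rewrite -expVgn /c invMg (inv x) // (inv y) //; elim: k => [|k IH].
    by rewrite mulg1 mul1g.
  by rewrite [in RHS]expgS -[RHS]mulgA -IH expgS !mulgA.
have E k r e : ((sign_perm x * sign_perm y) ^+ k) (r, e)
    = (r ^ (c ^+ k), e (+) odd (\sum_(i < k.*2) (r == (c ^+ i * x)%g))%N).
  elim: k => [|k IH]; first by rewrite perm1 big_ord0 conjg1 addbF.
  rewrite expgSr permM IH permM !permE /sign_act /= -!conjgM doubleS.
  have [d Ed] : exists d, d = k.*2 by eexists.
  rewrite -Ed !big_ord_recr /= !oddD !addbA !oddb; congr (_, _ (+) _ (+) _).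
  - by rewrite expgSr.
  - rewrite -(inj_eq (@conjg_inj _ (c ^- k))) conjgK conjgE invgK xcV mulgA.
    by rewrite Ed -addnn expgD.
  rewrite -(inj_eq (@conjg_inj _ (c ^+ k * x)^-1)) conjgK conjgE invgK.
  rewrite invMg (inv x) // -!mulgA (mulgA x y) -/c xcV.
  by rewrite mulgA -expgSr !mulgA -expgD Ed -addnn addSn.
apply/permP => -[r e]; rewrite E perm1 expg_order conjg1; congr pair.
rewrite -addnn big_split_ord /= oddD.
rewrite [X in odd X (+) _](eq_bigr (fun i : 'I_#[c] => (r == c ^+ (#[c] + i) * x) : nat)).
  by rewrite addbb addbF.
by move=> i _; rewrite expgD expg_order mul1g.
Qed.

(** The universal property extends [sign_perm] to a homomorphism phi from W to permutations, and
    [eta x t] is the bit that phi x gives to (t, false). Additivity of the bits under composition is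
    [cocycleM]. *)
Lemma coxeter_cocycle : exists eta, reflection_cocycle s eta.
Proof.
have [phi phiM phiE] := cox_presentation coxS sign_perm_braid.
have phi1 : phi 1 = 1 by apply: (mulgI (phi 1)); rewrite -phiM !mulg1.
have phiS i p : phi (s i) p = sign_act (s i) p.
  have -> : phi (s i) = sign_perm (s i) by apply: phiE; apply: enum_valP.
  by rewrite permE.
have E x t e : phi x (t, e) = (t ^ x, e (+) (phi x (t, false)).2).
  have [u <-] := simple_gen x; elim: u t e => [|i u IH] t e.
    by rewrite wprod_nil phi1 !perm1 conjg1 addbF.
  rewrite wprod_cons phiM !permM !phiS /sign_act.
  by rewrite IH [in RHS]IH conjgM /= addbA.
exists (fun x t => (phi x (t, false)).2); split.
- exact: simple_gen.
- exact: simple_invol.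
- by move=> x y t; rewrite phiM permM E [in LHS]E.
- by move=> i t; rewrite phiS.
Qed.

End CoxeterCocycle.

(** * The geometric representation and its roots *)

Section GeometricRepresentation.
Context (R : realType) (W : finGroupType) (S : {set W}) (coxS : coxeter_system S).

Local Notation n := #|S|.
Local Notation hR := 'rV[R]_n.
Local Notation s := (@simple W S).
Local Notation a_ := (@sroot R W S).
Local Notation B := (@bform R W S).
Local Notation len := (wlen s).
Local Notation ord i j := #[(s i * s j)%g]%g.
Local Notation refl := (@sreflection R W S).

Implicit Types (x y z : hR).

Let ggen := simple_gen coxS.
Let ginvol := simple_invol coxS.

Lemma bformDl x y z : B (x + y) z = B x z + B y z.
Proof. by rewrite /bform !mulmxDl mxE. Qed.

Lemma bformZl c x z : B (c *: x) z = c * B x z.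
Proof. by rewrite /bform -!scalemxAl mxE. Qed.

Lemma bform_root i j : B (a_ i) (a_ j) = gram R S i j.
Proof. by rewrite /bform -rowE trmx_delta -colE !mxE. Qed.

Lemma ord_sym i j : ord i j = ord j i.
Proof. by rewrite -(orderV (s i * s j)%g) invMg !(ginv ginvol). Qed.

Lemma gram_sym : (gram R S)^T = gram R S.
Proof. by apply/matrixP => i j; rewrite !mxE ord_sym. Qed.

Lemma bformC x y : B x y = B y x.
Proof.
have tr (M : 'M[R]_1) : M 0 0 = M^T 0 0 by rewrite mxE.
by rewrite {1}/bform tr !trmx_mul trmxK gram_sym mulmxA.
Qed.

Lemma bformDr x y z : B z (x + y) = B z x + B z y.
Proof. by rewrite bformC bformDl !(bformC z). Qed.

Lemma bformZr c x z : B z (c *: x) = c * B z x.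
Proof. by rewrite bformC bformZl (bformC z). Qed.

Lemma bformNr x z : B z (- x) = - B z x.
Proof. by rewrite -scaleN1r bformZr mulN1r. Qed.

Lemma bformNl x z : B (- x) z = - B x z.
Proof. by rewrite bformC bformNr bformC. Qed.

Lemma bform_self i : B (a_ i) (a_ i) = 1.
Proof. by rewrite bform_root mxE ginvol order1 divr1 cospi opprK. Qed.

Lemma reflD i x y : refl i (x + y) = refl i x + refl i y.
Proof. by rewrite /sreflection bformDl mulrDr scalerDl addrACA opprD. Qed.

Lemma reflZ i c x : refl i (c *: x) = c *: refl i x.
Proof. by rewrite /sreflection bformZl scalerBr scalerA; congr (_ - _ *: _); ring. Qed.

Lemma refl_root i : refl i (a_ i) = - a_ i.
Proof. by rewrite /sreflection bform_self mulr1 mulr2n scalerDl scale1r opprD addrA subrr sub0r. Qed.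

Lemma reflK i : involutive (refl i).
Proof.
move=> x; have E : B (refl i x) (a_ i) = - B x (a_ i).
  by rewrite /sreflection bformDl bformNl bformZl bform_self; ring.
by rewrite [LHS]/sreflection E mulrN scaleNr opprK subrK.
Qed.

Lemma refl_bform i x y : B (refl i x) (refl i y) = B x y.
Proof.
rewrite /sreflection !(bformDl, bformDr, bformNl, bformNr, bformZl, bformZr) bform_self.
by rewrite (bformC (a_ i) y); ring.
Qed.

Lemma foldr_reflD u x y : foldr refl (x + y) u = foldr refl x u + foldr refl y u.
Proof. by elim: u => //= i u ->; rewrite reflD. Qed.

Lemma foldr_reflZ u c x : foldr refl (c *: x) u = c *: foldr refl x u.
Proof. by elim: u => //= i u ->; rewrite reflZ. Qed.

Lemma foldr_reflK u x : foldr refl (foldr refl x (rev u)) u = x.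
Proof. by elim: u x => //= i u IH x; rewrite rev_cons -cats1 foldr_cat IH reflK. Qed.

Lemma foldr_reflVK u x : foldr refl (foldr refl x u) (rev u) = x.
Proof. by rewrite -{1}(revK u) foldr_reflK. Qed.

Lemma rev_alt (i j : 'I_n) k : rev (alt i j k.+1) = (if odd k then j else i) :: rev (alt i j k).
Proof.
by rewrite -addn1 alt_cat rev_cat; case: (odd k).
Qed.

Lemma rev_altE (i j : 'I_n) k : rev (alt i j k) = if odd k then alt i j k else alt j i k.
Proof. by elim: k i j => // k IH i j; rewrite rev_alt IH /=; case: (odd k). Qed.

Lemma ord_gt1 i j : i != j -> (1 < ord i j)%N.
Proof.
move=> ne; rewrite ltn_neqAle order_gt0 andbT eq_sym order_eq1.
apply: contra ne => /eqP e; apply/eqP/enum_val_inj.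
by rewrite -[enum_val i](ginv ginvol); apply/eqP; rewrite eq_invg_mul; apply/eqP.
Qed.

Section Dihedral.
Context (i j : 'I_n) (neij : i != j).
Local Notation m := (ord i j).
Let theta : R := trigo.pi / m%:R.

Lemma m_gt0 : 0 < m%:R :> R. Proof. by rewrite ltr0n order_gt0. Qed.

Lemma theta_sin k : (k <= m)%N -> 0 <= sin (k%:R * theta).
Proof.
move=> lek; apply: sin_ge0_pi; apply/andP; split.
  by rewrite mulr_ge0 ?divr_ge0 ?pi_ge0.
rewrite /theta mulrCA ler_piMr ?pi_ge0 // ler_pdivrMr ?mul1r ?ler_nat //.
exact: m_gt0.
Qed.

Lemma theta_gt0 : 0 < sin theta.
Proof.
apply: sin_gt0_pi; rewrite divr_gt0 ?pi_gt0 ?m_gt0 //=.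
by rewrite ltr_pdivrMr ?m_gt0 // ltr_pMr ?pi_gt0 // ltr1n; exact: ord_gt1.
Qed.

Lemma bform_theta : B (a_ i) (a_ j) = - cos theta.
Proof. by rewrite bform_root mxE. Qed.

(** The Chebyshev value U_(k-1) at cos theta; the coordinates of the roots in the plane of [a_ i]
    and [a_ j] obey its three-term recurrence. *)
Definition dsin k : R := sin (k%:R * theta) / sin theta.

Lemma dsin_ge0 k : (k <= m)%N -> 0 <= dsin k.
Proof. by move=> lek; rewrite divr_ge0 ?theta_sin // ltW ?theta_gt0. Qed.

Lemma dsin0 : dsin 0 = 0. Proof. by rewrite /dsin mul0r sin0 mul0r. Qed.
Lemma dsin1 : dsin 1 = 1.
Proof. by rewrite /dsin mul1r divff // gt_eqF ?theta_gt0. Qed.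

Lemma dsinS k : dsin k.+2 = 2%:R * cos theta * dsin k.+1 - dsin k.
Proof.
rewrite /dsin mulrA -mulrBl; congr (_ / _).
rewrite -!natr1 !mulrDl !mul1r; set y := k%:R * theta.
rewrite {1}sinD -[in sin y](addrK theta y) sinB; ring.
Qed.

Lemma dsin_2m : dsin m.*2 = 0 /\ dsin m.*2.+1 = 1.
Proof.
have e : m.*2%:R * theta = trigo.pi *+ 2.
  rewrite -muln2 natrM /theta -mulr_natl.
  by field; rewrite gt_eqF ?m_gt0.
rewrite /dsin e sin2pi mul0r -natr1 mulrDl e mul1r addrC sinD2pi divff //.
by rewrite gt_eqF ?theta_gt0.
Qed.

Lemma refl_theta : refl j (a_ i) = a_ i + (2%:R * cos theta) *: a_ j
  /\ refl i (a_ j) = a_ j + (2%:R * cos theta) *: a_ i.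
Proof.
by split; rewrite /sreflection ?(bformC (a_ j)) bform_theta mulrN scaleNr opprK.
Qed.

(** The list is reversed so that s_j acts first, then s_i, and so on. The larger index sits on the
    root whose reflection acted last, or on [a_ i] when k = 0. *)
Lemma foldr_alt_root k : foldr refl (a_ i) (rev (alt j i k)) =
  if odd k then dsin k *: a_ i + dsin k.+1 *: a_ j
  else dsin k.+1 *: a_ i + dsin k *: a_ j.
Proof.
have [ri rj] := refl_theta.
elim: k => [|k IH].
  by rewrite /= dsin0 dsin1 scale0r scale1r addr0.
rewrite rev_alt [LHS]/= IH dsinS [odd k.+1]/=.
case: (odd k) => /=; rewrite reflD !reflZ refl_root.
  by rewrite rj; apply/rowP => l; rewrite !mxE; ring.
by rewrite ri; apply/rowP => l; rewrite !mxE; ring.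
Qed.

End Dihedral.

(** The rotation (s_i s_j)^m fixes the plane of the two roots, by the closed formula at 2m steps,
    and every vector orthogonal to both. The form is nondegenerate on that plane, so these vectors
    span the space. *)
Lemma refl_braid i j x :
  foldr refl x (alt i j (ord i j)) = foldr refl x (alt j i (ord i j)).
Proof.
have [->//|ne] := eqVneq i j; set m := ord i j.
(* The alternating word of length 2m is one side of the claim followed by the inverse of the other
   side. *)
suff full y : foldr refl y (alt i j (m + m)) = y.
  have e : alt i j (m + m) = alt i j m ++ rev (alt j i m).
    by rewrite alt_cat rev_altE; case: (odd m).
  have := full (foldr refl x (alt j i m)).
  by rewrite e foldr_cat foldr_reflVK.
have ei : foldr refl (a_ i) (alt i j (m + m)) = a_ i.
  have [e0 e1] := dsin_2m ne.
  have := foldr_alt_root ne m.*2; rewrite rev_altE odd_double /= e0 e1 addnn.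
  by rewrite scale0r scale1r addr0.
have ej : foldr refl (a_ j) (alt i j (m + m)) = a_ j.
  have ne' : j != i by rewrite eq_sym.
  have [e0 e1] := dsin_2m ne'.
  have := foldr_alt_root ne' m.*2; rewrite rev_altE odd_double /=.
  rewrite -ord_sym -/m in e0 e1 *; rewrite e0 e1 scale0r scale1r addr0 => {1}<-.
  have -> : alt i j (m + m) = rev (alt j i m.*2) by rewrite rev_altE odd_double addnn.
  by rewrite foldr_reflVK.
(* 1 - c^2 is the Gram determinant of the two roots, equal to the square of sin theta. Below, a and
   b are the coordinates of the orthogonal projection of y to their plane. *)
set c := B (a_ i) (a_ j); have c2 : 1 - c ^+ 2 != 0.
  by rewrite /c bform_theta sqrrN -sin2cos2 expf_neq0 // gt_eqF ?theta_gt0.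
set p := B y (a_ i); set q := B y (a_ j).
set a := (p - c * q) / (1 - c ^+ 2); set b := (q - c * p) / (1 - c ^+ 2).
set z := y - (a *: a_ i + b *: a_ j).
have bi : B z (a_ i) = 0.
  rewrite /z bformDl bformNl bformDl !bformZl bform_self (bformC (a_ j)).
  by rewrite -/c -/p /a /b; field.
have bj : B z (a_ j) = 0.
  rewrite /z bformDl bformNl bformDl !bformZl bform_self.
  by rewrite -/c -/q /a /b; field.
have zi : refl i z = z by rewrite /sreflection bi mulr0 scale0r subr0.
have zj : refl j z = z by rewrite /sreflection bj mulr0 scale0r subr0.
have zk k : foldr refl z (alt i j k) = z /\ foldr refl z (alt j i k) = z.
  by elim: k => //= k [-> ->].
have -> : y = z + (a *: a_ i + b *: a_ j) by rewrite /z subrK.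
by rewrite foldr_reflD (zk _).1 foldr_reflD !foldr_reflZ ei ej.
Qed.

Lemma wact_reduced u x : reduced s u -> foldr refl x u = wact (wprod s u) x.
Proof.
have [eta geta] := coxeter_cocycle coxS => red.
apply: (matsumoto geta (Q := fun=> True)) => //; last 1 first.
- by rewrite wprod_rword.
- by move=> i j y _; apply: refl_braid.
exact: reduced_rword.
Qed.

Lemma wact_simple i w x : wact (s i * w)%g x = refl i (wact w x).
Proof.
have [eta geta] := coxeter_cocycle coxS.
have up v : (len v < len (s i * v))%N -> wact (s i * v)%g x = refl i (wact v x).
  move=> lt; have E : (s i * v)%g = wprod s (i :: rword s v).
    by rewrite wprod_cons wprod_rword.
  rewrite E -wact_reduced // (reduced_cons geta) reduced_rword //.
  by rewrite wprod_cons wprod_rword.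
case: (boolP (len w < len (s i * w))%N) => [/up //|].
rewrite -(simple_leNgt geta) => lt; have := up (s i * w)%g.
by rewrite !mulgg // => /(_ lt) ->; rewrite reflK.
Qed.

Lemma wact1 x : wact (1 : W) x = x.
Proof. by rewrite -(wprod_nil s) -wact_reduced //; apply/reducedP. Qed.

Lemma wact_wprod u x : wact (wprod s u) x = foldr refl x u.
Proof.
by elim: u => [|i u IH]; rewrite ?wprod_nil ?wact1 // wprod_cons wact_simple IH.
Qed.

Lemma wactM u v x : wact (u * v)%g x = wact u (wact v x).
Proof.
have [u' <-] := ggen u; have [v' <-] := ggen v.
by rewrite -wprod_cat !wact_wprod foldr_cat.
Qed.

Lemma wact_gen i x : wact (s i) x = refl i x.
Proof. by rewrite -[s i]mulg1 wact_simple wact1. Qed.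

Lemma wactD u x y : wact u (x + y) = wact u x + wact u y.
Proof. by have [u' <-] := ggen u; rewrite !wact_wprod foldr_reflD. Qed.

Lemma wactZ u c x : wact u (c *: x) = c *: wact u x.
Proof. by have [u' <-] := ggen u; rewrite !wact_wprod foldr_reflZ. Qed.

Lemma wactN u x : wact u (- x) = - wact u x.
Proof. by rewrite -scaleN1r wactZ scaleN1r. Qed.

Lemma wactK u x : wact u^-1%g (wact u x) = x.
Proof. by rewrite -wactM mulVg wact1. Qed.

Lemma wactVK u x : wact u (wact u^-1%g x) = x.
Proof. by rewrite -wactM mulgV wact1. Qed.

Lemma wact_bform u x y : B (wact u x) (wact u y) = B x y.
Proof.
have [u' <-] := ggen u; rewrite !wact_wprod.
by elim: u' => //= i v IH; rewrite refl_bform.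
Qed.

(** Induction on the length of w. A right descent j gives factorizations w = v d with lengths
    adding, d an alternating product of s_i and s_j that ends in s_j. For d as long as possible, v
    is lengthened by s_i and by s_j and sends both simple roots to nonnegative vectors, while d
    sends [a_ i] to a combination of them whose coefficients are values of [dsin] at indices at most
    m, hence nonnegative. *)
Lemma wact_pos w i k : (len w < len (w * s i)%g)%N -> 0 <= wact w (a_ i) 0 k.
Proof.
have [eta geta] := coxeter_cocycle coxS.
have [N] := ubnP (len w); elim: N => // N IH in w i k *; rewrite ltnS => leN lti.
have [->|nw] := eqVneq w 1%g; first by rewrite wact1 mxE; case: (_ && _); rewrite ?ler01.
have [j] : exists j, (len (w * s j)%g < len w)%N.
  have [j ltj] : exists j, (len (s j * w^-1)%g < len w^-1)%N.
    by apply: (exists_descent geta); rewrite invg_eq1.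
  exists j; move: ltj; rewrite -(wlenV ggen ginvol (_ * _)%g) invMg invgK (ginv ginvol).
  by rewrite (wlenV ggen ginvol).
move=> ltj; have ne : i != j by apply: contraTneq lti => ->; rewrite -leqNgt ltnW.
pose P k := [exists v, (v * wprod s (rev (alt j i k)) == w)%g && (len v + k == len w)%N].
have P1 : P 1%N.
  apply/existsP; exists (w * s j)%g; rewrite wprod_cons wprod_nil mulg1 -mulgA ginvol mulg1 eqxx.
  by case: (len_simplerP geta j w); lia.
have Pub k' : P k' -> (k' <= len w)%N by case/existsP => v /andP[_ /eqP <-]; apply: leq_addl.
have exP : exists k', P k' by exists 1%N.
case: (ex_maxnP exP Pub) => p /existsP[v /andP[/eqP wE /eqP lenE]] maxp.
have p0 : (0 < p)%N by apply: maxp.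
have lenrev u v' : (len (v' * wprod s u)%g <= len v' + size u)%N.
  by rewrite (leq_trans (wlenM ggen _ _)) // leq_add2l wlen_le.
(* An alternating word of length m can be rewritten to end in s_i, which would make i a descent of
   w. *)
have ltp : (p < ord i j)%N.
  rewrite ltnNge; apply/negP => lem.
  have E : wprod s (rev (alt j i (ord i j))) = wprod s (rev (alt i j (ord i j))).
    rewrite !wprod_rev //; congr (_^-1)%g; apply/eqP.
    by rewrite (alt_eqP geta) ord_sym.
  have [q qE] : exists q, p = (q + ord i j)%N by exists (p - ord i j)%N; rewrite subnK.
  have [u [su uE]] : exists u, size u = q /\ rev (alt j i p) = u ++ rev (alt j i (ord i j)).
    rewrite qE addnC alt_cat rev_cat; eexists; split; last by [].
    by rewrite size_rev; case: ifP; rewrite size_alt.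
  move: wE; rewrite uE wprod_cat E.
  have := order_gt0 (s i * s j)%g; case em: (ord i j) => [//|m'] _ wE.
  have : wprod s (rev (alt i j m'.+1)) = (wprod s (rev (alt j i m')) * s i)%g.
    by rewrite /= rev_cons wprod_rcons.
  move=> wE'; move: lti; rewrite -{2}wE wE' -!mulgA ginvol mulg1 mulgA ltnNge.
  have := lenrev (u ++ rev (alt j i m')) v; rewrite wprod_cat size_cat su size_rev size_alt.
  by rewrite !mulgA => le; rewrite -lenE qE em; lia.
have ltv : (len v < N)%N by lia.
pose b := if odd p then i else j; pose b' := if odd p then j else i.
have posb : (len v < len (v * s b)%g)%N.
  case: (len_simplerP geta b v) => [->//|lenv].
  suff /maxp : P p.+1 by rewrite ltnn.
  apply/existsP; exists (v * s b)%g; rewrite rev_alt wprod_cons -/b.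
  by rewrite -mulgA mulgg // wE eqxx -lenE lenv addSnnS /=.
(* [b'] is the first letter of the alternating word; if it shortened v, cancelling it would write w
   with two letters too few. *)
have posb' : (len v < len (v * s b')%g)%N.
  case: (len_simplerP geta b' v) => [->//|lenv].
  case: p @b @b' lenv {maxp ltp posb} p0 wE lenE => // p b b' lenv _.
  rewrite rev_alt wprod_cons (_ : (if odd p then i else j) = b') => [wE lenE|]; last first.
    by rewrite /b' /=; case: (odd p).
  have := lenrev (rev (alt j i p)) (v * s b')%g; rewrite -mulgA wE size_rev size_alt; lia.
have [vi vj] : (len v < len (v * s i)%g)%N /\ (len v < len (v * s j)%g)%N.
  by move: posb posb'; rewrite /b /b'; case: (odd p).
rewrite -wE wactM wact_wprod (foldr_alt_root ne).
by case: ifP => _; rewrite wactD !wactZ !mxE addr_ge0 // mulr_ge0 ?IH ?dsin_ge0 // ltnW.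
Qed.

End GeometricRepresentation.

(** * Roots, their signs and their reflections *)

Section Roots.
Context (R : realType) (W : finGroupType) (S : {set W}) (coxS : coxeter_system S).

Local Notation n := #|S|.
Local Notation hR := 'rV[R]_n.
Local Notation s := (@simple W S).
Local Notation a_ := (@sroot R W S).
Local Notation B := (@bform R W S).
Local Notation len := (wlen s).
Local Notation rr := (@root_reflection R W S).
Local Notation is_root := (@is_root R W S).
Local Notation is_posroot := (@is_posroot R W S).
Implicit Types (x y z a b : hR).

Let ggen := simple_gen coxS.
Let ginvol := simple_invol coxS.

Lemma wact_simple_root w i : wact (w * s i)%g (a_ i) = - wact w (a_ i).
Proof. by rewrite wactM // wact_gen // refl_root // wactN. Qed.

Lemma wact_neg w i k : (len (w * s i)%g < len w)%N -> wact w (a_ i) 0 k <= 0.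
Proof.
move=> lt; have := @wact_pos R _ _ coxS (w * s i)%g i k.
by rewrite -mulgA ginvol mulg1 wact_simple_root mxE oppr_ge0; apply.
Qed.

Lemma exists_rdescent w : w != 1%g -> exists i, (len (w * s i)%g < len w)%N.
Proof.
have [eta geta] := coxeter_cocycle coxS => nw.
have [|j ltj] := @exists_descent _ _ _ _ geta w^-1%g; first by rewrite invg_eq1.
exists j; move: ltj; rewrite -(wlenV ggen ginvol (_ * _)%g) invMg invgK.
by rewrite (ginv ginvol) (wlenV ggen ginvol).
Qed.

(** A nontrivial element sends some simple root to a nonpositive vector. Since [root_reflection]
    picks an arbitrary u and b with a = u(b), it is by faithfulness that the result can be
    identified from its action. *)
Lemma wact_faithful u v : (forall x, wact u x = wact v x) -> u = v.
Proof.
move=> eq; apply/eqP; rewrite eq_sym eq_mulVg1; apply/negPn/negP => /exists_rdescent[i lt].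
have := wact_neg i lt; rewrite wactM // eq wactK // mxE !eqxx.
by rewrite ler10.
Qed.

Lemma root_form a : is_root a -> B a a = 1.
Proof. by case/existsP => u /existsP[i /eqP->]; rewrite wact_bform // bform_self. Qed.

Lemma root_neq0 a : is_root a -> a != 0.
Proof.
move=> ra; apply/eqP => a0; move: (root_form ra); rewrite a0.
by rewrite -(scale0r (0 : hR)) bformZl mul0r => /eqP; rewrite eq_sym oner_eq0.
Qed.

Lemma is_root_wact u a : is_root (wact u a) = is_root a.
Proof.
have imp v b : is_root b -> is_root (wact v b).
  case/existsP => u' /existsP[i /eqP->]; apply/existsP; exists (v * u')%g.
  by apply/existsP; exists i; rewrite wactM.
by apply/idP/idP => [/(imp u^-1%g)|/(imp u)//]; rewrite wactK.
Qed.

Lemma is_root_sroot i : is_root (a_ i).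
Proof. by apply/existsP; exists 1%g; apply/existsP; exists i; rewrite wact1. Qed.

Lemma is_rootN a : is_root (- a) = is_root a.
Proof.
have imp b : is_root b -> is_root (- b).
  case/existsP => u /existsP[i /eqP->].
  by rewrite -wact_simple_root is_root_wact is_root_sroot.
by apply/idP/idP => /imp; rewrite ?opprK.
Qed.

Lemma posroot_is_root a : is_posroot a -> is_root a.
Proof. by case/andP. Qed.

Lemma root_signP a : is_root a -> is_posroot a || is_posroot (- a).
Proof.
move=> ra; rewrite /Defs.is_posroot is_rootN ra /=.
have [eta geta] := coxeter_cocycle coxS.
case/existsP: ra => u /existsP[i /eqP->].
case: (len_simplerP geta i u) => lenE; apply/orP; [left|right]; apply/forallP => k.
  by apply: wact_pos => //; rewrite lenE.
by rewrite mxE oppr_ge0; apply: wact_neg; rewrite lenE.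
Qed.

Lemma posrootN a : is_posroot a -> is_posroot (- a) = false.
Proof.
move=> pa; apply/negP => pna; have /eqP[] := root_neq0 (posroot_is_root pa).
case/andP: pa pna => _ /forallP pa /andP[_ /forallP pna]; apply/rowP => k.
by apply/eqP; rewrite mxE eq_le pa andbT; have := pna k; rewrite mxE oppr_ge0.
Qed.

Lemma posroot_sroot i : is_posroot (a_ i).
Proof.
rewrite /Defs.is_posroot is_root_sroot; apply/forallP => k.
by rewrite mxE; case: (_ && _); rewrite ?ler01.
Qed.

Lemma root_reflectionE a x : is_root a -> wact (rr a) x = x - (2%:R * B x a) *: a.
Proof.
rewrite /root_reflection; case: pickP => [[u i] /= /eqP -> _|none].
  rewrite !wactM // wact_gen // /sreflection wactD // wactN // wactZ // wactVK //.
  by rewrite -[B (wact _ _) _](wact_bform coxS u) wactVK.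
by case/existsP => u /existsP[i e]; have := none (u, i); rewrite /= e.
Qed.

Lemma root_reflection_uniq a u : is_root a ->
  (forall x, wact u x = x - (2%:R * B x a) *: a) -> rr a = u.
Proof. by move=> ra uE; apply: wact_faithful => x; rewrite uE root_reflectionE. Qed.

Lemma root_reflectionN a : is_root a -> rr (- a) = rr a.
Proof.
move=> ra; apply: root_reflection_uniq => [|x]; rewrite ?is_rootN ?root_reflectionE //.
by rewrite bformNr // mulrN scaleNr scalerN opprK.
Qed.

Lemma root_reflection_wact u a : is_root a -> rr (wact u a) = (u * rr a * u^-1)%g.
Proof.
move=> ra; apply: root_reflection_uniq => [|x]; first by rewrite is_root_wact.
rewrite !wactM // root_reflectionE // wactD // wactN // wactZ // wactVK //.
by rewrite -[B (wact _ _) _](wact_bform coxS u) wactVK.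
Qed.

Lemma root_reflection_sroot i : rr (a_ i) = s i.
Proof.
by apply: root_reflection_uniq => [|x]; rewrite ?is_root_sroot ?wact_gen.
Qed.

Lemma root_reflection_self a : is_root a -> wact (rr a) a = - a.
Proof.
move=> ra; rewrite root_reflectionE // root_form // mulr1 mulr2n scalerDl scale1r.
by rewrite opprD addrA subrr sub0r.
Qed.

Lemma root_reflection_invol a : is_root a -> (rr a * rr a = 1)%g.
Proof.
case/existsP => u /existsP[i /eqP->].
rewrite root_reflection_wact ?is_root_sroot // root_reflection_sroot.
by rewrite !mulgA mulgKV -(mulgA u) ginvol mulg1 mulgV.
Qed.

(** Evaluating both reflections at a gives a = B(a,b) b, and both roots have norm 1, so the factor
    is 1 or -1. *)
Lemma root_reflection_inj a b : is_root a -> is_root b -> rr a = rr b ->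
  a = b \/ a = - b.
Proof.
move=> ra rb eqr; have := root_reflection_self ra; rewrite eqr root_reflectionE //.
move=> e; have E : a = B a b *: b.
  apply: (scalerI (a := 2%:R)); first by rewrite pnatr_eq0.
  rewrite scalerA; apply/eqP; rewrite -subr_eq0 mulr2n scalerDl scale1r -addrA e.
  by rewrite subrr.
have := root_form ra; rewrite E bformZl bformZr // root_form // mulr1 -expr2.
move/eqP; rewrite sqrf_eq1 => /orP[] /eqP ->; first by left; rewrite scale1r.
by right; rewrite scaleN1r.
Qed.

(* u (-) reverses the sign of a simple root exactly at a right descent of u. *)
Lemma wact_sroot_simple u i j : (u * s i * u^-1)%g = s j ->
  (len (u * s i)%g < len u)%N -> wact u (a_ i) = - a_ j.
Proof.
move=> eqj lt; have [||||e] := @root_reflection_inj (- wact u (a_ i)) (a_ j).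
- by rewrite is_rootN is_root_wact is_root_sroot.
- exact: is_root_sroot.
- rewrite root_reflectionN ?is_root_wact ?is_root_sroot //.
  by rewrite root_reflection_wact ?is_root_sroot // !root_reflection_sroot.
- by move=> <-; rewrite opprK.
have := wact_neg j lt; rewrite -[wact _ _]opprK e opprK mxE !eqxx.
by rewrite ler10.
Qed.

End Roots.

(** * Linear maps on free modules *)

Section LinearExtensionTheory.
Context (K : choiceType) (C : comNzRingType).

Lemma malg_linear_ind (Q : {malg C[K]} -> Prop) :
    Q 0 -> (forall c a b, Q a -> Q b -> Q (c *: a + b)) -> (forall k, Q << k >>) ->
  forall a, Q a.
Proof.
move=> Q0 QP Qk a; rewrite [a]monalgE; elim: (enum_fset _) => [|k r IH].
  by rewrite big_nil.
rewrite big_cons; have -> : << a@_k *g k >> = a@_k *: << k >> :> {malg C[K]}.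
  by apply/malgP => l; rewrite mcoeffZ !mcoeffU mulr_natr.
exact: QP.
Qed.

Lemma linextU (V : lmodType C) (f : K -> V) k : linext f << k >> = f k.
Proof.
rewrite (linextEw f msuppU_le).
by rewrite big_seq_fset1 mcoeffUU scale1r.
Qed.

Lemma linext_scalable (V : lmodType C) (f : K -> V) : scalable (linext f).
Proof.
move=> c a; rewrite (linextEw f (msuppZ_le c a)) /linext scaler_sumr.
by apply: eq_bigr => k _; rewrite mcoeffZ scalerA.
Qed.

HB.instance Definition _ (V : lmodType C) (f : K -> V) :=
  GRing.isScalable.Build C {malg C[K]} V *:%R (linext f) (linext_scalable f).

Lemma malg_linear_eq (V : lmodType C) (f g : {malg C[K]} -> V) :
  linear f -> linear g -> (forall k, f << k >> = g << k >>) -> f =1 g.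
Proof.
move=> linf ling fg; apply: malg_linear_ind => [|c a b fa fb|//].
  have zero (h : {malg C[K]} -> V) : linear h -> h 0 = 0.
    by move=> linh; have := linh (-1) 0 0; rewrite scaler0 addr0 scaleN1r addNr.
  by rewrite !zero.
by rewrite linf ling fa fb.
Qed.

End LinearExtensionTheory.

Section Linearity.
Context (C : comNzRingType) (U V X : lmodType C).

Lemma linear_compf (f : V -> X) (g : U -> V) :
  linear f -> linear g -> linear (fun a => f (g a)).
Proof. by move=> linf ling c a b; rewrite ling linf. Qed.

Lemma lin0 (f : U -> V) : linear f -> f 0 = 0.
Proof. by move=> linf; have := linf (-1) 0 0; rewrite scaler0 addr0 scaleN1r addNr. Qed.

Lemma linZ (f : U -> V) c a : linear f -> f (c *: a) = c *: f a.
Proof. by move=> linf; have := linf c a 0; rewrite (lin0 linf) !addr0. Qed.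

Lemma linD (f : U -> V) a b : linear f -> f (a + b) = f a + f b.
Proof. by move=> linf; have := linf 1 a b; rewrite !scale1r. Qed.

Lemma linN (f : U -> V) a : linear f -> f (- a) = - f a.
Proof. by move=> linf; rewrite -!scaleN1r linZ. Qed.

Lemma linB (f : U -> V) a b : linear f -> f (a - b) = f a - f b.
Proof. by move=> linf; rewrite linD // linN. Qed.

Lemma lin_sum (J : Type) (r : seq J) (Q : pred J) (F : J -> U) (f : U -> V) :
  linear f -> f (\sum_(j <- r | Q j) F j) = \sum_(j <- r | Q j) f (F j).
Proof.
by move=> linf; apply: (big_morph f) => [a b|]; [apply: linD|apply: lin0].
Qed.

Lemma linear_add (f g : U -> V) : linear f -> linear g -> linear (fun a => f a + g a).
Proof. by move=> linf ling c a b; rewrite linf ling scalerDr addrACA. Qed.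

Lemma linear_opp (f : U -> V) : linear f -> linear (fun a => - f a).
Proof. by move=> linf c a b; rewrite linf opprD scalerN. Qed.

Lemma linear_scale d (f : U -> V) : linear f -> linear (fun a => d *: f a).
Proof. by move=> linf c a b; rewrite linf scalerDr !scalerA mulrC. Qed.

Lemma linear_id : linear (fun a : U => a). Proof. by []. Qed.

Lemma linear_bigsum (J : Type) (r : seq J) (P : pred J) (f : J -> U -> V) :
  (forall j, linear (f j)) -> linear (fun a => \sum_(j <- r | P j) f j a).
Proof.
move=> linf c a b; rewrite scaler_sumr -big_split.
by apply: eq_bigr => j _; rewrite linf.
Qed.

End Linearity.

Section MonoidAlgebra.
Context (K : monomType) (C : comNzRingType).
Local Notation A := {malg C[K]}.

Lemma malg_scalerAr c (a b : A) : a * (c *: b) = c *: (a * b).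
Proof.
rewrite (@malgMEw _ _ _ _ _ _ (fsubset_refl (msupp a)) (msuppZ_le c b)) malgME.
rewrite scaler_sumr; apply: eq_bigr => k _; rewrite scaler_sumr; apply: eq_bigr => l _.
by apply/malgP => m; rewrite !mcoeffZ !mcoeffU mulrCA mulrnAr.
Qed.

End MonoidAlgebra.

(** * The tensor algebra and its skew derivations *)

(* The operations are sealed because unification otherwise unfolds products in *)
(* the free algebra.                                                          *)
HB.lock Definition tmul (R : realType) (W : finGroupType) (S : {set W})
  (a b : tensor_alg R S) : tensor_alg R S := a * b.
Reserved Notation "a ** b" (at level 40, left associativity).
Notation "a ** b" := (tmul a b) : ring_scope.
HB.lock Definition word (R : realType) (W : finGroupType) (S : {set W})
  (u : seq (posroot R S)) : tensor_alg R S := tword (FMonom u).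
HB.lock Definition tgen_locked (R : realType) (W : finGroupType) (S : {set W})
  (a : posroot R S) : tensor_alg R S := Defs.tgen a.
HB.lock Definition xroot_locked (R : realType) (W : finGroupType) (S : {set W})
  (r : 'rV[R]_#|S|) : tensor_alg R S := Defs.xroot r.
HB.lock Definition tact_locked (R : realType) (W : finGroupType) (S : {set W})
  (g : W) (b : tensor_alg R S) : tensor_alg R S := Defs.tact g b.
HB.lock Definition hcomp_locked (R : realType) (W : finGroupType) (S : {set W})
  (m : nat) (b : tensor_alg R S) : tensor_alg R S := Defs.hcomp m b.
HB.lock Definition braid_locked (R : realType) (W : finGroupType) (S : {set W})
  (i : nat) (b : tensor_alg R S) : tensor_alg R S := Defs.braid i b.

Section TensorAlgebraTheory.
Context (R : realType) (W : finGroupType) (S : {set W}) (coxS : coxeter_system S).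

Local Notation n := #|S|.
Local Notation hR := 'rV[R]_n.
Local Notation C := (R[i]%C).
Local Notation P := (posroot R S).
Local Notation T := (tensor_alg R S).
Local Notation is_root := (@is_root R W S).
Local Notation xroot := (@xroot_locked R W S).
Local Notation tgen := (@tgen_locked R W S).
Local Notation word := (@word R W S).
Implicit Types (x y z p q r : hR).

Lemma tmulE (a b : T) : a ** b = a * b. Proof. by rewrite tmul.unlock. Qed.

Lemma tmulA (a b c : T) : a ** (b ** c) = a ** b ** c.
Proof. by rewrite tmul.unlock mulrA. Qed.

Lemma tmulDl (a b c : T) : (a + b) ** c = a ** c + b ** c.
Proof. by rewrite tmul.unlock mulrDl. Qed.

Lemma tmulDr (a b c : T) : a ** (b + c) = a ** b + a ** c.
Proof. by rewrite tmul.unlock mulrDr. Qed.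

Lemma tmulZl c (a b : T) : (c *: a) ** b = c *: (a ** b).
Proof. by rewrite tmul.unlock scalerAl. Qed.

Lemma tmulZr c (a b : T) : a ** (c *: b) = c *: (a ** b).
Proof. by rewrite tmul.unlock malg_scalerAr. Qed.

Lemma tmulNl (a b : T) : (- a) ** b = - (a ** b).
Proof. by rewrite tmul.unlock mulNr. Qed.

Lemma tmulNr (a b : T) : a ** (- b) = - (a ** b).
Proof. by rewrite tmul.unlock mulrN. Qed.

Lemma tmul0l (a : T) : 0 ** a = 0.
Proof. by rewrite tmul.unlock mul0r. Qed.

Lemma tmul0r (a : T) : a ** 0 = 0.
Proof. by rewrite tmul.unlock mulr0. Qed.

Lemma word_nil : word [::] = 1.
Proof. by rewrite word.unlock /tword -fmoneE. Qed.

Lemma tmul1l (a : T) : word [::] ** a = a.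
Proof. by rewrite tmul.unlock word_nil mul1r. Qed.

Lemma tmul1r (a : T) : a ** word [::] = a.
Proof. by rewrite tmul.unlock word_nil mulr1. Qed.

Lemma wordM u v : word (u ++ v) = word u ** word v.
Proof.
rewrite tmul.unlock word.unlock /tword malgM_def fgmulUU mulr1.
by congr << _ >>; apply: val_inj; rewrite /= fmM.
Qed.

Lemma tgenE a : tgen a = word [:: a].
Proof. by rewrite tgen_locked.unlock word.unlock /Defs.tgen fmuE. Qed.

Lemma word_cons a u : word (a :: u) = tgen a ** word u.
Proof. by rewrite tgenE -wordM. Qed.

Lemma linear_mull (U : lmodType C) (d : T) (f : U -> T) :
  linear f -> linear (fun a => d ** f a).
Proof. by move=> linf c a b; rewrite linf tmulDr tmulZr. Qed.

Lemma linear_mulr (U : lmodType C) (d : T) (f : U -> T) :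
  linear f -> linear (fun a => f a ** d).
Proof. by move=> linf c a b; rewrite linf tmulDl tmulZl. Qed.

Lemma twordE k : tword k = word (fmonom_val k).
Proof. by rewrite word.unlock fmK. Qed.

Lemma linext_word (V : lmodType C) (f : {fmonom P} -> V) u :
  linext f (word u) = f (FMonom u).
Proof. by rewrite word.unlock; apply: linextU. Qed.

Lemma word_linear_eq (V : lmodType C) (f g : T -> V) :
  linear f -> linear g -> (forall u, f (word u) = g (word u)) -> f =1 g.
Proof.
move=> linf ling fg; apply: malg_linear_eq => // k.
by have := fg (fmonom_val k); rewrite -twordE.
Qed.

Lemma root_val (a : P) : is_root (val a).
Proof. exact/posroot_is_root/valP. Qed.
#[local] Hint Resolve root_val : core.

Lemma xroot_pos a : xroot (val a) = tgen a.
Proof. by rewrite xroot_locked.unlock tgen_locked.unlock /Defs.xroot valK. Qed.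

Lemma xroot_neg a : xroot (- val a) = - tgen a.
Proof.
rewrite xroot_locked.unlock tgen_locked.unlock /Defs.xroot.
by rewrite insubN ?(posrootN coxS (valP a)) // opprK valK.
Qed.

Lemma rootP r : is_root r -> exists a : P, r = val a \/ r = - val a.
Proof.
case/(root_signP coxS)/orP => pr; first by exists (Sub r pr); left.
by exists (Sub (- r) pr); right; rewrite SubK opprK.
Qed.

Lemma xrootN r : is_root r -> xroot (- r) = - xroot r.
Proof.
by case/rootP => a [->|->]; rewrite ?opprK xroot_pos xroot_neg ?opprK.
Qed.

End TensorAlgebraTheory.

(** The value at x_r of the coordinate functional dual to x_p, extended to all roots by x_(-r) = -
    x_r. *)
Definition root_pairing (R : realType) (W : finGroupType) (S : {set W})
    (p r : 'rV[R]_#|S|) : R[i]%C :=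
  (p == r)%:R - (p == - r)%:R.

(** A sum over the letters of the word: each is braided to the front and then paired with p. Passing
    x_a turns x_b into x_(s_a b), and pairing the latter with p is pairing x_b with s_a p; hence the
    moving index in this twisted Leibniz rule. *)
Fixpoint skew_word (R : realType) (W : finGroupType) (S : {set W})
    (p : 'rV[R]_#|S|) (u : seq (posroot R S)) : tensor_alg R S :=
  if u is a :: u' then
    root_pairing p (val a) *: word u'
    + tgen_locked a ** skew_word (wact (root_reflection (val a)) p) u'
  else 0.

HB.lock Definition skew (R : realType) (W : finGroupType) (S : {set W})
    (p : 'rV[R]_#|S|) (b : tensor_alg R S) : tensor_alg R S :=
  linext (fun k : {fmonom (posroot R S)} => skew_word p (fmonom_val k)) b.

Section SkewDerivations.
Context (R : realType) (W : finGroupType) (S : {set W}) (coxS : coxeter_system S).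

Local Notation n := #|S|.
Local Notation hR := 'rV[R]_n.
Local Notation C := (R[i]%C).
Local Notation P := (posroot R S).
Local Notation T := (tensor_alg R S).
Local Notation rr := (@root_reflection R W S).
Local Notation is_root := (@is_root R W S).
Local Notation xroot := (@xroot_locked R W S).
Local Notation tgen := (@tgen_locked R W S).
Local Notation word := (@word R W S).
Local Notation tact := (@tact_locked R W S).
Implicit Types (x y z p q r : hR).
Local Notation skew := (@skew R W S).
Local Notation rpair := (@root_pairing R W S).
#[local] Hint Resolve root_val : core.

Lemma pairNl p r : rpair (- p) r = - rpair p r.
Proof. by rewrite /rpair eqr_oppLR eqr_opp opprB. Qed.

Lemma pairNr p r : rpair p (- r) = - rpair p r.
Proof. by rewrite /rpair opprK opprB. Qed.

Lemma pair_wact g p r : rpair (wact g p) (wact g r) = rpair p r.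
Proof.
have inj : injective (@wact R W S g) := can_inj (wactK coxS g).
by rewrite /rpair -wactN // !(inj_eq inj).
Qed.

Lemma skew_linear p : linear (skew p).
Proof. by rewrite skew.unlock; apply: linearP. Qed.

Lemma skewB p a b : skew p (a - b) = skew p a - skew p b.
Proof. exact/linB/skew_linear. Qed.

Lemma skewNr p a : skew p (- a) = - skew p a.
Proof. exact/linN/skew_linear. Qed.

Lemma skew0 p : skew p 0 = 0.
Proof. exact/lin0/skew_linear. Qed.

Lemma skew_wordE p u : skew p (word u) = skew_word p u.
Proof. by rewrite skew.unlock; apply: linext_word. Qed.

Lemma skew1 p : skew p (word [::]) = 0.
Proof. by rewrite skew_wordE. Qed.

Lemma skew_tgen p a b :
  skew p (tgen a ** b) = rpair p (val a) *: b + tgen a ** skew (wact (rr (val a)) p) b.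
Proof.
move: b; apply: word_linear_eq => [||u].
- exact/(linear_compf (@skew_linear _))/linear_mull/linear_id.
- apply: linear_add; first exact/linear_scale/linear_id.
  exact/linear_mull/skew_linear.
by rewrite -word_cons !skew_wordE.
Qed.

Lemma skew_xroot p r b : is_root r ->
  skew p (xroot r ** b) = rpair p r *: b + xroot r ** skew (wact (rr r) p) b.
Proof.
case/(rootP coxS) => a [->|->].
  by rewrite xroot_pos skew_tgen.
rewrite (xroot_neg coxS) !tmulNl skewNr skew_tgen pairNr scaleNr opprD.
by rewrite (root_reflectionN coxS (root_val a)).
Qed.

Lemma skewN p b : skew (- p) b = - skew p b.
Proof.
move: b; apply: word_linear_eq => [||u]; [exact: skew_linear|exact/linear_opp/skew_linear|].
elim: u p => [|a u IH] p; first by rewrite !skew1 oppr0.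
by rewrite word_cons !skew_tgen pairNl scaleNr wactN // IH tmulNr opprD.
Qed.

Definition counit (b : T) : C := mcoeff (FMonom [::]) (b : {malg C[{fmonom P}]}).

Lemma eps_linear : linear_for *%R counit.
Proof. by move=> c a b; rewrite /counit mcoeffD mcoeffZ. Qed.

Lemma eps_word u : counit (word u) = (u == [::])%:R.
Proof. by rewrite /counit word.unlock /tword mcoeffU1 fmP. Qed.

Lemma eps1 : counit (word [::]) = 1.
Proof. by rewrite eps_word. Qed.

Lemma eps_tgen a b : counit (tgen a ** b) = 0.
Proof.
have lin : linear (fun b => counit (tgen a ** b) : C^o).
  by move=> c d e; rewrite tmulDr tmulZr eps_linear.
move: b; apply: (word_linear_eq lin) => [c d e|u]; first by rewrite scaler0 addr0.
by rewrite -word_cons eps_word.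
Qed.

Fixpoint skews (l : seq P) (b : T) : T :=
  if l is p :: l' then skews l' (skew (val p) b) else b.

Lemma skews_linear l : linear (skews l).
Proof. by elim: l => //= p l IH c a b; rewrite skew_linear IH. Qed.

Lemma tact_linear g : linear (tact g).
Proof. by rewrite tact_locked.unlock; apply: linearP. Qed.

Lemma tactD g (a b : T) : tact g (a + b) = tact g a + tact g b.
Proof. exact/linD/tact_linear. Qed.

Lemma tactZ g c (a : T) : tact g (c *: a) = c *: tact g a.
Proof. exact/linZ/tact_linear. Qed.

Lemma tactN g (a : T) : tact g (- a) = - tact g a.
Proof. exact/linN/tact_linear. Qed.

Lemma tact_wordE g u : tact g (word u) = \prod_(a <- u) xroot (wact g (val a)).
Proof. by rewrite tact_locked.unlock xroot_locked.unlock; apply: linext_word. Qed.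

Lemma tact1 g : tact g (word [::]) = word [::].
Proof. by rewrite tact_wordE big_nil word_nil. Qed.

Lemma tact_word g a u : tact g (word (a :: u)) = xroot (wact g (val a)) ** tact g (word u).
Proof. by rewrite !tact_wordE big_cons tmulE. Qed.

Lemma tactM g (a b : T) : tact g (a ** b) = tact g a ** tact g b.
Proof.
move: b; apply: word_linear_eq => [||v].
- exact/(linear_compf (@tact_linear _))/linear_mull/linear_id.
- exact/linear_mull/tact_linear.
move: a; apply: word_linear_eq => [||u].
- exact/(linear_compf (@tact_linear _))/linear_mulr/linear_id.
- exact/linear_mulr/tact_linear.
elim: u => [|a u IH]; first by rewrite tact1 !tmul1l.
by rewrite -wordM cat_cons !tact_word wordM IH tmulA.
Qed.

Lemma tact_tgen g a : tact g (tgen a) = xroot (wact g (val a)).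
Proof. by rewrite tgenE tact_word tact1 tmul1r. Qed.

Lemma tact_xroot g r : is_root r -> tact g (xroot r) = xroot (wact g r).
Proof.
case/(rootP coxS) => a [->|->]; first by rewrite xroot_pos tact_tgen.
by rewrite (xroot_neg coxS) tactN tact_tgen (wactN coxS) (xrootN coxS) // (is_root_wact coxS).
Qed.

Lemma tact_id (a : T) : tact 1 a = a.
Proof.
move: a; apply: word_linear_eq => [||u]; [exact: tact_linear|exact: linear_id|].
elim: u => [|a u IH]; first by rewrite tact1.
by rewrite tact_word IH (wact1 coxS) xroot_pos word_cons.
Qed.

Lemma skew_tact g p (b : T) : skew (wact g p) (tact g b) = tact g (skew p b).
Proof.
move: b; apply: word_linear_eq => [||u].
- exact/(linear_compf (@skew_linear _))/tact_linear.
- exact/(linear_compf (@tact_linear _))/skew_linear.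
elim: u p => [|a u IH] p; first by rewrite tact1 !skew1 (lin0 (@tact_linear _)).
have rga : is_root (wact g (val a)).
  by rewrite (is_root_wact coxS); apply: root_val.
rewrite tact_word word_cons skew_tgen tactD tactM tact_tgen tactZ.
rewrite (skew_xroot _ _ rga) pair_wact (root_reflection_wact coxS _ (root_val a)).
by rewrite -(wactM coxS) mulgKV (wactM coxS) IH.
Qed.

End SkewDerivations.

Section Homogeneous.
Context (R : realType) (W : finGroupType) (S : {set W}) (coxS : coxeter_system S).

Local Notation n := #|S|.
Local Notation hR := 'rV[R]_n.
Local Notation C := (R[i]%C).
Local Notation T := (tensor_alg R S).
Local Notation is_root := (@is_root R W S).
Local Notation xroot := (@xroot_locked R W S).
Local Notation tgen := (@tgen_locked R W S).
Local Notation word := (@word R W S).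
Local Notation hcomp m := (@hcomp_locked R W S m).
Implicit Types (x y z p q r : hR).

Lemma hcomp_linear m : linear (hcomp m).
Proof. by rewrite hcomp_locked.unlock; apply: linearP. Qed.

Lemma hcomp_word m u : hcomp m (word u) = if size u == m then word u else 0.
Proof.
by rewrite hcomp_locked.unlock /Defs.hcomp linext_word twordE.
Qed.

Definition homogeneous m (a : T) : Prop := hcomp m a = a.

Lemma homog_word u : homogeneous (size u) (word u).
Proof. by rewrite /homogeneous hcomp_word eqxx. Qed.

Lemma hcompK m a : homogeneous m (hcomp m a).
Proof.
rewrite /homogeneous; move: a; apply: word_linear_eq => [||u].
- exact/(linear_compf (@hcomp_linear _))/hcomp_linear.
- exact: hcomp_linear.
by rewrite hcomp_word; case: ifP => [e|_]; [rewrite hcomp_word e|exact/lin0/hcomp_linear].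
Qed.

Lemma homog_linear_eq m (V : lmodType C) (f g : T -> V) :
    linear f -> linear g -> (forall u, size u = m -> f (word u) = g (word u)) ->
  forall a, homogeneous m a -> f a = g a.
Proof.
move=> linf ling fg a <-; move: a; apply: word_linear_eq => [||u].
- exact/(linear_compf linf)/hcomp_linear.
- exact/(linear_compf ling)/hcomp_linear.
rewrite hcomp_word; case: eqP => [/fg //|_].
have zero (h : T -> V) : linear h -> h 0 = 0.
  by move=> linh; have := linh (-1) 0 0; rewrite scaler0 addr0 scaleN1r addNr.
by rewrite !zero.
Qed.

Lemma homog_linear m m' (f : T -> T) : linear f ->
    (forall u, size u = m -> homogeneous m' (f (word u))) ->
  forall a, homogeneous m a -> homogeneous m' (f a).
Proof.
move=> linf fh; apply: homog_linear_eq => //.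
exact/(linear_compf (@hcomp_linear _)).
Qed.

Lemma hcomp_tgen m a b : hcomp m.+1 (tgen a ** b) = tgen a ** hcomp m b.
Proof.
move: b; apply: word_linear_eq => [||u].
- exact/(linear_compf (@hcomp_linear _))/linear_mull/linear_id.
- exact/linear_mull/hcomp_linear.
by rewrite -word_cons !hcomp_word eqSS; case: eqP; rewrite ?tmul0r ?word_cons.
Qed.

Lemma hcomp_xroot m r b : is_root r -> hcomp m.+1 (xroot r ** b) = xroot r ** hcomp m b.
Proof.
case/(rootP coxS) => a [->|->]; first by rewrite xroot_pos hcomp_tgen.
by rewrite (xroot_neg coxS) !tmulNl -hcomp_tgen; apply/linN/hcomp_linear.
Qed.

Lemma homog_xroot m r b : is_root r -> homogeneous m b -> homogeneous m.+1 (xroot r ** b).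
Proof. by move=> ir hb; rewrite /homogeneous (hcomp_xroot _ _ ir) hb. Qed.

Lemma homog_tgen m a b : homogeneous m b -> homogeneous m.+1 (tgen a ** b).
Proof. by move=> hb; rewrite /homogeneous hcomp_tgen hb. Qed.

Lemma homog_coef m a k : homogeneous m a -> size (fmonom_val k) <> m -> a@_k = 0.
Proof.
move=> ha ne.
have lin : linear (fun a : T => a@_k : C^o) by move=> c d e; rewrite mcoeffD mcoeffZ.
rewrite -[LHS]/((fun a : T => a@_k : C^o) a).
apply: (homog_linear_eq lin (g := fun=> 0) _ _ ha) => [c d e|u su].
  by rewrite scaler0 addr0.
by rewrite word.unlock /tword mcoeffU1; case: eqP => // e; case: ne; rewrite -e.
Qed.

Lemma skew_homog m p a : homogeneous m.+1 a -> homogeneous m (skew p a).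
Proof.
move: a; apply: homog_linear; first exact: skew_linear.
have zero k : hcomp k 0 = 0 by apply/lin0/hcomp_linear.
elim: m p => [|m IH] p [|a u] su; try discriminate su; case: su => su;
  rewrite word_cons skew_tgen /homogeneous hcomp_linear.
  by move/size0nil: su => ->; rewrite skew1 tmul0r zero hcomp_word.
by rewrite hcomp_word su eqxx hcomp_tgen (IH _ u su).
Qed.

End Homogeneous.

(** * The braided factorial and the Nichols ideal *)

Section BraidedFactorial.
Context (R : realType) (W : finGroupType) (S : {set W}) (coxS : coxeter_system S).

Local Notation n := #|S|.
Local Notation hR := 'rV[R]_n.
Local Notation T := (tensor_alg R S).
Local Notation rr := (@root_reflection R W S).
Local Notation is_root := (@is_root R W S).
Local Notation xroot := (@xroot_locked R W S).
Local Notation tgen := (@tgen_locked R W S).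
Local Notation word := (@word R W S).
Local Notation braid i := (@braid_locked R W S i).
Implicit Types (x y z p q r : hR).
Local Notation homog := (@homogeneous R W S).

Lemma braid_linear i : linear (braid i).
Proof. by rewrite braid_locked.unlock; apply: linearP. Qed.

Lemma braid_wordE i u : braid i (word u) =
  if drop i u is a :: b :: k then
    word (take i u) ** xroot (wact (rr (val a)) (val b)) ** tgen a ** word k
  else word u.
Proof.
rewrite braid_locked.unlock /Defs.braid linext_word /braid_word tmul.unlock word.unlock.
rewrite xroot_locked.unlock tgen_locked.unlock.
by case: (drop i u) => [|a [|b k]].
Qed.

Lemma braidN i b : braid i (- b) = - braid i b.
Proof. exact/linN/braid_linear. Qed.

Lemma braid_word0 a b u :
  braid 0 (word [:: a, b & u]) = xroot (wact (rr (val a)) (val b)) ** (tgen a ** word u).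
Proof. by rewrite braid_wordE drop0 take0 tmul1l -tmulA. Qed.

Lemma braid_wordS i a u : braid i.+1 (word (a :: u)) = tgen a ** braid i (word u).
Proof.
rewrite !braid_wordE; change (drop i.+1 (a :: u)) with (drop i u).
change (take i.+1 (a :: u)) with (a :: take i u).
case: (drop i u) => [|x [|y k]]; rewrite word_cons; [reflexivity|reflexivity|].
by rewrite !tmulA.
Qed.

Lemma braidS i a b : braid i.+1 (tgen a ** b) = tgen a ** braid i b.
Proof.
move: b; apply: word_linear_eq => [||u].
- exact/(linear_compf (@braid_linear _))/linear_mull/linear_id.
- exact/linear_mull/braid_linear.
by rewrite -word_cons braid_wordS.
Qed.

Lemma braidS_xroot i r b : is_root r -> braid i.+1 (xroot r ** b) = xroot r ** braid i b.
Proof.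
case/(rootP coxS) => a [->|->]; first by rewrite xroot_pos braidS.
by rewrite (xroot_neg coxS) !tmulNl braidN braidS.
Qed.

Lemma braid0_tgen a r b : is_root r ->
  braid 0 (tgen a ** (xroot r ** b)) = xroot (wact (rr (val a)) r) ** (tgen a ** b).
Proof.
have main c : braid 0 (tgen a ** (tgen c ** b)) =
    xroot (wact (rr (val a)) (val c)) ** (tgen a ** b).
  move: b; apply: word_linear_eq => [||u].
  - exact/(linear_compf (@braid_linear _))/linear_mull/linear_mull/linear_id.
  - exact/linear_mull/linear_mull/linear_id.
  by rewrite -!word_cons braid_word0 word_cons.
case/(rootP coxS) => c [->|->]; first by rewrite xroot_pos main.
have rc : is_root (wact (rr (val a)) (val c)).
  by rewrite (is_root_wact coxS); apply: root_val.
by rewrite (xroot_neg coxS) tmulNl tmulNr braidN main (wactN coxS) (xrootN coxS rc) tmulNl.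
Qed.

Lemma braid0_xroot q r b : is_root q -> is_root r ->
  braid 0 (xroot q ** (xroot r ** b)) = xroot (wact (rr q) r) ** (xroot q ** b).
Proof.
case/(rootP coxS) => a [->|->] ir; first by rewrite xroot_pos braid0_tgen.
rewrite (xroot_neg coxS) !tmulNl tmulNr braidN (braid0_tgen _ _ ir).
by rewrite (root_reflectionN coxS (root_val a)).
Qed.

Lemma braid_homog m i a : homog m a -> homog m (braid i a).
Proof.
move: a; apply: homog_linear; first exact: braid_linear.
move=> u; elim: u i m => [|a u IH] i m <-.
  by rewrite braid_wordE; apply: homog_word.
case: i => [|i]; last by rewrite braid_wordS; apply: homog_tgen; apply: IH.
case: u {IH} => [|b u]; first by rewrite braid_wordE; apply: homog_word.
rewrite braid_word0; apply: (homog_xroot coxS); last exact/homog_tgen/homog_word.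
by rewrite (is_root_wact coxS); apply: root_val.
Qed.

Lemma braid_far i j u : (i.+1 < j)%N -> (j.+1 < size u)%N ->
  braid i (braid j (word u)) = braid j (braid i (word u)).
Proof.
elim: i j u => [|i IH] j u lt ltu;
  (case: u ltu => [|a u] ltu; first by exfalso; rewrite ltn0 in ltu);
  (case: j lt ltu => [|j] lt ltu; first by exfalso; rewrite ltn0 in lt); last first.
  by rewrite !word_cons !braidS (IH _ _ lt ltu).
case: j lt ltu => [|j] lt ltu; first by exfalso; rewrite ltnn in lt.
case: u ltu => [|b u] ltu; first by exfalso; rewrite ltnS ltn0 in ltu.
have rab : is_root (wact (rr (val a)) (val b)).
  by rewrite (is_root_wact coxS); apply: root_val.
rewrite braid_word0 (braidS_xroot _ _ rab) braidS !word_cons !braidS -!xroot_pos xroot_pos.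
by rewrite (braid0_tgen _ _ (root_val b)).
Qed.

(** On words of only i+2 letters [braid i.+1] is the identity, and the relation would say that
    [braid i] is idempotent. This explains the bound on the size, and the homogeneity invariant with
    which Matsumoto's theorem is applied to braidings. *)
Lemma braid_adj i u : (i.+2 < size u)%N ->
  braid i (braid i.+1 (braid i (word u))) = braid i.+1 (braid i (braid i.+1 (word u))).
Proof.
elim: i u => [|i IH] u ltu;
  (case: u ltu => [|a u] ltu; first by exfalso; rewrite ltn0 in ltu); last first.
  by rewrite !word_cons !braidS (IH _ ltu).
case: u ltu => [|b u] ltu; first by exfalso; rewrite ltnS ltn0 in ltu.
case: u ltu => [|c u] ltu; first by exfalso; rewrite !ltnS ltn0 in ltu.
rewrite !word_cons -!xroot_pos.
have [ra rb rc] : [/\ is_root (val a), is_root (val b) & is_root (val c)].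
  by split; apply: root_val.
have rw g r : is_root r -> is_root (wact g r) by move=> ir; rewrite (is_root_wact coxS).
rewrite (braid0_xroot _ ra rb) (braidS_xroot _ _ (rw _ _ rb)) (braid0_xroot _ ra rc).
rewrite (braid0_xroot _ (rw _ _ rb) (rw _ _ rc)).
rewrite (braidS_xroot _ _ ra) (braid0_xroot _ rb rc) (braid0_xroot _ ra (rw _ _ rc)).
rewrite (braidS_xroot _ _ (rw _ _ (rw _ _ rc))) (braid0_xroot _ ra rb).
(* Both sides begin with the root s_a s_b c, because s_(s_a b) = s_a s_b s_a. *)
by rewrite (root_reflection_wact coxS _ rb) -!(wactM coxS) mulgKV.
Qed.

Definition braids (m : nat) (u : seq 'I_m) (a : T) : T := foldr (fun i : 'I_m => braid i) a u.

Lemma braids_linear m (u : seq 'I_m) : linear (braids u).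
Proof. by elim: u => [|i u IH] c a b //=; rewrite -!/(braids u _) IH braid_linear. Qed.

Lemma braids_reduced m (u v : seq 'I_m.-1) a :
    reduced (@adj_tperm m) u -> reduced (@adj_tperm m) v ->
    wprod (@adj_tperm m) u = wprod (@adj_tperm m) v -> homog m a ->
  braids u a = braids v a.
Proof.
move=> redu redv eq; apply: (matsumoto (inversion_cocycle m) (Q := homog m)) => //.
  by move=> i b; apply: braid_homog.
have sym (i j : 'I_m.-1) b : homog m b -> (i <= j)%N ->
    foldr (fun i : 'I_m.-1 => braid i) b (alt i j #[(adj_tperm i * adj_tperm j)%g]%g) =
    foldr (fun i : 'I_m.-1 => braid i) b (alt j i #[(adj_tperm i * adj_tperm j)%g]%g).
  move=> hb leij; rewrite (order_adj_tperm leij).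
  case: eqP => [->//|/eqP]; rewrite -val_eqE /= => ne.
  have ltj : (j.+1 < m)%N by have := ltn_ord j; lia.
  have lin2 k l : linear (fun c => braid k (braid l c)).
    exact/(linear_compf (@braid_linear _))/braid_linear.
  have lin3 k l k' : linear (fun c => braid k (braid l (braid k' c))).
    exact/(linear_compf (@braid_linear _))/lin2.
  case: ifP => cmp /=; first apply: (homog_linear_eq (@lin2 i j) (@lin2 j i) _ hb).
    by move=> w sw; apply: braid_far; rewrite ?sw.
  have ej : (j = i.+1 :> nat)%N by lia.
  rewrite ej; apply: (homog_linear_eq (@lin3 i i.+1 i) (@lin3 i.+1 i i.+1) _ hb).
  by move=> w sw; apply: braid_adj; rewrite sw -ej.
move=> i j b hb; have [/(sym _ _ _ hb) //|/ltnW/(sym _ _ _ hb) E] := leqP i j.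
rewrite -(orderV (adj_tperm i * adj_tperm j)%g) invMg !(ginv (@adj_tperm_invol m)).
by rewrite E.
Qed.

End BraidedFactorial.

(** Strips the first letter without braiding, unlike [skew]. Over all p, these maps detect whether a
    homogeneous tensor of positive degree vanishes. *)
HB.lock Definition head_coef (R : realType) (W : finGroupType) (S : {set W})
    (p : posroot R S) (b : tensor_alg R S) : tensor_alg R S :=
  linext (fun k : {fmonom (posroot R S)} =>
    if fmonom_val k is a :: u then (a == p)%:R *: word u else 0) b.

Section NicholsIdeal.
Context (R : realType) (W : finGroupType) (S : {set W}) (coxS : coxeter_system S).

Local Notation n := #|S|.
Local Notation hR := 'rV[R]_n.
Local Notation C := (R[i]%C).
Local Notation P := (posroot R S).
Local Notation T := (tensor_alg R S).
Local Notation rr := (@root_reflection R W S).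
Local Notation is_root := (@is_root R W S).
Local Notation xroot := (@xroot_locked R W S).
Local Notation tgen := (@tgen_locked R W S).
Local Notation word := (@word R W S).
Local Notation hcomp m := (@hcomp_locked R W S m).
Local Notation braid i := (@braid_locked R W S i).
Implicit Types (x y z p q r : hR).
Local Notation homog := (@homogeneous R W S).
Local Notation lext := (@head_coef R W S).
Local Notation skew := (@skew R W S).
Local Notation rpair := (@root_pairing R W S).
Local Notation eps := (@counit R W S).

Lemma lext_linear (p : P) : linear (lext p).
Proof. by rewrite head_coef.unlock; apply: linearP. Qed.

Lemma lext_tgen (p : P) a b : lext p (tgen a ** b) = (a == p)%:R *: b.
Proof.
move: b; apply: word_linear_eq => [||u].
- exact/(linear_compf (@lext_linear _))/linear_mull/linear_id.
- exact/linear_scale/linear_id.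
by rewrite -word_cons head_coef.unlock linext_word.
Qed.

Lemma lext_xroot (p : P) r b : is_root r -> lext p (xroot r ** b) = rpair (val p) r *: b.
Proof.
have ne (a : P) : (val p == - val a) = false.
  apply/eqP => e; have := valP p; rewrite e => pa.
  by have := posrootN coxS (valP a); rewrite pa.
case/(rootP coxS) => a [->|->].
  by rewrite xroot_pos lext_tgen /root_pairing ne subr0 val_eqE eq_sym.
rewrite (xroot_neg coxS) tmulNl (linN _ (@lext_linear p)) lext_tgen.
by rewrite /root_pairing ne opprK val_eqE eq_sym sub0r scaleNr.
Qed.

Lemma lext_eq0 m c : homog m.+1 c -> (forall p : P, lext p c = 0) -> c = 0.
Proof.
move=> hc l0; apply/malgP => k; rewrite mcoeff0.
have [sk|sk] := eqVneq (size (fmonom_val k)) m.+1; last exact: (homog_coef hc (elimN eqP sk)).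
case: k sk => -[|p u] sk; first discriminate sk.
have lin : linear (fun a : T => a@_(FMonom (p :: u)) : C^o).
  by move=> d e f; rewrite mcoeffD mcoeffZ.
have lin' : linear (fun a : T => (lext p a)@_(FMonom u) : C^o).
  by move=> d e f; rewrite lext_linear mcoeffD mcoeffZ.
have E : c@_(FMonom (p :: u)) = (lext p c)@_(FMonom u).
  apply: (word_linear_eq lin lin') => -[|a v].
    by rewrite head_coef.unlock linext_word mcoeff0 word.unlock /tword mcoeffU1 fmP.
  rewrite word_cons lext_tgen -word_cons mcoeffZ word.unlock /tword !mcoeffU1 !fmP.
  change ((a :: v == p :: u)%:R = (a == p)%:R * (v == u)%:R :> C).
  by rewrite eqseq_cons -natrM mulnb.
by rewrite E l0 mcoeff0.
Qed.

Lemma braids_lift m (w : seq 'I_m) a b :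
  braids (map (lift ord0) w) (tgen a ** b) = tgen a ** braids w b.
Proof. by elim: w => [//|i w IH] /=; rewrite -!/(braids _ _) IH braidS. Qed.

Lemma braids_shift m (w : seq 'I_m.-1) r b : is_root r ->
  braids (map (@ord_shift m) w) (xroot r ** b) = xroot r ** braids w b.
Proof.
by move=> ir; elim: w => [//|i w IH] /=; rewrite -!/(braids _ _) IH (braidS_xroot coxS _ _ ir).
Qed.

(** Braiding along [cycle_word m j] brings letter j of v to the front, where it becomes the root
    vector of [r j] and leaves the tensor [c j] behind; the twisted Leibniz rule sums the same data
    over j. *)
Lemma skew_split m (v : seq P) : size v = m.+1 ->
  exists (r : 'I_m.+1 -> hR) (c : 'I_m.+1 -> T),
  [/\ forall j, is_root (r j),
      forall j : 'I_m.+1, braids (cycle_word m j) (word v) = xroot (r j) ** c j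
    & forall p, skew p (word v) = \sum_j rpair p (r j) *: c j].
Proof.
elim: m v => [|m IH] v sv; (case: v sv => [|a u] sv; first discriminate sv); case: sv => su.
  move/size0nil: su => ->; exists (fun=> val a), (fun=> word [::]).
  split=> [j|j|p]; first exact: root_val.
    by rewrite word_cons xroot_pos.
  by rewrite word_cons skew_tgen skew1 tmul0r addr0 big_ord1.
have [r [c [rr_ bc sc]]] := IH u su.
pose r' (j : 'I_m.+2) := if unlift ord0 j is Some j' then wact (rr (val a)) (r j') else val a.
pose c' (j : 'I_m.+2) := if unlift ord0 j is Some j' then tgen a ** c j' else word u.
exists r', c'; split=> [j|j|p].
- rewrite /r'; case: (unlift ord0 j) => [j'|]; last exact: root_val.
  by rewrite (is_root_wact coxS).
- case: (unliftP ord0 j) => [j'|] ->.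
    rewrite /r' /c' liftK word_cons.
    change (braid 0 (braids (map (lift ord0) (cycle_word m j')) (tgen a ** word u))
      = xroot (wact (rr (val a)) (r j')) ** (tgen a ** c j')).
    by rewrite braids_lift bc (braid0_tgen coxS).
  by rewrite /r' /c' unlift_none xroot_pos -word_cons.
have r0 : r' ord0 = val a by rewrite /r' unlift_none.
have c0 : c' ord0 = word u by rewrite /c' unlift_none.
have rl j : r' (lift ord0 j) = wact (rr (val a)) (r j) by rewrite /r' liftK.
have cl j : c' (lift ord0 j) = tgen a ** c j by rewrite /c' liftK.
rewrite word_cons skew_tgen sc [RHS]big_ord_recl r0 c0.
rewrite (lin_sum _ _ _ (linear_mull (tgen a) (@linear_id _ _))); congr (_ + _).
apply: eq_bigr => j _; rewrite rl cl tmulZr -[in RHS](pair_wact coxS (rr (val a))).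
by rewrite -(wactM coxS) (root_reflection_invol coxS (root_val a)) (wact1 coxS).
Qed.

Lemma braids_cat m (w w' : seq 'I_m) (a : T) :
  braids (w ++ w') a = braids w (braids w' a).
Proof. exact: foldr_cat. Qed.

Lemma bfactE m (a : T) : bfact m a = \sum_(sigma : 'S_m) braids (rword (@adj_tperm m) sigma) a.
Proof. by apply: eq_bigr => sigma _; rewrite /braid_perm /braids braid_locked.unlock. Qed.

Lemma bfact_linear m : linear (@bfact R W S m).
Proof.
move=> c a b; rewrite !bfactE scaler_sumr -big_split.
by apply: eq_bigr => sigma _; rewrite braids_linear.
Qed.

Lemma braids_homog m k (w : seq 'I_k) a : homog m a -> homog m (braids w a).
Proof. by move=> ha; elim: w => [|i w IH]; [exact: ha|exact: (braid_homog coxS i IH)]. Qed.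

Lemma homog_sum m (J : Type) (s : seq J) (Q : pred J) (F : J -> T) :
  (forall j, homog m (F j)) -> homog m (\sum_(j <- s | Q j) F j).
Proof.
move=> hF; rewrite /homogeneous (lin_sum _ _ _ (@hcomp_linear _ _ _ m)).
by apply: eq_bigr => j _; apply: hF.
Qed.

Lemma bfact_homog m (a : T) : homog m a -> homog m (bfact m a).
Proof. by move=> ha; rewrite bfactE; apply: homog_sum => sigma; apply: braids_homog. Qed.

(** Factorization of [m+1]! along the cosets of [lift_perm_bij]: the concatenated words are reduced,
    so they may replace the chosen ones. The outer factor is [m]! shifted by one position and does
    not touch the first tensor factor. *)
Lemma bfactS m (a : T) : homog m.+1 a -> bfact m.+1 a =
  \sum_(sigma : 'S_m) \sum_(j < m.+1)
    braids (map (@ord_shift m) (rword (@adj_tperm m) sigma)) (braids (cycle_word m j) a).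
Proof.
move=> ha; rewrite bfactE (reindex _ (onW_bij _ (lift_perm_bij m))) /=.
rewrite pair_bigA; apply: eq_bigr => -[sigma j] _ /=.
rewrite -braids_cat; apply: (braids_reduced coxS) ha.
- exact/reduced_rword/adj_tperm_gen.
- apply: reduced_lift_cat; first exact/reduced_rword/adj_tperm_gen.
  exact: reduced_cycle_word.
rewrite (wprod_rword (@adj_tperm_gen _)) wprod_cat lift_wprod wprod_cycle_word.
by rewrite (wprod_rword (@adj_tperm_gen _)) lift_perm_cycle.
Qed.

(** The link between the braided factorial and the derivations: in [bfactS] only the coset words act
    on the first position, and [skew_split] identifies the coefficients which they produce there. *)
Lemma lext_bfact m (p : P) a : homog m.+1 a -> lext p (bfact m.+1 a) = bfact m (skew (val p) a).
Proof.
move: a; apply: homog_linear_eq => [||v sv].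
- exact/(linear_compf (@lext_linear p))/bfact_linear.
- exact/(linear_compf (@bfact_linear m))/skew_linear.
have [r [c [irr bc sc]]] := skew_split sv.
have hv : homog m.+1 (word v) by rewrite -sv; apply: homog_word.
rewrite (bfactS hv) (lin_sum _ _ _ (@lext_linear p)) bfactE; apply: eq_bigr => sigma _.
rewrite (lin_sum _ _ _ (@lext_linear p)) sc (lin_sum _ _ _ (@braids_linear _ _ _ _ _)).
apply: eq_bigr => j _; rewrite bc braids_shift // lext_xroot //.
by rewrite (linZ _ _ (@braids_linear _ _ _ _ _)).
Qed.

Lemma eps_homog0 a : homog 0 a -> a = eps a *: word [::].
Proof.
move: a; apply: homog_linear_eq => [||u /size0nil ->]; first exact: linear_id.
  by move=> c a b; rewrite eps_linear scalerDl scalerA.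
by rewrite eps_word scale1r.
Qed.

Lemma bfact0 (a : T) : bfact 0 a = a.
Proof.
rewrite bfactE (big_pred1 1%g) => [|sigma]; last first.
  by rewrite /= -[sigma == _]/(_) ; apply/esym/eqP/permP => -[].
by case: (rword _ _) => [|[]].
Qed.

Lemma bfact_eq0 m (a : T) : homog m a ->
  bfact m a = 0 <-> (forall l : seq P, size l = m -> eps (skews l a) = 0).
Proof.
elim: m a => [|m IH] a ha.
  rewrite bfact0; split=> [-> l /size0nil -> /=|e0].
    by rewrite /counit mcoeff0.
  by rewrite (eps_homog0 ha) (e0 [::]) // scale0r.
have hs p := skew_homog p ha.
split=> [b0 [|p l] sl|e0]; first discriminate sl.
  case: sl => sl; apply: (proj1 (IH _ (hs _))) => //.
  by rewrite -lext_bfact // b0 (lin0 (@lext_linear _)).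
apply: (lext_eq0 (bfact_homog ha)) => p; rewrite lext_bfact //.
by apply: (proj2 (IH _ (hs _))) => l sl; apply: (e0 (p :: l)); rewrite /= sl.
Qed.

Lemma skew_hcomp m p a : skew p (hcomp m.+1 a) = hcomp m (skew p a).
Proof.
move: a; apply: word_linear_eq => [||u].
- exact/(linear_compf (@skew_linear _ _ _ _))/hcomp_linear.
- exact/(linear_compf (@hcomp_linear _ _ _ _))/skew_linear.
elim: u p m => [|a u IH] p m.
  by rewrite hcomp_word skew0 skew1 (lin0 (@hcomp_linear _ _ _ _)).
rewrite word_cons hcomp_tgen !skew_tgen (linD _ _ (@hcomp_linear _ _ _ _)).
rewrite (linZ _ _ (@hcomp_linear _ _ _ _)); congr (_ + _).
case: m => [|m]; last by rewrite IH hcomp_tgen.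
have h0 : skew (wact (rr (val a)) p) (hcomp 0 (word u)) = 0.
  by rewrite hcomp_word; case: eqP => [/size0nil->|_]; rewrite ?skew1 ?skew0.
rewrite h0 tmul0r; apply/esym.
move: (skew _ _); apply: word_linear_eq => [||v].
- exact/(linear_compf (@hcomp_linear _ _ _ _))/linear_mull/linear_id.
- by move=> c x y; rewrite scaler0 addr0.
by rewrite -word_cons hcomp_word.
Qed.

(** Each derivation lowers the degree by one, and the counit sees degree 0 only. *)
Lemma eps_skews_hcomp l a : eps (skews l (hcomp (size l) a)) = eps (skews l a).
Proof.
elim: l a => [|p l IH] a /=; last by rewrite skew_hcomp IH.
have lin (f : T -> T) : linear f -> linear (fun a => eps (f a) : C^o).
  by move=> linf c b d; rewrite linf eps_linear.
move: a; apply: (word_linear_eq (lin _ (@hcomp_linear _ _ _ _)) (lin _ (@linear_id _ _))) => u.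
rewrite hcomp_word eps_word; case: u => [|a u] /=; first by rewrite eps_word.
by rewrite /counit mcoeff0.
Qed.

Lemma nichols_idealP a :
  a \in @nichols_ideal R W S <-> (forall l : seq P, eps (skews l a) = 0).
Proof.
split=> [/asboolP Ia l|e0].
  rewrite -eps_skews_hcomp; have := Ia (size l); rewrite -[Defs.hcomp _ _]/(_).
  have -> : Defs.hcomp (size l) a = hcomp (size l) a by rewrite hcomp_locked.unlock.
  by rewrite (bfact_eq0 (hcompK _ _)); apply.
apply/asboolP => m.
have -> : Defs.hcomp m a = hcomp m a by rewrite hcomp_locked.unlock.
by apply: (proj2 (bfact_eq0 (hcompK _ _))) => l <-; rewrite eps_skews_hcomp.
Qed.

End NicholsIdeal.

(** * Stability of the Nichols ideal under product, grading, action and reversal *)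

HB.lock Definition wdeg_proj (R : realType) (W : finGroupType) (S : {set W})
    (g : W) (b : tensor_alg R S) : tensor_alg R S :=
  linext (fun k : {fmonom (posroot R S)} => if wdeg k == g then tword k else 0) b.

HB.lock Definition trev_locked (R : realType) (W : finGroupType) (S : {set W})
    (b : tensor_alg R S) : tensor_alg R S := Defs.trev b.

Section NicholsIdealTheory.
Context (R : realType) (W : finGroupType) (S : {set W}) (coxS : coxeter_system S).

Local Notation n := #|S|.
Local Notation hR := 'rV[R]_n.
Local Notation C := (R[i]%C).
Local Notation P := (posroot R S).
Local Notation T := (tensor_alg R S).
Local Notation rr := (@root_reflection R W S).
Local Notation is_root := (@is_root R W S).
Local Notation xroot := (@xroot_locked R W S).
Local Notation tgen := (@tgen_locked R W S).
Local Notation word := (@word R W S).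
Local Notation tact := (@tact_locked R W S).
Implicit Types (x y z p q r : hR).
Local Notation skew := (@skew R W S).
Local Notation rpair := (@root_pairing R W S).
Local Notation eps := (@counit R W S).
Local Notation proj := (@wdeg_proj R W S).
Local Notation rv := (@trev_locked R W S).
Local Notation I := (@nichols_ideal R W S).
Implicit Types (a b c : T).

Lemma skews0 (l : seq P) : skews l 0 = 0.
Proof. exact/lin0/skews_linear. Qed.

Lemma nichols_idealZ (d : C) b : b \in I -> d *: b \in I.
Proof.
move=> /(nichols_idealP coxS) Ib; apply/(nichols_idealP coxS) => l.
by rewrite (linZ _ _ (@skews_linear _ _ _ l)) /counit mcoeffZ -/(eps _) Ib mulr0.
Qed.

Lemma nichols_ideal_skew r b : is_root r -> b \in I -> skew r b \in I.
Proof.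
have pos (p : P) : b \in I -> skew (val p) b \in I.
  move=> /(nichols_idealP coxS) Ib; apply/(nichols_idealP coxS) => l.
  exact: (Ib (p :: l)).
case/(rootP coxS) => p [->|->] Ib; first exact: pos.
by rewrite (skewN coxS) -scaleN1r; apply/nichols_idealZ/pos.
Qed.

Lemma nichols_ideal_eps b : b \in I -> eps b = 0.
Proof. by move=> /(nichols_idealP coxS)/(_ [::]). Qed.

Lemma nichols_ideal_intro b :
  eps b = 0 -> (forall p : P, skew (val p) b \in I) -> b \in I.
Proof.
move=> e0 sI; apply/(nichols_idealP coxS) => -[|p l] //=.
exact: (proj1 (nichols_idealP coxS _) (sI p)).
Qed.

Lemma nichols_ideal0 : 0 \in I. Proof. exact: rpred0. Qed.

Lemma nichols_idealD a b : a \in I -> b \in I -> a + b \in I.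
Proof. exact: rpredD. Qed.

Lemma nichols_ideal_sum (J : Type) (s : seq J) (Q : pred J) (F : J -> T) :
  (forall j, Q j -> F j \in I) -> \sum_(j <- s | Q j) F j \in I.
Proof.
move=> IF; exact: (big_ind (fun a => a \in I) nichols_ideal0 nichols_idealD IF).
Qed.

Lemma word_ind (Q : T -> Prop) : Q 0 -> (forall d a b, Q a -> Q b -> Q (d *: a + b)) ->
  (forall u, Q (word u)) -> forall a, Q a.
Proof.
move=> Q0 Qlin Qw; apply: malg_linear_ind => // k.
by rewrite -[<< k >>]/(tword k) twordE.
Qed.

Lemma nichols_ideal_tgen (x : P) b : b \in I -> tgen x ** b \in I.
Proof.
move=> Ib; apply/(nichols_idealP coxS) => l; elim: l x b Ib => [|p l IH] x b Ib /=.
  exact: eps_tgen.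
have ir : is_root (wact (rr (val x)) (val p)).
  by rewrite (is_root_wact coxS); apply: root_val.
rewrite skew_tgen skews_linear eps_linear (IH _ _ (nichols_ideal_skew ir Ib)) addr0.
by rewrite (proj1 (nichols_idealP coxS _) Ib) mulr0.
Qed.

Lemma nichols_ideal_mull a b : b \in I -> a ** b \in I.
Proof.
move=> Ib; move: a; apply: word_ind => [|d a c Ia Ic|u].
- by rewrite tmul0l; apply: nichols_ideal0.
- by rewrite tmulDl tmulZl; exact: (nichols_idealD (nichols_idealZ d Ia) Ic).
elim: u => [|x u IH]; first by rewrite tmul1l.
by rewrite word_cons -tmulA; apply: nichols_ideal_tgen.
Qed.

Lemma proj_linear g : linear (proj g).
Proof. by rewrite wdeg_proj.unlock; apply: linearP. Qed.

Lemma proj_word g u : proj g (word u) = if wdeg (FMonom u) == g then word u else 0.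
Proof. by rewrite wdeg_proj.unlock linext_word twordE. Qed.

Lemma wdeg_cons (x : P) u : wdeg (FMonom (x :: u)) = (rr (val x) * wdeg (FMonom u))%g.
Proof. exact: big_cons. Qed.

Lemma wdeg_nil : wdeg (FMonom [::] : {fmonom P}) = 1%g.
Proof. exact: big_nil. Qed.

Lemma proj_tgen g (x : P) b : proj g (tgen x ** b) = tgen x ** proj (rr (val x) * g)%g b.
Proof.
move: b; apply: word_linear_eq => [||u].
- exact/(linear_compf (@proj_linear g))/linear_mull/linear_id.
- exact/linear_mull/proj_linear.
rewrite -word_cons !proj_word wdeg_cons.
rewrite -(inj_eq (mulgI (rr (val x)))) mulgA (root_reflection_invol coxS (root_val x)) mul1g.
by case: ifP; rewrite ?tmul0r // word_cons.
Qed.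

(** The removed letter, once braided to the front, is x_p or x_(-p) and has degree s_p; so degree g
    goes to degree s_p g. *)
Lemma skew_proj p g b : is_root p -> skew p (proj g b) = proj (rr p * g)%g (skew p b).
Proof.
move=> ip; move: b; apply: word_linear_eq => [||u].
- exact/(linear_compf (@skew_linear _ _ _ p))/proj_linear.
- exact/(linear_compf (@proj_linear _))/skew_linear.
elim: u p g ip => [|x u IH] p g ip.
  rewrite proj_word skew1 (lin0 (@proj_linear _)).
  by case: ifP => _; rewrite ?skew1 ?skew0.
rewrite word_cons proj_tgen !skew_tgen IH; last by rewrite (is_root_wact coxS).
rewrite (linD _ _ (@proj_linear _)) (linZ _ _ (@proj_linear _)) proj_tgen.
rewrite (root_reflection_wact coxS _ ip) -!mulgA mulKg.
suff -> : rpair p (val x) *: proj (rr (val x) * g)%g (word u)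
    = rpair p (val x) *: proj (rr p * g)%g (word u) by [].
rewrite /root_pairing; case: eqP => [->//|_]; case: eqP => [->|_].
  by rewrite (root_reflectionN coxS (root_val x)).
by rewrite subrr !scale0r.
Qed.

Lemma eps_proj g b : eps (proj g b) = (g == 1%g)%:R * eps b.
Proof.
have lin1 : linear (fun a => eps (proj g a) : C^o).
  by move=> d a c; rewrite proj_linear eps_linear.
have lin2 : linear (fun a => (g == 1%g)%:R * eps a : C^o).
  by move=> d a c; rewrite eps_linear mulrDr; congr (_ + _); rewrite mulrCA.
move: b; apply: (word_linear_eq lin1 lin2) => -[|x u].
  rewrite proj_word wdeg_nil eq_sym; case: eqP => _; rewrite ?mul1r // mul0r.
  by rewrite /counit mcoeff0.
rewrite proj_word !eps_word mulr0; case: ifP => _; first by rewrite eps_word.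
by rewrite /counit mcoeff0.
Qed.

Lemma nichols_ideal_proj g b : b \in I -> proj g b \in I.
Proof.
move=> Ib; apply/(nichols_idealP coxS) => l; elim: l g b Ib => [|p l IH] g b Ib /=.
  by rewrite eps_proj (nichols_ideal_eps Ib) mulr0.
rewrite skew_proj; last exact: root_val.
exact: (IH _ _ (nichols_ideal_skew (root_val p) Ib)).
Qed.

Lemma sum_proj b : \sum_(g : W) proj g b = b.
Proof.
move: b; apply: word_linear_eq => [||u].
- by apply: linear_bigsum => g; apply: proj_linear.
- exact: linear_id.
rewrite (bigD1 (wdeg (FMonom u))) //= proj_word eqxx big1 ?addr0 // => g ne.
by rewrite proj_word eq_sym (negbTE ne).
Qed.

Lemma projK g b : proj g (proj g b) = proj g b.
Proof.
move: b; apply: word_linear_eq => [||u].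
- exact/(linear_compf (@proj_linear _))/proj_linear.
- exact: proj_linear.
rewrite proj_word; case: ifP => e; last exact/lin0/proj_linear.
by rewrite proj_word e.
Qed.

Lemma proj_linear_eq g (V : lmodType C) (f h : T -> V) :
    linear f -> linear h -> (forall u, wdeg (FMonom u) = g -> f (word u) = h (word u)) ->
  forall b, proj g b = b -> f b = h b.
Proof.
move=> linf linh fh b <-; move: b; apply: word_linear_eq => [||u].
- exact/(linear_compf linf)/proj_linear.
- exact/(linear_compf linh)/proj_linear.
by rewrite proj_word; case: eqP => [/fh //|_]; rewrite (lin0 linf) (lin0 linh).
Qed.

(** To be removed, the last letter x has to pass all of u and is moved by the W-degree of u. Because
    of this dependence, right multiplication and reversal are treated one W-degree at a time. *)
Lemma skew_mulr_word p u (x : P) : skew p (word u ** tgen x)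
  = skew p (word u) ** tgen x + rpair p (wact (wdeg (FMonom u)) (val x)) *: word u.
Proof.
elim: u p => [|y u IH] p.
  rewrite tmul1l skew1 tmul0l add0r wdeg_nil (wact1 coxS) -[tgen x]tmul1r skew_tgen.
  by rewrite skew1 tmul0r addr0.
rewrite word_cons -tmulA !skew_tgen IH tmulDl tmulDr tmulZl tmulZr -tmulA addrA wdeg_cons.
rewrite (wactM coxS) -(pair_wact coxS (rr (val y)) p (wact _ (wact _ _))).
by rewrite -(wactM coxS (rr _) (rr _)) (root_reflection_invol coxS (root_val y)) (wact1 coxS).
Qed.

Lemma eps_mulr b (x : P) : eps (b ** tgen x) = 0.
Proof.
have lin : linear (fun b => eps (b ** tgen x) : C^o).
  by move=> c d e; rewrite tmulDl tmulZl eps_linear.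
move: b; apply: (word_linear_eq lin) => [c d e|u]; first by rewrite scaler0 addr0.
by rewrite tgenE -wordM eps_word; case: u.
Qed.

Lemma nichols_ideal_tgenr (x : P) b : b \in I -> b ** tgen x \in I.
Proof.
(* The ideal is graded by W, so every component of b lies in it. *)
suff main g c : c \in I -> proj g c = c -> c ** tgen x \in I.
  move=> Ib; rewrite -(sum_proj b) (lin_sum _ _ _ (linear_mulr (tgen x) (@linear_id _ _))).
  apply: nichols_ideal_sum => g _.
  exact: (main g _ (nichols_ideal_proj g Ib) (projK g b)).
move=> Ic cg; apply/(nichols_idealP coxS) => l; elim: l g c Ic cg => [|p l IH] g c Ic cg /=.
  exact: eps_mulr.
have -> : skew (val p) (c ** tgen x) =
    skew (val p) c ** tgen x + rpair (val p) (wact g (val x)) *: c.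
  move: c cg {Ic}; apply: proj_linear_eq => [||u <-]; last exact: skew_mulr_word.
  - exact/(linear_compf (@skew_linear _ _ _ _))/linear_mulr/linear_id.
  apply: linear_add; first exact/linear_mulr/skew_linear.
  exact/linear_scale/linear_id.
rewrite addrC skews_linear eps_linear (proj1 (nichols_idealP coxS _) Ic) mulr0 add0r.
apply: (IH (rr (val p) * g)%g); first exact: (nichols_ideal_skew (root_val p) Ic).
by rewrite -(skew_proj _ _ (root_val p)) cg.
Qed.

Lemma nichols_ideal_mulr a b : b \in I -> b ** a \in I.
Proof.
move=> Ib; move: a; apply: word_ind => [|d a c Ia Ic|u].
- by rewrite tmul0r; apply: nichols_ideal0.
- by rewrite tmulDr tmulZr; exact: (nichols_idealD (nichols_idealZ d Ia) Ic).
elim: u b Ib => [|x u IH] b Ib; first by rewrite tmul1r.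
by rewrite word_cons tmulA; apply/IH/nichols_ideal_tgenr.
Qed.

Lemma nichols_ideal_tact g b : b \in I -> tact g b \in I.
Proof.
move=> Ib; apply/(nichols_idealP coxS) => l.
have lin : linear (fun b => eps (tact g b) : C^o).
  by move=> c d e; rewrite tact_linear eps_linear.
elim: l b Ib => [|p l IH] b Ib /=.
  rewrite -(nichols_ideal_eps Ib); move: b {Ib}.
  apply: (word_linear_eq lin) => [|[|x u]]; first exact: eps_linear.
    by rewrite tact1.
  rewrite tact_word eps_word.
  have ir : is_root (wact g (val x)) by rewrite (is_root_wact coxS); apply: root_val.
  case/(rootP coxS): ir => y [->|->]; first by rewrite xroot_pos eps_tgen.
  rewrite (xroot_neg coxS) tmulNl.
  by rewrite /counit mcoeffN -/(eps _) eps_tgen oppr0.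
have -> : skew (val p) (tact g b) = tact g (skew (wact g^-1%g (val p)) b).
  by rewrite -(skew_tact coxS) (wactVK coxS).
have ir : is_root (wact g^-1%g (val p)) by rewrite (is_root_wact coxS); apply: root_val.
exact: (IH _ (nichols_ideal_skew ir Ib)).
Qed.

Lemma rv_linear : linear rv.
Proof. by rewrite trev_locked.unlock; apply: linearP. Qed.

Lemma rv_word u : rv (word u) = word (rev u).
Proof. by rewrite trev_locked.unlock /trev linext_word twordE. Qed.

Lemma rvM a b : rv (a ** b) = rv b ** rv a.
Proof.
move: b; apply: word_linear_eq => [||v].
- exact/(linear_compf rv_linear)/linear_mull/linear_id.
- exact/linear_mulr/rv_linear.
move: a; apply: word_linear_eq => [||u].
- exact/(linear_compf rv_linear)/linear_mulr/linear_id.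
- exact/linear_mull/rv_linear.
by rewrite -wordM !rv_word rev_cat wordM.
Qed.

Lemma rv_tgen (x : P) : rv (tgen x) = tgen x.
Proof. by rewrite tgenE rv_word. Qed.

Lemma rv_xroot r : is_root r -> rv (xroot r) = xroot r.
Proof.
case/(rootP coxS) => x [->|->]; first by rewrite xroot_pos rv_tgen.
by rewrite (xroot_neg coxS) (linN _ rv_linear) rv_tgen.
Qed.

Lemma rvK b : rv (rv b) = b.
Proof.
move: b; apply: word_linear_eq => [||u]; [|exact: linear_id|].
- exact/(linear_compf rv_linear)/rv_linear.
by rewrite !rv_word revK.
Qed.

Lemma wdeg_rev u : wdeg (FMonom (rev u) : {fmonom P}) = (wdeg (FMonom u))^-1%g.
Proof.
elim: u => [|x u IH]; first by rewrite wdeg_nil invg1.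
rewrite wdeg_cons invMg -IH rev_cons -cats1 {1}/wdeg big_cat big_seq1.
congr (_ * _)%g; apply/eqP; rewrite eq_sym eq_invg_mul.
by rewrite (root_reflection_invol coxS (root_val x)).
Qed.

(* A letter removed from the right end differs from the same letter removed  *)
(* from the left end by the action of the total degree, up to a sign.        *)
Lemma skew_rv_word p u :
  skew p (rv (word u)) = - rv (skew (wact (wdeg (FMonom u)) p) (word u)).
Proof.
elim: u p => [|x u IH] p.
  by rewrite rv_word !skew1 (lin0 rv_linear) oppr0.
have rx := root_val x.
have := skew_mulr_word p (rev u) x; rewrite -rv_word wdeg_rev IH => E.
rewrite word_cons rvM rv_tgen E skew_tgen wdeg_cons.
rewrite (linD _ _ rv_linear) (linZ _ _ rv_linear) rvM rv_tgen tmulNl.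
rewrite (wactM coxS) -(wactM coxS (rr _) (rr _)) (root_reflection_invol coxS rx) (wact1 coxS).
rewrite -[in RHS](pair_wact coxS (rr (val x))) -(wactM coxS (rr _) (rr _)).
rewrite (root_reflection_invol coxS rx) (wact1 coxS) (root_reflection_self coxS rx).
rewrite -{1}(pair_wact coxS (wdeg (FMonom u))) (wactVK coxS) pairNr.
by rewrite scaleNr opprD opprK addrC.
Qed.

Lemma nichols_ideal_rv b : b \in I -> rv b \in I.
Proof.
suff main g c : c \in I -> proj g c = c -> rv c \in I.
  move=> Ib; rewrite -(sum_proj b) (lin_sum _ _ _ rv_linear).
  apply: nichols_ideal_sum => g _.
  exact: (main g _ (nichols_ideal_proj g Ib) (projK g b)).
move=> Ic cg; apply/(nichols_idealP coxS) => l; elim: l g c Ic cg => [|p l IH] g c Ic cg /=.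
  rewrite -(nichols_ideal_eps Ic); move: c {Ic cg}.
  have lin : linear (fun b => eps (rv b) : C^o).
    by move=> c d e; rewrite rv_linear eps_linear.
  apply: (word_linear_eq lin) => [|u]; first exact: eps_linear.
  by rewrite rv_word !eps_word -!size_eq0 size_rev.
have -> : skew (val p) (rv c) = - rv (skew (wact g (val p)) c).
  move: c cg {Ic}; apply: proj_linear_eq => [||u <-]; last exact: skew_rv_word.
  - exact/(linear_compf (@skew_linear _ _ _ _))/rv_linear.
  exact/linear_opp/(linear_compf rv_linear)/skew_linear.
have ip : is_root (wact g (val p)) by rewrite (is_root_wact coxS); apply: root_val.
rewrite (linN _ (@skews_linear _ _ _ l)) /counit mcoeffN -/(eps _).
rewrite (IH (rr (wact g (val p)) * g)%g) ?oppr0; first reflexivity.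
  exact: (nichols_ideal_skew ip Ic).
by rewrite -(skew_proj _ _ ip) cg.
Qed.

(** Removing the second letter replaces p by s_a p, and s_a a = - a, so the two terms of the
    derivative cancel. *)
Lemma nichols_ideal_sqr r : is_root r -> xroot r ** xroot r \in I.
Proof.
have main (x : P) : tgen x ** tgen x \in I.
  apply: nichols_ideal_intro => [|p]; first exact: eps_tgen.
  have rx := root_val x.
  have sx q : skew q (tgen x) = rpair q (val x) *: word [::].
    by rewrite -(tmul1r (tgen x)) skew_tgen skew1 tmul0r addr0.
  have px : rpair (wact (rr (val x)) (val p)) (val x) = - rpair (val p) (val x).
    rewrite -(pair_wact coxS (rr (val x))) -(wactM coxS) (root_reflection_invol coxS rx).
    by rewrite (wact1 coxS) (root_reflection_self coxS rx) pairNr.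
  rewrite skew_tgen sx px tmulZr tmul1r scaleNr subrr; exact: nichols_ideal0.
case/(rootP coxS) => x [->|->]; first by rewrite xroot_pos.
by rewrite (xroot_neg coxS) tmulNl tmulNr opprK.
Qed.

End NicholsIdealTheory.

HB.lock Definition npi (R : realType) (W : finGroupType) (S : {set W})
    (b : tensor_alg R S) : nichols R S := \pi_(nichols R S) b.

HB.lock Definition xw (R : realType) (W : finGroupType) (S : {set W})
    (u : seq 'I_#|S|) : tensor_alg R S :=
  foldr (fun i b => xroot_locked (sroot R i) ** b) (word [::]) u.

(** * The elements x_w *)

Section SimpleWords.
Context (R : realType) (W : finGroupType) (S : {set W}) (coxS : coxeter_system S).

Local Notation n := #|S|.
Local Notation hR := 'rV[R]_n.
Local Notation C := (R[i]%C).
Local Notation P := (posroot R S).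
Local Notation T := (tensor_alg R S).
Local Notation rr := (@root_reflection R W S).
Local Notation is_root := (@is_root R W S).
Local Notation xroot := (@xroot_locked R W S).
Local Notation tgen := (@tgen_locked R W S).
Local Notation word := (@word R W S).
Local Notation braid i := (@braid_locked R W S i).
Implicit Types (x y z p q r : hR).
Local Notation skew := (@skew R W S).
Local Notation rpair := (@root_pairing R W S).
Local Notation eps := (@counit R W S).
Local Notation npi := (@npi R W S).
Local Notation xw := (@xw R W S).
Local Notation I := (@nichols_ideal R W S).
Local Notation s := (@simple W S).
Local Notation a_ := (@sroot R W S).
Local Notation len := (wlen s).
Local Notation ord i j := #[(s i * s j)%g]%g.
Implicit Types (a b c : T).

Let ggen := simple_gen coxS.
Let ginvol := simple_invol coxS.

Lemma npiP a b : npi a = npi b <-> a - b \in I.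
Proof.
rewrite npi.unlock Quotient.idealrBE.
by split=> [->|/eqP]; [exact: eqxx|exact].
Qed.

Lemma npi0P a : npi a = 0 <-> a \in I.
Proof.
have E : npi 0 = 0 by rewrite npi.unlock; apply: raddf0.
by rewrite -E npiP subr0.
Qed.

Lemma npiD a b : npi (a + b) = npi a + npi b.
Proof. by rewrite npi.unlock; apply: raddfD. Qed.

Lemma npi0 : npi 0 = 0.
Proof. by rewrite npi.unlock; apply: raddf0. Qed.

Lemma npiN a : npi (- a) = - npi a.
Proof. by rewrite npi.unlock; apply: raddfN. Qed.

Lemma npi_repr (x : nichols R S) : npi (repr x) = x.
Proof. by rewrite npi.unlock reprK. Qed.

Lemma repr_npi a : repr (npi a) - a \in I.
Proof. by apply/npiP; rewrite npi_repr. Qed.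

Lemma npi_mull c a b : npi a = npi b -> npi (c ** a) = npi (c ** b).
Proof.
move=> /npiP Iab; apply/npiP; rewrite -tmulNr -tmulDr; exact: (nichols_ideal_mull coxS c Iab).
Qed.

Lemma npi_mulr c a b : npi a = npi b -> npi (a ** c) = npi (b ** c).
Proof.
move=> /npiP Iab; apply/npiP; rewrite -tmulNl -tmulDl; exact: (nichols_ideal_mulr coxS c Iab).
Qed.

Lemma nmul_npi a b : nmul (npi a) (npi b) = npi (a ** b).
Proof.
have -> : nmul (npi a) (npi b) = npi (repr (npi a) ** repr (npi b)).
  by rewrite {3}npi.unlock tmulE.
by rewrite (npi_mulr _ (npi_repr (npi a))) (npi_mull _ (npi_repr (npi b))).
Qed.

Lemma npi_skew r a b : is_root r -> npi a = npi b -> npi (skew r a) = npi (skew r b).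
Proof.
move=> ir /npiP Iab; apply/npiP; rewrite -skewB; exact: (nichols_ideal_skew coxS ir Iab).
Qed.

Lemma xw_nil : xw [::] = word [::].
Proof. by rewrite xw.unlock. Qed.

Lemma xw_cons i u : xw (i :: u) = xroot (a_ i) ** xw u.
Proof. by rewrite xw.unlock. Qed.

Lemma root_simple i : is_root (a_ i). Proof. exact: is_root_sroot. Qed.
Lemma root_wact_simple g i : is_root (wact g (a_ i)).
Proof. by rewrite (is_root_wact coxS); apply: root_simple. Qed.

Lemma eps_xw u : eps (xw u) = (u == [::])%:R.
Proof.
case: u => [|i u]; first by rewrite xw_nil eps1.
by rewrite xw_cons -[a_ i]/(val (Sub (a_ i) (posroot_sroot R coxS i) : P)) xroot_pos eps_tgen.
Qed.

Lemma skew_xw p i u :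
  skew p (xw (i :: u)) = rpair p (a_ i) *: xw u + xroot (a_ i) ** skew (wact (s i) p) (xw u).
Proof.
by rewrite xw_cons (skew_xroot coxS _ _ (root_simple i)) (root_reflection_sroot R coxS).
Qed.

(** A surviving term deletes a letter which, braided to the front, is x_p up to sign. As in the
    exchange condition, the shortened word then represents s_p times the product of u, whose length
    is therefore below the size of u. *)
Lemma skew_xw_eq0 p u : is_root p ->
  (size u <= len (rr p * wprod s u)%g)%N -> skew p (xw u) = 0.
Proof.
suff split q v : is_root q -> skew q (xw v) <> 0 ->
    exists v1 j v2, v = v1 ++ j :: v2 /\ (rr q * wprod s v)%g = wprod s (v1 ++ v2).
  move=> ip le; apply: contrapT => /(split _ _ ip)[v1 [j [v2 [eu ew]]]].
  move: le; rewrite ew leqNgt eu !size_cat /= addnS ltnS -size_cat.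
  by rewrite (wlen_le ggen).
elim: v q => [|i v IH] q iq ne; first by case: ne; rewrite xw_nil skew1.
have siE : wact (s i) q = wact (rr (a_ i)) q by rewrite (root_reflection_sroot R coxS).
have [eqp|nep] := pselect (rr q = s i).
  by exists [::], i, v; rewrite eqp wprod_cons (mulgg ginvol).
have pair0 : rpair q (a_ i) = 0.
  rewrite /root_pairing; case: eqP => [e|_].
    by case: nep; rewrite e (root_reflection_sroot R coxS).
  case: eqP => [e|_]; last by rewrite subrr.
  by case: nep; rewrite e (root_reflectionN coxS (root_simple i)) (root_reflection_sroot R coxS).
have iq' : is_root (wact (s i) q) by rewrite (is_root_wact coxS).
have [|v1 [j [v2 [ev ew]]]] := IH (wact (s i) q) iq'.
  by move=> e; case: ne; rewrite skew_xw pair0 scale0r add0r e tmul0r.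
exists (i :: v1), j, v2; rewrite ev; split=> //.
rewrite cat_cons [in RHS]wprod_cons -ew -ev wprod_cons (root_reflection_wact coxS _ iq).
by rewrite (ginv ginvol) !mulgA ginvol mul1g.
Qed.

Lemma npi_xw_sqr i u : npi (xroot (a_ i) ** xw (i :: u)) = 0.
Proof.
apply/npi0P; rewrite xw_cons tmulA.
exact: (nichols_ideal_mulr coxS _ (nichols_ideal_sqr coxS (root_simple i))).
Qed.

Lemma tmul_lin2 c (d e : C) a b : c ** (d *: a + e *: b : T) = d *: (c ** a) + e *: (c ** b).
Proof. by rewrite (linear_mull c (@linear_id _ _)) tmulZr. Qed.

(** Deleting an inner letter of an alternating word brings two equal letters together, and squares
    vanish; only the deletions of the first and of the last letter remain. *)
Lemma skew_alt p i j k : is_root p -> i != j ->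
  npi (skew p (xw (alt i j k.+2))) = npi (rpair p (a_ i) *: xw (alt j i k.+1)
    + rpair p (wact (wprod s (alt i j k.+1)) (a_ (if odd k then i else j))) *: xw (alt i j k.+1)).
Proof.
elim: k p i j => [|k IH] p i j ip ne.
  change (alt i j 2) with [:: i; j]; change (alt j i 1) with [:: j].
  change (alt i j 1) with [:: i]; change (if odd 0 then i else j) with j.
  have sx q : skew q (xw [:: j]) = rpair q (a_ j) *: word [::].
    by rewrite skew_xw xw_nil skew1 tmul0r addr0.
  have -> : rpair p (wact (wprod s [:: i]) (a_ j)) = rpair (wact (s i) p) (a_ j).
    rewrite wprod_cons wprod_nil mulg1 -[in RHS](pair_wact coxS (s i)).
    by rewrite -(wactM coxS (s i) (s i)) ginvol (wact1 coxS).
  by rewrite skew_xw sx tmulZr -xw_nil -xw_cons.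
have ne' : j != i by rewrite eq_sym.
have ip' : is_root (wact (s i) p) by rewrite (is_root_wact coxS).
change (alt i j k.+3) with (i :: alt j i k.+2); rewrite skew_xw !npiD.
apply: (congr1 (fun t => _ + t)).
rewrite [LHS](npi_mull _ (IH _ _ _ ip' ne')) tmul_lin2 [LHS]npiD.
(* [alt i j k.+1] starts with i, so this term contains the square of x_i. *)
have z : npi (rpair (wact (s i) p) (a_ j) *: (xroot (a_ i) ** xw (alt i j k.+1))) = 0.
  apply/npi0P/(nichols_idealZ coxS)/npi0P; exact: npi_xw_sqr.
apply: etrans (congr1 (fun t => t + _) z) _; apply: etrans (add0r _) _.
have e : wact (s i) (wact (wprod s (alt i j k.+2)) (a_ (if odd k.+1 then i else j)))
    = wact (wprod s (alt j i k.+1)) (a_ (if odd k then j else i)).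
  rewrite -(wactM coxS (s i) (wprod s _)).
  change (alt i j k.+2) with (i :: alt j i k.+1); rewrite wprod_cons mulgA ginvol mul1g.
  by change (odd k.+1) with (~~ odd k); rewrite if_neg.
have ex : xw (alt i j k.+2) = xroot (a_ i) ** xw (alt j i k.+1) by apply: xw_cons.
rewrite -e (pair_wact coxS) ex; reflexivity.
Qed.

Lemma dsin_ord i j : i != j ->
  dsin R i j (ord i j) = 0 /\ dsin R i j (ord i j).-1 = 1.
Proof.
move=> ne; have m0 := @m_gt0 R W S i j; have th0 := @theta_gt0 R W S coxS i j ne.
have m1 : (ord i j)%:R = (ord i j).-1%:R + 1 :> R by rewrite natr1 prednK ?order_gt0.
have e : (ord i j)%:R * (trigo.pi / (ord i j)%:R) = trigo.pi :> R.
  by rewrite mulrC divfK // gt_eqF.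
rewrite /dsin e sinpi mul0r; split=> //; move: e th0; set th := trigo.pi / _ => e th0.
have -> : (ord i j).-1%:R * th = trigo.pi - th by rewrite -e m1 mulrDl mul1r addrK.
by rewrite sinB sinpi cospi mul0r sub0r mulN1r opprK divff // gt_eqF.
Qed.

(** The product of m-1 alternating letters starting with i carries the simple root of the next
    letter to [a_ j]: the [dsin] coordinates at m and m-1 are 0 and 1. *)
Lemma wact_alt_last i j k : i != j -> ord i j = k.+2 ->
  wact (wprod s (alt i j k.+1)) (a_ (if odd k then i else j)) = a_ j.
Proof.
move=> ne eo; have ne' : j != i by rewrite eq_sym.
have [d0 d1] := dsin_ord ne; have [d0' d1'] := dsin_ord ne'.
rewrite -(ord_sym coxS) !eo [k.+2.-1]/= in d0' d1' d0 d1.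
rewrite (wact_wprod coxS); case ok : (odd k).
  have -> : alt i j k.+1 = rev (alt j i k.+1) by rewrite rev_altE [odd _]/= ok.
  rewrite (foldr_alt_root R coxS ne) [odd _]/= ok /= d0 d1.
  by rewrite scale0r scale1r add0r.
have -> : alt i j k.+1 = rev (alt i j k.+1) by rewrite rev_altE [odd _]/= ok.
rewrite (foldr_alt_root R coxS ne') [odd _]/= ok /= d0' d1'.
by rewrite scale0r scale1r addr0.
Qed.

(** By [skew_alt] and [wact_alt_last], the derivative of either side is the pairing of p with [a_ i]
    times the word of length m-1 starting with j, plus the pairing with [a_ j] times the one
    starting with i. *)
Lemma npi_braid i j : npi (xw (alt i j (ord i j))) = npi (xw (alt j i (ord i j))).
Proof.
have [->//|ne] := eqVneq i j; have ne' : j != i by rewrite eq_sym.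
have := ord_gt1 coxS ne; case eo: (ord i j) => [//|[//|k]] _.
have eo' : ord j i = k.+2 by rewrite (ord_sym coxS).
apply/npiP; apply: (nichols_ideal_intro coxS) => [|p].
  have lin : linear (fun b => eps b : C^o) by apply: eps_linear.
  by rewrite (linB _ _ lin) !eps_xw subrr.
have ip := root_val p; rewrite skewB; apply/npiP.
rewrite (skew_alt _ ip ne) (skew_alt _ ip ne') (wact_alt_last ne eo) (wact_alt_last ne' eo').
exact: (congr1 npi (addrC _ _)).
Qed.

Lemma npi_reduced u v : reduced s u -> reduced s v -> wprod s u = wprod s v ->
  npi (xw u) = npi (xw v).
Proof.
have [eta geta] := coxeter_cocycle coxS.
pose f (i : 'I_n) (b : nichols R S) := nmul (npi (xroot (a_ i))) b.
have fE w c : foldr f (npi c) w = npi (xw w ** c).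
  elim: w => [|i w IH]; first by rewrite xw_nil tmul1l.
  by rewrite [LHS]/= IH /f nmul_npi xw_cons tmulA.
move=> redu redv eq; have := matsumoto geta (f := f) (Q := fun=> True).
move=> /(_ (fun _ _ _ => Logic.I)) M.
have {M} := M _ _ _ redu redv eq (npi (word [::])) Logic.I.
rewrite !fE !tmul1r; apply=> i j b _.
by rewrite -(npi_repr b) !fE; apply/npi_mulr/npi_braid.
Qed.

Lemma reduced_skew i u : reduced s u -> (len (wprod s u) < len (s i * wprod s u)%g)%N ->
  skew (a_ i) (xw u) = 0.
Proof.
rewrite (reducedE ggen) => /eqP su lt; apply: (skew_xw_eq0 (root_simple i)).
by rewrite (root_reflection_sroot R coxS) su ltnW.
Qed.

(** The second Leibniz term derives [xw u] along - [a_ i], and vanishes since s_i lengthens the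
    product of u. *)
Lemma reduced_skew_cons i u : reduced s (i :: u) -> skew (a_ i) (xw (i :: u)) = xw u.
Proof.
have [eta geta] := coxeter_cocycle coxS.
rewrite (reduced_cons geta) wprod_cons => /andP[redu lt].
have E : (a_ i == - a_ i) = false.
  apply/eqP => e; have := posrootN coxS (posroot_sroot R coxS i).
  by rewrite -e (posroot_sroot R coxS i).
have p1 : rpair (a_ i) (a_ i) = 1 by rewrite /root_pairing eqxx E subr0.
rewrite skew_xw (wact_gen coxS) (refl_root R coxS) (skewN coxS) (reduced_skew redu lt).
by rewrite oppr0 tmul0r addr0 p1 scale1r.
Qed.

Definition spos i : P := Sub (a_ i) (posroot_sroot R coxS i).

Lemma nichols_ideal_skews (l : seq P) b : b \in I -> skews l b \in I.
Proof.
elim: l b => [//|p l IH] b Ib; apply: IH; exact: (nichols_ideal_skew coxS (root_val p) Ib).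
Qed.

Lemma eps_npi a b : npi a = npi b -> eps a = eps b.
Proof.
move=> /npiP /(nichols_ideal_eps coxS).
have lin : linear (fun b => eps b : C^o) by apply: eps_linear.
by rewrite (linB _ _ lin) => /eqP; rewrite subr_eq0 => /eqP.
Qed.

Lemma npi_skews (l : seq P) a b : npi a = npi b -> npi (skews l a) = npi (skews l b).
Proof.
move=> /npiP Iab; apply/npiP; rewrite -(linB _ _ (@skews_linear _ _ _ l)).
exact: nichols_ideal_skews.
Qed.

(** Let i be the first letter of u. If i is no left descent of the product of v, then [skew (a_ i)]
    kills [xw v], and the two products differ. Otherwise [xw v] may be rewritten modulo the ideal to
    begin with i, and the derivation strips that letter. *)
Lemma eps_skews_xw u v : reduced s u -> reduced s v ->
  eps (skews (map spos u) (xw v)) = (wprod s u == wprod s v)%:R.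
Proof.
have [eta geta] := coxeter_cocycle coxS.
elim: u v => [|i u IH] v redu redv.
  rewrite /= eps_xw wprod_nil (eq_sym 1%g) -(wlen_eq0 ggen).
  by move: redv; rewrite (reducedE ggen) => /eqP <-; rewrite size_eq0.
have [redu' ltu] : reduced s u /\ (len (wprod s u) < len (s i * wprod s u)%g)%N.
  by move: redu; rewrite (reduced_cons geta) wprod_cons => /andP.
rewrite [skews _ _]/= -/(skews (map spos u) (skew (a_ i) (xw v))).
case: (boolP (len (wprod s v) < len (s i * wprod s v)%g)%N) => lt.
  rewrite (reduced_skew redv lt) skews0.
  have -> : eps 0 = 0 by rewrite /counit mcoeff0.
  case: eqP => // e; move: lt; rewrite -e wprod_cons (mulgg ginvol) => /(ltn_trans ltu).
  by rewrite ltnn.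
rewrite -(simple_leNgt geta) in lt.
pose v' := rword s (s i * wprod s v)%g.
have v'E : wprod s v' = (s i * wprod s v)%g by apply: (wprod_rword ggen).
have redv' : reduced s v' by apply: (reduced_rword ggen).
have redv'' : reduced s (i :: v').
  by rewrite (reduced_cons geta) redv' wprod_cons v'E (mulgg ginvol).
have E : npi (xw v) = npi (xw (i :: v')).
  by apply: npi_reduced => //; rewrite wprod_cons v'E (mulgg ginvol).
rewrite (eps_npi (npi_skews _ (npi_skew (root_simple i) E))) (reduced_skew_cons redv'').
rewrite (IH _ redu' redv') v'E wprod_cons -[X in _ = (X == _)%:R](mulgK (wprod s v)).
by rewrite -(inj_eq (mulgI (s i)) _ (s i * _)%g) (mulgg ginvol) mulgK.
Qed.

End SimpleWords.

HB.lock Definition tens_locked (R : realType) (W : finGroupType) (S : {set W})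
    (a b : tensor_alg R S) : tensor_alg2 R S := Defs.tens a b.

HB.lock Definition coprod_locked (R : realType) (W : finGroupType) (S : {set W})
    (b : tensor_alg R S) : tensor_alg2 R S := Defs.coprod b.

HB.lock Definition primmul (R : realType) (W : finGroupType) (S : {set W})
    (x : posroot R S) (c : tensor_alg2 R S) : tensor_alg2 R S :=
  twisted_mul (Defs.tens (Defs.tgen x) 1 + Defs.tens 1 (Defs.tgen x)) c.

HB.lock Definition tnsmap (R : realType) (W : finGroupType) (S : {set W})
    (V : lmodType R[i]%C) (f : tensor_alg R S -> tensor_alg R S -> V)
    (c : tensor_alg2 R S) : V :=
  linext (fun k : ({fmonom (posroot R S)} * {fmonom (posroot R S)})%type =>
    f (tword k.1) (tword k.2)) c.

(** One elimination step with pivot d: the two combinations on the right are mixed so that x0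
    cancels. *)
Lemma rank_reduce (K : fieldType) (V : lmodType K) (J : Type) (r : seq J)
    (e e' : J -> K) (x : J -> V) (d d' : K) (x0 : V) : d != 0 ->
  \sum_(t <- r) (e' t - e t / d * d') *: x t =
  - (d' / d) *: (d *: x0 + \sum_(t <- r) e t *: x t)
  + (d' *: x0 + \sum_(t <- r) e' t *: x t).
Proof.
move=> d0; rewrite scalerDr scalerA mulNr divfK // scaleNr addrACA addNr add0r.
rewrite scaler_sumr -big_split; apply: eq_bigr => t _ /=.
by rewrite scalerA -scalerDl; congr (_ *: _); ring.
Qed.

(** * The tensor square and the coproduct *)

Section TensorSquare.
Context (R : realType) (W : finGroupType) (S : {set W}) (coxS : coxeter_system S).

Local Notation n := #|S|.
Local Notation hR := 'rV[R]_n.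
Local Notation C := (R[i]%C).
Local Notation P := (posroot R S).
Local Notation T := (tensor_alg R S).
Local Notation rr := (@root_reflection R W S).
Local Notation is_root := (@is_root R W S).
Local Notation tgen := (@tgen_locked R W S).
Local Notation word := (@word R W S).
Local Notation tact := (@tact_locked R W S).
Implicit Types (x y z p q r : hR).
Local Notation TT := (tensor_alg2 R S).
Local Notation skew := (@skew R W S).
Local Notation rpair := (@root_pairing R W S).
Local Notation eps := (@counit R W S).
Local Notation tns := (@tens_locked R W S).
Local Notation cop := (@coprod_locked R W S).
Local Notation primmul := (@primmul R W S).
Local Notation I := (@nichols_ideal R W S).
Local Notation I2 := (@nichols_ideal2 R W S).
Implicit Types (a b : T) (c : TT).

Lemma tns_linearl b : linear (tns^~ b).
Proof. by rewrite tens_locked.unlock => d a c; rewrite /Defs.tens linearP. Qed.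

Lemma tns_word u v : tns (word u) (word v) = << (FMonom u, FMonom v) >>.
Proof.
have -> : tns (word u) (word v) =
    linext (fun l : {fmonom P} => << (FMonom u, l) >> : TT) (word v).
  by rewrite tens_locked.unlock; apply: linext_word.
exact: linext_word.
Qed.

Lemma tns_linearr a : linear (tns a).
Proof.
move=> d b c; move: a; apply: word_linear_eq => [||u].
- exact: tns_linearl.
- apply: linear_add; last exact: tns_linearl.
  exact/linear_scale/tns_linearl.
have tw e : tns (word u) e =
    linext (fun l : {fmonom P} => << (FMonom u, l) >> : TT) e.
  by rewrite tens_locked.unlock; apply: linext_word.
rewrite !tw; exact: linearP.
Qed.

Lemma tns_linear_eq (V : lmodType C) (f g : TT -> V) : linear f -> linear g ->
  (forall u v, f (tns (word u) (word v)) = g (tns (word u) (word v))) -> f =1 g.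
Proof.
move=> linf ling fg; apply: malg_linear_eq => // -[[u] [v]].
by have := fg u v; rewrite tns_word.
Qed.

Definition bilin (V : lmodType C) (f : T -> T -> V) :=
  (forall b, linear (f^~ b)) /\ (forall a, linear (f a)).

Lemma tnsmap_linear (V : lmodType C) (f : T -> T -> V) : linear (tnsmap f).
Proof. by rewrite tnsmap.unlock; apply: linearP. Qed.

Lemma tnsmap_tns (V : lmodType C) (f : T -> T -> V) a b : bilin f ->
  tnsmap f (tns a b) = f a b.
Proof.
move=> [fl fr]; move: b; apply: word_linear_eq => [||v].
- exact/(linear_compf (@tnsmap_linear _ f))/tns_linearr.
- exact: fr.
move: a; apply: word_linear_eq => [||u].
- exact/(linear_compf (@tnsmap_linear _ f))/tns_linearl.
- exact: fl.
by rewrite tns_word tnsmap.unlock linextU !twordE.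
Qed.

Lemma tns_rep (c : TT) : exists r : seq (T * T), c = \sum_(t <- r) tns t.1 t.2.
Proof.
move: c; apply: malg_linear_ind => [|d c c' [r ->] [r' ->]|[[u] [v]]].
- by exists [::]; rewrite big_nil.
- exists ([seq (d *: t.1, t.2) | t <- r] ++ r'); rewrite big_cat big_map /=.
  rewrite scaler_sumr; congr (_ + _); apply: eq_bigr => t _.
  by rewrite (linZ _ _ (@tns_linearl _)).
by exists [:: (word u, word v)]; rewrite big_seq1 /= tns_word.
Qed.

Lemma I2_linear (d : C) c c' : c \in I2 -> c' \in I2 -> d *: c + c' \in I2.
Proof.
move=> /asboolP[r Ir ->] /asboolP[r' Ir' ->]; apply/asboolP.
exists ([seq (d *: t.1, t.2) | t <- r] ++ r') => [t|].
  rewrite mem_cat => /orP[/mapP[q /Ir Iq ->] /=|/Ir' //].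
  case/orP: Iq => Iq; apply/orP; last by right.
  by left; apply: (nichols_idealZ coxS).
rewrite big_cat big_map scaler_sumr; congr (_ + _); apply: eq_bigr => t _ /=.
by have := linZ d t.1 (@tns_linearl t.2); rewrite tens_locked.unlock.
Qed.

Lemma I2_0 : 0 \in I2. Proof. exact: rpred0. Qed.

Lemma I2_D c c' : c \in I2 -> c' \in I2 -> c + c' \in I2.
Proof. by move=> Ic Ic'; rewrite -[c]scale1r; apply: I2_linear. Qed.

Lemma I2_sum (J : eqType) (r : seq J) (F : J -> TT) :
  {in r, forall j, F j \in I2} -> \sum_(j <- r) F j \in I2.
Proof.
elim: r => [|j r IH] IF; first by rewrite big_nil; apply: I2_0.
rewrite big_cons; apply: I2_D; first by apply: IF; rewrite mem_head.
by apply: IH => k kr; apply: IF; rewrite inE kr orbT.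
Qed.

Lemma I2_tnsl a b : a \in I -> tns a b \in I2.
Proof.
move=> Ia; apply/asboolP; exists [:: (a, b)] => [t|]; last by rewrite big_seq1 tens_locked.unlock.
by rewrite inE => /eqP -> /=; rewrite Ia.
Qed.

Lemma I2_tnsr a b : b \in I -> tns a b \in I2.
Proof.
move=> Ib; apply/asboolP; exists [:: (a, b)] => [t|]; last by rewrite big_seq1 tens_locked.unlock.
by rewrite inE => /eqP -> /=; rewrite Ib orbT.
Qed.

Lemma I2_ind (Q : TT -> Prop) : Q 0 -> (forall c c', Q c -> Q c' -> Q (c + c')) ->
    (forall a b, (a \in I) || (b \in I) -> Q (tns a b)) ->
  forall c, c \in I2 -> Q c.
Proof.
move=> Q0 QD Qt c /asboolP[r Ir ->]; elim: r Ir => [|t r IH] Ir; first by rewrite big_nil.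
rewrite big_cons; apply: QD.
  by have := Qt t.1 t.2; rewrite tens_locked.unlock; apply; apply: Ir; rewrite mem_head.
by apply: IH => q qr; apply: Ir; rewrite inE qr orbT.
Qed.

Lemma linear_eps_skews (l : seq P) : linear (fun a => eps (skews l a) : C^o).
Proof. by move=> d a b; rewrite skews_linear eps_linear. Qed.

(* Rank reduction: if some t.1 is not in I, a functional vanishing on I but  *)
(* not on t.1 expresses t.2, modulo I, by the second factors of the other    *)
(* tensors, so that the tensor t.1 (x) t.2 can be absorbed.                  *)
Lemma I2_rank m (r : seq (T * T)) : (size r <= m)%N ->
    (forall l : seq P, \sum_(t <- r) eps (skews l t.1) *: t.2 \in I) ->
  \sum_(t <- r) tns t.1 t.2 \in I2.
Proof.
elim: m r => [|m IH] r sr rI.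
  by move: sr; rewrite leqn0 => /eqP/size0nil ->; rewrite big_nil; apply: I2_0.
have [allI|/allPn[t0 p0r p0I]] := boolP (all (fun t : T * T => t.1 \in I) r).
  by apply: I2_sum => t pr; apply: I2_tnsl; apply: (allP allI).
have [l el] : exists l : seq P, eps (skews l t0.1) != 0.
  apply: contrapT => no; case/negP: p0I; apply/(nichols_idealP coxS) => l.
  by apply/eqP/negPn/negP => ne; apply: no; exists l.
pose r' := rem t0 r; have permr : perm_eq r (t0 :: r') by apply: perm_to_rem.
have sr' : (size r' <= m)%N by rewrite size_rem // -ltnS (leq_trans _ sr) // ltn_predL; case: (r) p0r.
set d := eps (skews l t0.1) in el.
pose e (t : T * T) := eps (skews l t.1) / d.
have sumE (V : lmodType C) (F : T * T -> V) :
    \sum_(t <- r) F t = F t0 + \sum_(t <- r') F t.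
  by rewrite (perm_big _ permr) big_cons.
pose r'' := [seq (t.1 - e t *: t0.1, t.2) | t <- r'].
have IH' : \sum_(t <- r'') tns t.1 t.2 \in I2.
  apply: IH => [|l']; first by rewrite size_map.
  set d' := eps (skews l' t0.1).
  have -> : \sum_(t <- r'') eps (skews l' t.1) *: t.2 =
      - (d' / d) *: (\sum_(t <- r) eps (skews l t.1) *: t.2)
      + \sum_(t <- r) eps (skews l' t.1) *: t.2.
    have E1 := sumE _ (fun t => eps (skews l t.1) *: t.2).
    have E2 := sumE _ (fun t => eps (skews l' t.1) *: t.2).
    refine (etrans _ (esym (congr2 (fun A B : T => - (d' / d) *: A + B) E1 E2))).
    refine (etrans _ (rank_reduce r' (fun t => eps (skews l t.1))
      (fun t => eps (skews l' t.1)) (fun t => t.2) d' t0.2 el)).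
    rewrite big_map; apply: eq_bigr => t _; apply: (congr1 (fun f => f *: t.2)).
    rewrite (linB _ _ (linear_eps_skews l')) /e.
    by rewrite [X in _ - X](linZ _ _ (linear_eps_skews l')).
  exact: (nichols_idealD (nichols_idealZ coxS _ (rI l)) (rI l')).
pose z := \sum_(t <- r) eps (skews l t.1) *: t.2.
have zE : \sum_(t <- r) tns t.1 t.2 = tns t0.1 (d^-1 *: z) + \sum_(t <- r'') tns t.1 t.2.
  rewrite /z !sumE -/d scalerDr scalerA mulVf // scale1r (linD _ _ (tns_linearr _)) -addrA.
  congr (_ + _); rewrite scaler_sumr (lin_sum _ _ _ (tns_linearr _)) big_map -big_split.
  apply: eq_bigr => t _ /=; rewrite scalerA (linB _ _ (tns_linearl _)).
  rewrite (linZ _ _ (tns_linearl _)) (linZ _ _ (tns_linearr _)) /e [_ / d]mulrC.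
  by rewrite addrC subrK.
rewrite zE; apply: I2_D IH'; apply: I2_tnsr.
exact: (nichols_idealZ coxS d^-1 (rI l)).
Qed.

Lemma bilin_skew p : bilin (fun a b => tns (skew p a) b).
Proof.
split=> [b|a]; last exact: tns_linearr.
exact/(linear_compf (tns_linearl b))/skew_linear.
Qed.

Definition skewl p : TT -> TT := tnsmap (fun a b => tns (skew p a) b).

Lemma skewl_tns p a b : skewl p (tns a b) = tns (skew p a) b.
Proof. exact: (tnsmap_tns _ _ (bilin_skew p)). Qed.

Lemma skewl_linear p : linear (skewl p). Proof. exact: tnsmap_linear. Qed.

Lemma bilin_eps : bilin (fun a b => eps a *: b).
Proof.
split=> [b d a c|a]; last exact/linear_scale/linear_id.
by rewrite eps_linear scalerDl scalerA.
Qed.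

Definition epsl : TT -> T := tnsmap (fun a b => eps a *: b).

Lemma epsl_tns a b : epsl (tns a b) = eps a *: b.
Proof. exact: (tnsmap_tns _ _ bilin_eps). Qed.

Lemma epsl_linear : linear epsl. Proof. exact: tnsmap_linear. Qed.

Fixpoint skewls (l : seq P) (c : TT) : TT :=
  if l is p :: l' then skewls l' (skewl (val p) c) else c.

Lemma skewls_linear l : linear (skewls l).
Proof. by elim: l => //= p l IH c a b; rewrite skewl_linear IH. Qed.

Lemma skewls_tns l a b : skewls l (tns a b) = tns (skews l a) b.
Proof. by elim: l a => //= p l IH a; rewrite skewl_tns IH. Qed.

(** The functionals [eps (skews l _)] have I as their common kernel, so by [I2_rank] it is enough to
    apply them to the left factor and to look for the result in I. *)
Lemma I2_intro c : (forall l, epsl (skewls l c) \in I) -> c \in I2.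
Proof.
have [r ->] := tns_rep c => cI; apply: (I2_rank (leqnn _)) => l; move: (cI l).
rewrite (lin_sum _ _ _ (skewls_linear l)) (lin_sum _ _ _ epsl_linear).
have -> : \sum_(t <- r) epsl (skewls l (tns t.1 t.2)) =
    \sum_(t <- r) eps (skews l t.1) *: t.2.
  by apply: eq_bigr => t _; rewrite skewls_tns epsl_tns.
exact.
Qed.

Local Notation twist k := (linext (fun l : ({fmonom P} * {fmonom P})%type =>
  tns (tword k.1 ** tact (wdeg k.2) (tword l.1)) (tword k.2 ** tword l.2))).

Lemma primmulE (x : P) c : primmul x c =
  twist (FMonom [:: x], FMonom [::] : {fmonom P}) c
  + twist (FMonom [::] : {fmonom P}, FMonom [:: x]) c.
Proof.
have E : Defs.tens (Defs.tgen x) 1 + Defs.tens 1 (Defs.tgen x) =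
    << (FMonom [:: x], FMonom [::]) >> + << (FMonom [::], FMonom [:: x]) >> :> TT.
  by rewrite -!tns_word -!tgenE word_nil tens_locked.unlock tgen_locked.unlock.
have -> : primmul x c = twisted_mul (Defs.tens (Defs.tgen x) 1 + Defs.tens 1 (Defs.tgen x)) c.
  by rewrite primmul.unlock.
rewrite E tens_locked.unlock tmul.unlock tact_locked.unlock /twisted_mul.
set f := fun k => linext _ c.
have linf : linear (linext f) by apply: linearP.
rewrite (linD _ _ linf).
exact: (congr2 (fun A B => A + B) (linextU f _) (linextU f _)).
Qed.

Lemma primmul_linear (x : P) : linear (primmul x).
Proof.
move=> d c c'; rewrite !primmulE.
by apply: (linear_add (f := twist _) (g := twist _)); apply: linearP.
Qed.

Lemma primmul_tns (x : P) a b : primmul x (tns a b) =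
  tns (tgen x ** a) b + tns (tact (rr (val x)) a) (tgen x ** b).
Proof.
move: b; apply: word_linear_eq => [||v].
- exact/(linear_compf (primmul_linear x))/tns_linearr.
- apply: linear_add; first exact: tns_linearr.
  exact/(linear_compf (tns_linearr _))/linear_mull/linear_id.
move: a; apply: word_linear_eq => [||u].
- exact/(linear_compf (primmul_linear x))/tns_linearl.
- apply: linear_add; last exact/(linear_compf (tns_linearl _))/tact_linear.
  exact/(linear_compf (tns_linearl _))/linear_mull/linear_id.
rewrite primmulE.
have tw k l : twist (FMonom k, FMonom l) (tns (word u) (word v)) =
    tns (word k ** tact (wdeg (FMonom l)) (word u)) (word l ** word v).
  rewrite [X in linext _ X]tns_word; apply: etrans (linextU _ _) _.
  by rewrite word.unlock.
apply: etrans (congr2 (fun A B : TT => A + B) (tw _ _) (tw _ _)) _.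
rewrite wdeg_nil wdeg_cons wdeg_nil mulg1 (tact_id coxS) !tmul1l -tgenE.
reflexivity.
Qed.

Lemma cop_linear : linear cop.
Proof. by rewrite coprod_locked.unlock; apply: linearP. Qed.

Lemma cop1 : cop (word [::]) = tns (word [::]) (word [::]).
Proof. by rewrite coprod_locked.unlock /coprod linext_word tens_locked.unlock word_nil. Qed.

Lemma cop_tgen (x : P) b : cop (tgen x ** b) = primmul x (cop b).
Proof.
move: b; apply: word_linear_eq => [||v].
- exact/(linear_compf cop_linear)/linear_mull/linear_id.
- exact/(linear_compf (primmul_linear x))/cop_linear.
by rewrite -word_cons coprod_locked.unlock /coprod !linext_word primmul.unlock.
Qed.

(** Both summands of [primmul x] move p by s_x: the one with [tgen x ** a] by the Leibniz rule, the
    one with [tact (rr (val x)) a] by [skew_tact]. *)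
Lemma skewl_primmul p (x : P) c : skewl p (primmul x c) =
  rpair p (val x) *: c + primmul x (skewl (wact (rr (val x)) p) c).
Proof.
move: c; apply: tns_linear_eq => [||u v].
- exact/(linear_compf (@skewl_linear p))/primmul_linear.
- apply: linear_add; first exact/linear_scale/linear_id.
  exact/(linear_compf (primmul_linear x))/skewl_linear.
have rK : wact (rr (val x)) (wact (rr (val x)) p) = p.
  by rewrite -(wactM coxS) (root_reflection_invol coxS (root_val x)) (wact1 coxS).
rewrite primmul_tns (linD _ _ (@skewl_linear p)) !skewl_tns primmul_tns skew_tgen.
rewrite (tns_linearl (word v)) -(skew_tact coxS) rK.
by rewrite addrA.
Qed.

(** A derivation passes through the coproduct onto its left factor. With [epsl_cop], this reduces
    each test of [I2_intro] on a coproduct to a statement about [skews l b]. *)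
Lemma skewl_cop p b : skewl p (cop b) = cop (skew p b).
Proof.
move: b; apply: word_linear_eq => [||u].
- exact/(linear_compf (@skewl_linear p))/cop_linear.
- exact/(linear_compf cop_linear)/skew_linear.
elim: u p => [|x u IH] p.
  by rewrite cop1 skewl_tns skew1 (lin0 cop_linear) (lin0 (tns_linearl _)).
rewrite word_cons cop_tgen skewl_primmul IH skew_tgen cop_linear cop_tgen.
reflexivity.
Qed.

Lemma eps_tact g b : eps (tact g b) = eps b.
Proof.
have lin : linear (fun b => eps (tact g b) : C^o).
  by move=> c d e; rewrite tact_linear eps_linear.
move: b; apply: (word_linear_eq lin) => [|[|x u]]; first exact: eps_linear.
  by rewrite tact1.
rewrite tact_word eps_word.
have ir : is_root (wact g (val x)) by rewrite (is_root_wact coxS); apply: root_val.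
case/(rootP coxS): ir => y [->|->]; first by rewrite xroot_pos eps_tgen.
rewrite (xroot_neg coxS) tmulNl.
by rewrite /counit mcoeffN -/(eps _) eps_tgen oppr0.
Qed.

Lemma epsl_primmul (x : P) c : epsl (primmul x c) = tgen x ** epsl c.
Proof.
move: c; apply: tns_linear_eq => [||u v].
- exact/(linear_compf epsl_linear)/primmul_linear.
- exact/linear_mull/epsl_linear.
rewrite primmul_tns (linD _ _ epsl_linear) !epsl_tns eps_tgen scale0r add0r.
by rewrite eps_tact tmulZr.
Qed.

Lemma epsl_cop b : epsl (cop b) = b.
Proof.
move: b; apply: word_linear_eq => [||u]; [|exact: linear_id|].
- exact/(linear_compf epsl_linear)/cop_linear.
elim: u => [|x u IH]; first by rewrite cop1 epsl_tns eps1 scale1r.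
by rewrite word_cons cop_tgen epsl_primmul IH.
Qed.

Lemma cop_I2 b : b \in I -> cop b \in I2.
Proof.
move=> Ib; apply: I2_intro => l.
have -> : skewls l (cop b) = cop (skews l b).
  by elim: l b {Ib} => //= p l IH b; rewrite skewl_cop IH.
by rewrite epsl_cop; apply: nichols_ideal_skews.
Qed.

Lemma primmul_I2 (x : P) c : c \in I2 -> primmul x c \in I2.
Proof.
move: c; apply: I2_ind => [|c c' Ic Ic'|a b /orP[Ia|Ib]].
- rewrite (lin0 (primmul_linear x)); exact: I2_0.
- by rewrite (linD _ _ (primmul_linear x)); apply: I2_D.
- rewrite primmul_tns; apply: I2_D; apply: I2_tnsl.
    exact: nichols_ideal_mull.
  exact: nichols_ideal_tact.
rewrite primmul_tns; apply: I2_D; apply: I2_tnsr; first by [].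
exact: nichols_ideal_mull.
Qed.

End TensorSquare.

Definition gate (V : zmodType) (b : bool) (x : V) : V := if b then x else 0.

Lemma gateD (V : zmodType) b (x y : V) : gate b (x + y) = gate b x + gate b y.
Proof. by case: b => //=; rewrite addr0. Qed.

Lemma gate_and (V : zmodType) b b' (x : V) : gate b (gate b' x) = gate (b && b') x.
Proof. by case: b. Qed.

Lemma gate_morph (U V : zmodType) (f : U -> V) b x : f 0 = 0 -> f (gate b x) = gate b (f x).
Proof. by case: b. Qed.

(** The recursion for f(sw,v) unrolled into a tensor, for words that may fail to be reduced; thus
    [skexp_rcons] is an identity before passing to the quotient. *)
Fixpoint skew_expansion (R : realType) (W : finGroupType) (S : {set W})
    (u : seq 'I_#|S|) (v : W) : tensor_alg R S :=
  if u is i :: u' then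
    xroot_locked (wact v^-1%g (sroot R i)) ** skew_expansion R u' v
    + gate (wlen (@simple W S) (simple i * v)%g < wlen (@simple W S) v)%N
        (skew_expansion R u' (simple i * v)%g)
  else gate (v == 1%g) (word [::]).

HB.lock Definition skexp (R : realType) (W : finGroupType) (S : {set W})
    (u : seq 'I_#|S|) (v : W) : tensor_alg R S := skew_expansion R u v.

HB.lock Definition npi2 (R : realType) (W : finGroupType) (S : {set W})
    (c : tensor_alg2 R S) : nichols2 R S := \pi_(nichols2 R S) c.

(** * The elements x_{w/v} *)

Section BruhatLifting.
Context (W : finGroupType) (S : {set W}) (coxS : coxeter_system S).
Local Notation s := (@simple W S).
Local Notation len := (wlen s).
Let ginvol := simple_invol coxS.

(** Each side says that s_j v s_i is shorter than v by two. *)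
Lemma len_mixed i j v :
  ((len (s j * v)%g < len v) && (len (s j * v * s i)%g < len (s j * v)%g))%N =
  ((len (v * s i)%g < len v) && (len (s j * (v * s i))%g < len (v * s i)%g))%N.
Proof.
have [eta geta] := coxeter_cocycle coxS.
have aux (a b c d : nat) : b = a.+1 \/ a = b.+1 -> c = a.+1 \/ a = c.+1 ->
    d = b.+1 \/ b = d.+1 -> d = c.+1 \/ c = d.+1 ->
    ((b < a) && (d < b) = (c < a) && (d < c))%N by lia.
rewrite (aux _ _ _ _ (len_simpleP geta j v) (len_simplerP geta i v)
  (len_simplerP geta i (s j * v)%g)) -(mulgA (s j) v (s i)) //.
exact: len_simpleP geta j (v * s i)%g.
Qed.

(** Write y = t x with the reflection t on the left. If t = s_i, then s_i x = y. Otherwise the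
    cocycle of s_i x at the conjugate of t by s_i equals that of x at t, so the step from s_i x to
    s_i y still goes up. *)
Lemma bruhat_step_simple i x y : bruhat_step S x y ->
  bruhat S (s i * x)%g y \/ bruhat S (s i * x)%g (s i * y)%g.
Proof.
have [eta geta] := coxeter_cocycle coxS.
case/andP => /existsP[t /andP[tR /eqP yE]] lt.
have [k [h tE]] : exists k h, t = (s k ^ h)%g.
  case/imset2P: tR => z h zS _ ->; exists (enum_rank_in zS z), h.
  by rewrite /simple enum_rankK_in.
have yE' : y = (s k ^ (h * x^-1) * x)%g by rewrite conjgM -tE conjgE invgK -mulgA mulgKV -yE.
have neta : eta x (s k ^ (h * x^-1))%g = false.
  by rewrite (cocycle_ltE geta) -yE' ltnNge ltnW.
have [ti|ti] := eqVneq (s k ^ (h * x^-1))%g (s i).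
  by left; rewrite -ti -yE'; apply: connect0.
right; apply: connect1; apply/andP; split.
  by apply/existsP; exists t; rewrite tR yE mulgA eqxx.
have -> : (s i * y = s k ^ (h * x^-1 * s i) * (s i * x))%g.
  by rewrite yE' [in RHS]conjgM (conjgE _ (s i)) (ginv ginvol) -!mulgA (mulgg ginvol).
have := refl_leNgt geta k (h * x^-1 * s i)%g (s i * x)%g.
have iK (r : W) : ((r ^ s i) ^ s i = r)%g by rewrite -conjgM ginvol conjg1.
rewrite -(cocycle_ltE geta) (cocycleM geta) (cocycleE geta) conjgM iK neta addbF.
rewrite -(inj_eq (@conjg_inj _ (s i))) iK [(s i ^ _)%g]conjgE mulKg (negbTE ti).
by move/esym/negbFE.
Qed.

Lemma bruhat_lift i x y : bruhat S x y ->
  bruhat S (s i * x)%g y \/ bruhat S (s i * x)%g (s i * y)%g.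
Proof.
case/connectP => p; elim: p x => [|z p IH] x /=.
  by move=> _ ->; right; apply: connect0.
case/andP => xz pz yE; have zy : bruhat S z y by apply/connectP; exists p.
case: (bruhat_step_simple i xz) => [H|H].
  by left; apply: connect_trans H zy.
by case: (IH _ pz yE) => H'; [left|right]; apply: connect_trans H H'.
Qed.

End BruhatLifting.

Section SkewElements.
Context (R : realType) (W : finGroupType) (S : {set W}) (coxS : coxeter_system S).

Local Notation n := #|S|.
Local Notation hR := 'rV[R]_n.
Local Notation P := (posroot R S).
Local Notation T := (tensor_alg R S).
Local Notation rr := (@root_reflection R W S).
Local Notation xroot := (@xroot_locked R W S).
Local Notation tgen := (@tgen_locked R W S).
Local Notation word := (@word R W S).
Local Notation tact := (@tact_locked R W S).
Implicit Types (x y z p q r : hR).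
Local Notation TT := (tensor_alg2 R S).
Local Notation eps := (@counit R W S).
Local Notation tns := (@tens_locked R W S).
Local Notation cop := (@coprod_locked R W S).
Local Notation npi := (@npi R W S).
Local Notation pi2 := (@npi2 R W S).
Local Notation rv := (@trev_locked R W S).
Local Notation xw := (@xw R W S).
Local Notation primmul := (@primmul R W S).
Local Notation skexp := (@skexp R W S).
Local Notation I := (@nichols_ideal R W S).
Local Notation I2 := (@nichols_ideal2 R W S).
Local Notation s := (@simple W S).
Local Notation a_ := (@sroot R W S).
Local Notation len := (wlen s).
Implicit Types (a b : T) (c : TT) (u : seq 'I_n) (v w : W).

Let ggen := simple_gen coxS.
Let ginvol := simple_invol coxS.

Lemma skexp_nil v : skexp [::] v = gate (v == 1%g) (word [::]).
Proof. by rewrite skexp.unlock. Qed.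

Lemma skexp_cons i u v : skexp (i :: u) v =
  xroot (wact v^-1%g (a_ i)) ** skexp u v
  + gate (len (s i * v)%g < len v)%N (skexp u (s i * v)%g).
Proof. by rewrite skexp.unlock. Qed.

Lemma gate_tmull (d : bool) a a' : a ** gate d a' = gate d (a ** a').
Proof. by case: d; rewrite /gate ?tmul0r. Qed.

Lemma gate_tmulr (d : bool) a a' : gate d a ** a' = gate d (a ** a').
Proof. by case: d; rewrite /gate ?tmul0l. Qed.

Lemma gate_tact (d : bool) g a : tact g (gate d a) = gate d (tact g a).
Proof. exact: (gate_morph _ _ (lin0 (tact_linear g))). Qed.

Lemma len_inv v : len v^-1%g = len v. Proof. exact: (wlenV ggen ginvol). Qed.

(** The same expansion read from its other end. After the reversal in [colexp] the last letter of u
    becomes the first one, which is the letter that the coproduct peels off; the two mixed terms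
    match by [len_mixed]. *)
Lemma skexp_rcons u i v : skexp (rcons u i) v =
  skexp u v ** xroot (a_ i)
  + gate (len (v * s i)%g < len v)%N (tact (s i) (skexp u (v * s i)%g)).
Proof.
elim: u v => [|j u IH] v.
  rewrite skexp_cons !skexp_nil gate_tmull gate_tmulr gate_tact tmul1l tmul1r tact1 !gate_and.
  have -> : ((s i * v)%g == 1%g) = ((v * s i)%g == 1%g).
    by rewrite -!eq_invg_mul -(inj_eq invg_inj) invgK eq_sym.
  have [->|nv] := eqVneq v 1%g; first by rewrite invg1 (wact1 coxS) mulg1 mul1g.
  have [e|_] := eqVneq (v * s i)%g 1%g; last by rewrite !andbF.
  have -> : v = s i by rewrite -[v](mulgK (s i)) e mul1g (ginv ginvol).
  by [].
rewrite rcons_cons !skexp_cons !IH tmulDr gateD gate_tmull gate_and (len_mixed coxS).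
rewrite tmulDl gate_tmulr !tmulA tactD tactM gate_tact gateD gate_and.
have -> : tact (s i) (xroot (wact (v * s i)^-1%g (a_ j))) = xroot (wact v^-1%g (a_ j)).
  rewrite (tact_xroot coxS); last exact: root_wact_simple.
  by rewrite invMg (ginv ginvol) (wactM coxS) -(wactM coxS (s i)) ginvol (wact1 coxS).
by rewrite addrACA (mulgA (s j)).
Qed.

(* For a reduced word u of w, skexp u v represents the element x_{w/v}^o and    *)
(* colexp u v represents x_{w/v}.                                              *)
Definition colexp u v : T := rv (skexp (rev u) v^-1%g).

Lemma rv_tact g a : rv (tact g a) = tact g (rv a).
Proof.
move: a; apply: word_linear_eq => [||l].
- exact/(linear_compf (@rv_linear _ _ _))/tact_linear.
- exact/(linear_compf (@tact_linear _ _ _ g))/rv_linear.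
elim: l => [|x l IH]; first by rewrite tact1 rv_word tact1.
rewrite tact_word rvM IH word_cons rvM tactM rv_tgen tact_tgen rv_xroot //.
by rewrite (is_root_wact coxS); apply: root_val.
Qed.

Lemma colexp_cons i u v : colexp (i :: u) v =
  xroot (a_ i) ** colexp u v
  + gate (len (s i * v)%g < len v)%N (tact (s i) (colexp u (s i * v)%g)).
Proof.
rewrite /colexp rev_cons skexp_rcons (linD _ _ (@rv_linear _ _ _)) rvM.
rewrite (rv_xroot coxS (root_simple R coxS i)).
have E : (v^-1 * s i)%g = (s i * v)^-1%g by rewrite invMg (ginv ginvol).
by rewrite E !len_inv (gate_morph _ _ (lin0 (@rv_linear _ _ _))) rv_tact.
Qed.

Lemma colexp_nil v : colexp [::] v = gate (v == 1%g) (word [::]).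
Proof.
rewrite /colexp skexp_nil invg_eq1 (gate_morph _ _ (lin0 (@rv_linear _ _ _))).
by rewrite rv_word.
Qed.

(** A nonzero term requires v or s_i v to lie below the product of the tail, and [bruhat_lift] then
    puts v below s_i times that product. This restricts the sum of [pi2_cop_xw] to the range that
    [is_nquot] asks for. *)
Lemma colexp_bruhat u v : reduced s u -> ~~ bruhat S v (wprod s u) -> colexp u v = 0.
Proof.
have [eta geta] := coxeter_cocycle coxS.
elim: u v => [|i u IH] v red nb.
  rewrite colexp_nil; case: eqP nb => // ->.
  by rewrite wprod_nil /bruhat connect0.
move: red; rewrite (reduced_cons geta) wprod_cons => /andP[red lt].
have up : bruhat S (wprod s u) (s i * wprod s u)%g.
  apply: connect1; apply/andP; split=> //; apply/existsP.
  exists (s i ^ wprod s u)%g; rewrite conjgE mulKVg eqxx andbT.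
  apply/imset2P; exists (s i) (wprod s u); rewrite ?inE ?conjgE //.
  exact: enum_valP.
rewrite colexp_cons IH //; last first.
  apply: contra nb => vb; rewrite wprod_cons; exact: connect_trans vb up.
rewrite tmul0r add0r /gate; case: ifP => // _; rewrite IH ?(lin0 (tact_linear _)) //.
apply: contra nb => vb; rewrite wprod_cons.
have := bruhat_lift coxS i vb; rewrite (mulgg ginvol) => -[H|//].
exact: connect_trans H up.
Qed.

Definition xv v : T := xw (rword s v).

Lemma npi_xv u : reduced s u -> npi (xw u) = npi (xv (wprod s u)).
Proof.
move=> red; rewrite /xv; apply: (npi_reduced R coxS red); first exact: (reduced_rword ggen).
by rewrite (wprod_rword ggen).
Qed.

Lemma npi_xv_simple i v : npi (xroot (a_ i) ** xv v) =
  gate (len v < len (s i * v)%g)%N (npi (xv (s i * v)%g)).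
Proof.
have [eta geta] := coxeter_cocycle coxS.
have cons (z : W) : (len z < len (s i * z)%g)%N ->
    npi (xroot (a_ i) ** xv z) = npi (xv (s i * z)%g).
  move=> lt; rewrite -xw_cons npi_xv ?wprod_cons ?(wprod_rword ggen) //.
  by rewrite (reduced_cons geta) (reduced_rword ggen) wprod_cons (wprod_rword ggen).
rewrite /gate; case: ifP => [/cons //|/negbT].
rewrite -(simple_leNgt geta) => lt.
have := cons (s i * v)%g; rewrite (mulgg ginvol) => /(_ lt) E.
rewrite -(npi_mull coxS _ E).
apply/npi0P; rewrite tmulA.
exact: (nichols_ideal_mulr coxS _ (nichols_ideal_sqr coxS (root_simple R coxS i))).
Qed.

Lemma pi2P (c c' : TT) : pi2 c = pi2 c' <-> c - c' \in I2.
Proof.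
rewrite npi2.unlock Quotient.idealrBE.
by split=> [->|/eqP]; [exact: eqxx|exact].
Qed.

Lemma pi2D (c c' : TT) : pi2 (c + c') = pi2 c + pi2 c'.
Proof. by rewrite npi2.unlock; apply: raddfD. Qed.

Lemma pi20 : pi2 0 = 0.
Proof. by rewrite npi2.unlock; apply: raddf0. Qed.

Lemma pi2_sum (J : Type) (l : seq J) (Q : pred J) (F : J -> TT) :
  pi2 (\sum_(j <- l | Q j) F j) = \sum_(j <- l | Q j) pi2 (F j).
Proof. exact: (big_morph pi2 pi2D pi20). Qed.

Lemma tnsBl a a' b : tns (a - a') b = tns a b - tns a' b.
Proof. exact: (linB _ _ (@tns_linearl _ _ _ b)). Qed.

Lemma tnsBr a b b' : tns a (b - b') = tns a b - tns a b'.
Proof. exact: (linB _ _ (@tns_linearr _ _ _ a)). Qed.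

Lemma tns0l b : tns 0 b = 0.
Proof. exact: (lin0 (@tns_linearl _ _ _ b)). Qed.

Lemma tns0r a : tns a 0 = 0.
Proof. exact: (lin0 (@tns_linearr _ _ _ a)). Qed.

Lemma tnsDl a a' b : tns (a + a') b = tns a b + tns a' b.
Proof. exact: (linD _ _ (@tns_linearl _ _ _ b)). Qed.

Lemma pi2_tns a a' b b' : npi a = npi a' -> npi b = npi b' ->
  pi2 (tns a b) = pi2 (tns a' b').
Proof.
move=> /npiP Ia /npiP Ib; transitivity (pi2 (tns a' b)); apply/pi2P.
  by have H := I2_tnsl b Ia; rewrite tnsBl in H; exact: H.
by have H := I2_tnsr a' Ib; rewrite tnsBr in H; exact: H.
Qed.

Lemma pi2_primmul (x : P) (c c' : TT) :
  pi2 c = pi2 c' -> pi2 (primmul x c) = pi2 (primmul x c').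
Proof.
move=> /pi2P Ic; apply/pi2P; have H := primmul_I2 coxS x Ic.
by rewrite (linB _ _ (@primmul_linear _ _ _ x)) in H; exact: H.
Qed.

(** [primmul] yields two sums over v. In the second, x_i x_v is x_(s_i v) or 0 in the quotient, and
    replacing v by s_i v produces the gated term of [colexp_cons]. *)
Lemma pi2_cop_xw u : pi2 (cop (xw u)) = \sum_v pi2 (tns (colexp u v) (xv v)).
Proof.
have [eta geta] := coxeter_cocycle coxS.
elim: u => [|i u IH].
  rewrite xw_nil cop1 (bigD1 1%g) //= big1 ?addr0 => [|v nv].
    rewrite colexp_nil eqxx; apply: pi2_tns => //.
    by rewrite -xw_nil npi_xv ?wprod_nil //; apply/reducedP.
  by rewrite colexp_nil (negbTE nv) tns0l pi20.
have xE : xroot (a_ i) = tgen (spos R coxS i) by rewrite -xroot_pos.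
have rE : rr (val (spos R coxS i)) = s i by apply: (root_reflection_sroot R coxS i).
rewrite xw_cons xE cop_tgen.
have IH' : pi2 (cop (xw u)) = pi2 (\sum_v tns (colexp u v) (xv v)) by rewrite IH pi2_sum.
rewrite (pi2_primmul _ IH') (lin_sum _ _ _ (@primmul_linear _ _ _ _)) pi2_sum.
transitivity (\sum_v pi2 (tns (tgen (spos R coxS i) ** colexp u v) (xv v))
   + \sum_v pi2 (tns (tact (s i) (colexp u v)) (tgen (spos R coxS i) ** xv v))).
  rewrite -big_split; apply: eq_bigr => v _.
  by rewrite (primmul_tns coxS) rE pi2D.
rewrite [X in _ + X](reindex_inj (mulgI (s i))) /= -big_split; apply: eq_bigr => v _ /=.
rewrite colexp_cons -xE tnsDl pi2D; congr (_ + _).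
have := npi_xv_simple i (s i * v)%g; rewrite (mulgg ginvol) /gate; case: ifP => lt e.
  exact: pi2_tns.
rewrite tns0l pi20 -pi20 -(tns0r (tact (s i) (colexp u (s i * v)%g))).
by apply: pi2_tns => //; rewrite e npi0.
Qed.

Lemma nelt_npi w : nelt R S w = npi (xv w).
Proof.
rewrite /nelt /xv; elim: (rword s w) => [|i u IH].
  by rewrite big_nil xw_nil npi.unlock /nunit word_nil.
rewrite big_cons IH xw_cons -(nmul_npi coxS); congr nmul.
by rewrite npi.unlock /nroot xroot_locked.unlock.
Qed.

Lemma ncoprod_npi a : ncoprod (npi a) = pi2 (cop a).
Proof.
have -> : ncoprod (npi a) = pi2 (cop (repr (npi a))).
  by rewrite npi2.unlock coprod_locked.unlock.
apply/pi2P; have H := cop_I2 coxS (repr_npi a).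
by rewrite (linB _ _ (@cop_linear _ _ _)) in H; exact: H.
Qed.

Lemma ntens_npi a b : ntens (npi a) (npi b) = pi2 (tns a b).
Proof.
have -> : ntens (npi a) (npi b) = pi2 (tns (repr (npi a)) (repr (npi b))).
  by rewrite npi2.unlock tens_locked.unlock.
by apply: pi2_tns; rewrite npi_repr.
Qed.

Definition nquot_family u : {ffun W -> nichols R S} := [ffun v => npi (colexp u v)].

Lemma nquot_familyP u : reduced s u -> is_nquot (wprod s u) (nquot_family u).
Proof.
move=> red; split=> [|v nb]; last by rewrite ffunE colexp_bruhat ?npi0.
rewrite nelt_npi -npi_xv // ncoprod_npi pi2_cop_xw (bigID (bruhat S ^~ (wprod s u))) /=.
rewrite [X in _ + X]big1 ?addr0 => [|v nb]; last first.
  by rewrite colexp_bruhat // tns0l pi20.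
by apply: eq_bigr => v _; rewrite ffunE nelt_npi ntens_npi.
Qed.

Lemma bilin_evalr (l : seq P) : bilin (fun a b => eps (skews l b) *: a).
Proof.
split=> [b|a d b b']; first exact/linear_scale/linear_id.
by rewrite skews_linear eps_linear scalerDl scalerA.
Qed.

(** Evaluating the second factor by the functional dual to x_v sends [I2] into [I], and singles out
    the term at v in the difference of the two expansions. *)
Lemma nquot_uniq w (q q' : {ffun W -> nichols R S}) :
  is_nquot w q -> is_nquot w q' -> q = q'.
Proof.
move=> [qE q0] [qE' q0']; apply/ffunP => v.
have [vw|nvw] := boolP (bruhat S v w); last by rewrite q0 ?q0'.
pose f := tnsmap (fun a b => eps (skews (map (spos R coxS) (rword s v)) b) *: a).
have flin : linear f by apply: tnsmap_linear.
have fT a b : f (tns a b) = eps (skews (map (spos R coxS) (rword s v)) b) *: a.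
  exact: (tnsmap_tns _ _ (bilin_evalr _)).
have fI c : c \in I2 -> f c \in I.
  move: c; apply: I2_ind => [|c c' Ic Ic'|a b /orP[Ia|Ib]].
  - rewrite (lin0 flin); exact: nichols_ideal0.
  - rewrite (linD _ _ flin); exact: (nichols_idealD Ic Ic').
  - rewrite fT; exact: (nichols_idealZ coxS _ Ia).
  rewrite fT.
  rewrite (nichols_ideal_eps coxS (nichols_ideal_skews coxS _ Ib)) scale0r.
  exact: nichols_ideal0.
pose D := \sum_(t | bruhat S t w) tns (repr (q t) - repr (q' t)) (xv t).
have DI : D \in I2.
  rewrite -[D]subr0; apply/pi2P; rewrite pi20 /D pi2_sum.
  have E (r : {ffun W -> nichols R S}) : \sum_(t | bruhat S t w) ntens (r t) (nelt R S t)
      = \sum_(t | bruhat S t w) pi2 (tns (repr (r t)) (xv t)).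
    by apply: eq_bigr => t _; rewrite -{1}(npi_repr (r t)) nelt_npi ntens_npi.
  have EE : \sum_(t | bruhat S t w) pi2 (tns (repr (q t)) (xv t))
      = \sum_(t | bruhat S t w) pi2 (tns (repr (q' t)) (xv t)).
    exact: etrans (etrans (esym (E q)) (etrans (esym qE) qE')) (E q').
  have pi2N c : pi2 (- c) = - pi2 c by rewrite npi2.unlock; apply: raddfN.
  transitivity (\sum_(t | bruhat S t w) (pi2 (tns (repr (q t)) (xv t))
      - pi2 (tns (repr (q' t)) (xv t)))).
    by apply: eq_bigr => t _; rewrite tnsBl pi2D pi2N.
  by rewrite sumrB EE subrr.
have fD : f D = repr (q v) - repr (q' v).
  rewrite /D (lin_sum _ _ _ flin) (bigD1 v) //= big1 ?addr0 => [|t /andP[_ nt]].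
    rewrite fT (eps_skews_xw R coxS); try exact: (reduced_rword ggen).
    by rewrite eqxx scale1r.
  rewrite fT (eps_skews_xw R coxS); try exact: (reduced_rword ggen).
  by rewrite !(wprod_rword ggen) eq_sym (negbTE nt) scale0r.
by rewrite -(npi_repr (q v)) -(npi_repr (q' v)); apply/npiP; rewrite -fD; apply: fI.
Qed.

Lemma nquotE u v : reduced s u -> nquot R S (wprod s u) v = npi (colexp u v).
Proof.
move=> red; have fam := nquot_familyP red; rewrite /nquot.
case: classical_sets.xgetP => [q _ qP|no]; last by case: (no _ fam).
by rewrite (nquot_uniq qP fam) ffunE.
Qed.

Lemma nquot_opE u v : reduced s u -> nquot_op R S (wprod s u) v = npi (skexp u v).
Proof.
move=> red; rewrite /nquot_op -(wprod_rev ginvol) nquotE ?reduced_rev //.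
have nrevE (t : nichols R S) : nrev t = npi (rv (repr t)).
  by rewrite npi.unlock trev_locked.unlock.
rewrite nrevE; transitivity (npi (rv (colexp (rev u) v^-1%g))).
  apply/npiP; have H := nichols_ideal_rv coxS (repr_npi (colexp (rev u) v^-1%g)).
  by rewrite (linB _ _ (@rv_linear _ _ _)) in H; exact: H.
by rewrite /colexp rvK revK invgK.
Qed.

End SkewElements.

(** * The sum over subwords *)

Section SubsetSum.
Context (R : realType) (W : finGroupType) (S : {set W}) (coxS : coxeter_system S).

Local Notation n := #|S|.
Local Notation hR := 'rV[R]_n.
Local Notation T := (tensor_alg R S).
Local Notation xroot := (@xroot_locked R W S).
Local Notation word := (@word R W S).
Implicit Types (x y z p q r : hR).
Local Notation npi := (@npi R W S).
Local Notation skexp := (@skexp R W S).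
Local Notation s := (@simple W S).
Local Notation a_ := (@sroot R W S).
Local Notation len := (wlen s).
Implicit Types (a b : T) (u : seq 'I_n) (v w : W).

Let ggen := simple_gen coxS.
Let ginvol := simple_invol coxS.

Definition skw w v : T := skexp (rword s w) v.

Lemma npi_skexp u v : reduced s u -> npi (skexp u v) = npi (skw (wprod s u) v).
Proof.
move=> red; rewrite -(nquot_opE R coxS v red) /skw -{1}(wprod_rword ggen (wprod s u)).
by rewrite (nquot_opE R coxS) ?(reduced_rword ggen).
Qed.

Lemma skw_simple i w v : (len w < len (s i * w)%g)%N ->
  npi (skw (s i * w)%g v) = npi (xroot (wact v^-1%g (a_ i)) ** skw w v
    + gate (len (s i * v)%g < len v)%N (skw w (s i * v)%g)).
Proof.
have [eta geta] := coxeter_cocycle coxS => lt.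
have red : reduced s (i :: rword s w).
  by rewrite (reduced_cons geta) (reduced_rword ggen) wprod_cons (wprod_rword ggen).
by have := npi_skexp v red; rewrite wprod_cons (wprod_rword ggen) skexp_cons => <-.
Qed.

(* The same recursion as for subsum, where the first letter of a reduced word *)
(* of w_o v is removed; the relation x_a ^+ 2 = 0 enters when s_i w < w.        *)
Lemma skw_lower i w v : (len v < len (s i * v)%g)%N ->
  npi (skw w v) = npi (xroot (wact v^-1%g (a_ i)) ** skw w (s i * v)%g
    + gate (len w < len (s i * w)%g)%N (skw (s i * w)%g (s i * v)%g)).
Proof.
have [eta geta] := coxeter_cocycle coxS => ltv.
have nltv : (len (s i * v)%g < len v)%N = false by rewrite ltnNge ltnW.
set x := xroot (wact v^-1%g (a_ i)).
have xN : xroot (wact (s i * v)^-1%g (a_ i)) = - x.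
  rewrite invMg (ginv ginvol) (wact_simple_root R coxS) (xrootN coxS) //.
  exact: root_wact_simple.
(* The recursion for s_i w' taken at s_i v: both of its terms occur, since s_i shortens s_i v. *)
have low w' : (len w' < len (s i * w')%g)%N ->
    npi (skw (s i * w')%g (s i * v)%g) = - npi (x ** skw w' (s i * v)%g) + npi (skw w' v).
  move=> lt; rewrite (skw_simple _ lt) (mulgg ginvol) ltv xN tmulNl.
  by rewrite npiD npiN.
rewrite /gate; case: ifP => [lt|/negbT].
  by rewrite npiD low // addrA subrr add0r.
rewrite -(simple_leNgt geta) => lt; rewrite addr0.
(* Here s_i shortens w. Multiplying the relation for w' by x kills its term in x, because x squares
   to zero, and leaves x f(w',v), which is f(w,v). *)
set w' := (s i * w)%g in lt; have wE : w = (s i * w')%g by rewrite (mulgg ginvol).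
have ltw : (len w' < len (s i * w')%g)%N by rewrite -wE.
have E : npi (skw w (s i * v)%g) = npi (skw w' v - x ** skw w' (s i * v)%g).
  by rewrite wE low // npiD npiN addrC.
rewrite [RHS](npi_mull coxS x E) tmulDr tmulNr npiD npiN.
have -> : npi (x ** (x ** skw w' (s i * v)%g)) = 0.
  apply/npi0P; rewrite tmulA; apply: (nichols_ideal_mulr coxS).
  exact/(nichols_ideal_sqr coxS)/root_wact_simple.
by rewrite subr0 wE (skw_simple _ ltw) nltv /gate addr0.
Qed.

(** A count of letters: if one letter of u is spent on a root vector, too few remain to bring v down
    to 1. This serves as the base case v = w_o, where no w is longer than v. *)
Lemma skexp_small u v : (size u <= len v)%N ->
  skexp u v = gate (wprod s u == v) (word [::]).
Proof.
have [eta geta] := coxeter_cocycle coxS.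
elim: u v => [|i u IH] v le; first by rewrite skexp_nil wprod_nil eq_sym.
have lew := wlen_le ggen u.
rewrite skexp_cons IH ?(ltnW le) // wprod_cons.
have -> : (wprod s u == v) = false.
  by apply/eqP => e; move: lew; rewrite e leqNgt le.
rewrite [gate false _]/= tmul0r add0r.
have E : (s i * wprod s u == v)%g = (wprod s u == s i * v)%g.
  by rewrite -(inj_eq (mulgI (s i))) (mulgg ginvol).
rewrite E /gate; case: ifP => [lt|/negbT nlt].
  apply: IH; move: lt; rewrite (len_gt_simple geta) => /eqP ev.
  by move: le; rewrite ev.
case: eqP => // e; case/negP: nlt; rewrite -e.
exact: leq_ltn_trans lew le.
Qed.

(** The sum over J split at the first letter: it lies in J for the first term and in the complement
    for the second, where the length condition keeps the complementary word reduced. *)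
Fixpoint subsum u (w : W) : T :=
  if u is i :: u' then
    xroot (wact (wprod s u')^-1%g (a_ i)) ** subsum u' w
    + gate (len (s i * w)%g < len w)%N (subsum u' (s i * w)%g)
  else gate (w == 1%g) (word [::]).

Lemma longest_max w : (len w <= len (longest S))%N.
Proof. by rewrite /longest; case: arg_maxnP => // w0 _ max; apply: max. Qed.

Lemma npi_subsum u w v : reduced s u -> wprod s u = (longest S * v)%g ->
  npi (subsum u (longest S * w)%g) = npi (skw w v).
Proof.
have [eta geta] := coxeter_cocycle coxS; set w0 := longest S.
have w0max := longest_max.
elim: u w v => [|i u IH] w v.
  move=> _; rewrite wprod_nil => e.
  have vE : v = w0^-1%g by rewrite -[v](mulKg w0) -e mulg1.
  rewrite /= /skw skexp_small; last first.
    rewrite vE (wlenV ggen ginvol) (leq_trans _ (w0max w)) //.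
  by rewrite (wprod_rword ggen) vE -eq_invg_mul eq_sym.
rewrite (reduced_cons geta) !wprod_cons => /andP[red lt] e.
(* s_i passes through w0 as s_j, so removing a letter from the word of w0 v multiplies v by s_j. *)
have [j jE] := longest_conj geta w0max i; rewrite -/w0 in jE.
have sw0 w' : (s i * (w0 * w') = w0 * (s j * w'))%g.
  by rewrite -jE !mulgA mulgV mul1g.
have ue : wprod s u = (w0 * (s j * v))%g by rewrite -sw0 -e (mulgg ginvol).
have ltv : (len v < len (s j * v)%g)%N.
  by rewrite -(longest_ltE geta w0max) -ue -e.
(* The inverse of w0 sends [a_ i] to a negative root whose reflection is s_j. In [rE] this sign
   cancels against the one from s_j acting on [a_ j]. *)
have wj : wact w0^-1%g (a_ i) = - a_ j.
  apply: (@wact_sroot_simple R _ _ coxS); first by rewrite invgK -mulgA jE.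
  rewrite -(wlenV ggen ginvol) invMg invgK (ginv ginvol) (wlenV ggen ginvol).
  by rewrite (simple_leNgt geta) -leqNgt.
have rE : wact (wprod s u)^-1%g (a_ i) = wact v^-1%g (a_ j).
  rewrite ue !invMg (ginv ginvol) (wactM coxS) wj (wactN coxS) (wact_simple_root R coxS).
  by rewrite opprK.
rewrite (skw_lower _ ltv) [subsum _ _]/= rE !npiD sw0 (longest_ltE geta w0max).
rewrite (npi_mull coxS _ (IH w _ red ue)); congr (_ + _).
by rewrite /gate; case: ifP => // _; apply: IH.
Qed.

Lemma nroot_npi r : nroot r = npi (xroot r).
Proof. by rewrite npi.unlock xroot_locked.unlock. Qed.

Lemma nmul_sum a (J : Type) (l : seq J) (Q : pred J) (F : J -> nichols R S) :
  nmul (npi a) (\sum_(j <- l | Q j) F j) = \sum_(j <- l | Q j) nmul (npi a) (F j).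
Proof.
apply: (big_morph (nmul (npi a))) => [t t'|].
  by rewrite -(npi_repr t) -(npi_repr t') -npiD !(nmul_npi coxS) tmulDr npiD.
by rewrite -npi0 (nmul_npi coxS) tmul0r.
Qed.

Section SetCons.
Context (l : nat).

Definition set_cons (t : bool * {set 'I_l}) : {set 'I_l.+1} :=
  (if t.1 then [set ord0] else set0) :|: (lift ord0 @: t.2).

Lemma set_cons0 t : (ord0 \in set_cons t) = t.1.
Proof.
rewrite inE (_ : ord0 \in lift ord0 @: t.2 = false) ?orbF.
  by case: t.1; rewrite inE.
by apply/imsetP => -[j _ /eqP]; rewrite (negbTE (neq_lift _ _)).
Qed.

Lemma set_consS t j : (lift ord0 j \in set_cons t) = (j \in t.2).
Proof.
rewrite inE (mem_imset _ _ (@lift_inj _ ord0)).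
by case: t.1; rewrite inE // eq_sym (negbTE (neq_lift _ _)).
Qed.

Lemma set_cons_bij : bijective set_cons.
Proof.
exists (fun J : {set 'I_l.+1} => (ord0 \in J, [set j | lift ord0 j \in J])) => [[c J]|J].
  have E : [set j | lift ord0 j \in set_cons (c, J)] = J.
    by apply/setP => j; rewrite inE set_consS.
  by rewrite set_cons0 E.
apply/setP => j; case: (unliftP ord0 j) => [j'|] ->; last by rewrite set_cons0.
by rewrite set_consS inE.
Qed.

Lemma set_consC t : ~: set_cons t = set_cons (~~ t.1, ~: t.2).
Proof.
apply/setP => j; rewrite inE; case: (unliftP ord0 j) => [j'|] ->.
  by rewrite !set_consS inE.
by rewrite !set_cons0.
Qed.

(** [enum] is increasing, so index 0 comes first; this matches the increasing order of the products
    with the first letter of the word. *)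
Lemma enum_set_cons t :
  enum (set_cons t) = (if t.1 then [:: ord0] else [::]) ++ map (lift ord0) (enum t.2).
Proof.
have E (m : nat) (A : {set 'I_m}) : enum A = [seq j <- enum 'I_m | j \in A].
  by rewrite enumT; apply: eq_filter.
rewrite !E enum_ordSl /= set_cons0 filter_map.
rewrite (eq_filter (a2 := [pred j | j \in t.2])) => [|j]; last exact: set_consS.
by case: t.1.
Qed.

End SetCons.

Lemma reduced_expr_cons i u w : reduced_expr s w (i :: u) =
  reduced_expr s (s i * w)%g u && (len (s i * w)%g < len w)%N.
Proof.
have [eta geta] := coxeter_cocycle coxS.
rewrite !(reduced_exprE ggen) wprod_cons.
rewrite -(inj_eq (mulgI (s i))) (mulgg ginvol) -andbA.
case: eqP => //= e; have := wlen_le ggen u; rewrite e (len_gt_simple geta) /=.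
have aux (a b c : nat) : b = a.+1 \/ a = b.+1 -> (b <= c)%N ->
    (c.+1 == a) = ((c == b) && (a == b.+1)) by lia.
exact: aux (len_simpleP geta i w).
Qed.

(** A subset of l+1 indices is a bit and a subset of the tail. The terms of the tail are unchanged,
    because each root depends only on its own letter and those after it. *)
Lemma sum_subsets l (beta : l.-tuple 'I_n) w :
  \sum_(J : {set 'I_l} | reduced_expr s w [seq tnth beta j | j <- enum (~: J)])
     \big[@nmul R W S/nunit R S]_(j <- enum J)
        nroot (wact (wprod s (rev (drop j.+1 beta))) (a_ (tnth beta j)))
  = npi (subsum beta w).
Proof.
elim: l beta w => [|l IH] beta w.
  rewrite (tuple0 beta) [subsum _ _]/=.
  have e0 (A : {set 'I_0}) : enum A = [::] by case: (enum A) => [//|[]].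
  have red0 : reduced_expr s w [::] = (w == 1%g).
    rewrite /reduced_expr wprod_nil eq_sym; case: eqP => //= _.
    by apply/reducedP.
  rewrite (eq_bigl (fun=> w == 1%g)) => [|J]; last by rewrite e0 /= red0.
  rewrite (eq_bigr (fun=> nunit R S)) => [|J _]; last by rewrite e0 big_nil.
  case: eqP => _; last by rewrite big_pred0_eq npi0.
  rewrite (big_pred1 set0) => [|J]; last by apply/esym/eqP/setP => -[].
  by rewrite word_nil npi.unlock.
case/tupleP: beta => i beta.
pose x := xroot (wact (wprod s beta)^-1%g (a_ i)).
pose term (J : {set 'I_l}) := \big[@nmul R W S/nunit R S]_(j <- enum J)
        nroot (wact (wprod s (rev (drop j.+1 beta))) (a_ (tnth beta j))).
pose word_of (J : {set 'I_l}) := [seq tnth beta j | j <- enum (~: J)].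
have wordE c J : [seq tnth [tuple of i :: beta] j | j <- enum (~: set_cons (c, J))]
    = (if c then [::] else [:: i]) ++ word_of J.
  rewrite set_consC enum_set_cons map_cat -map_comp; congr (_ ++ _).
    by case: c => //=; rewrite (tnth_nth i).
  by apply: eq_map => j /=; rewrite tnthS.
have termE c J : \big[@nmul R W S/nunit R S]_(j <- enum (set_cons (c, J)))
    nroot (wact (wprod s (rev (drop j.+1 [tuple of i :: beta])))
                (a_ (tnth [tuple of i :: beta] j)))
    = (if c then nmul (npi x) (term J) else term J).
  have tail : \big[@nmul R W S/nunit R S]_(j <- map (lift ord0) (enum J))
      nroot (wact (wprod s (rev (drop j.+1 [tuple of i :: beta])))
                (a_ (tnth [tuple of i :: beta] j))) = term J.
    by rewrite big_map; apply: eq_bigr => j _; rewrite tnthS.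
  rewrite enum_set_cons; case: c => /=; last exact: tail.
  rewrite big_cons tail; congr nmul; rewrite nroot_npi /x /= drop0 (wprod_rev ginvol).
  by rewrite (tnth_nth i).
rewrite (reindex _ (onW_bij _ (set_cons_bij l))).
rewrite (eq_bigl
  (fun t => reduced_expr s w ((if t.1 then [::] else [:: i]) ++ word_of t.2)));
  last by case=> c J; rewrite wordE.
rewrite (eq_bigr (fun t => if t.1 then nmul (npi x) (term t.2) else term t.2));
  last by case=> c J _; rewrite termE.
(* Turning the condition into zero terms lets the sum over pairs be split along the bit: true gives
   the first term of [subsum], false the second. *)
rewrite big_mkcond /= -(pair_bigA _ (fun (c : bool) (J : {set 'I_l}) =>
  if reduced_expr s w ((if c then [::] else [:: i]) ++ word_of J)
  then if c then nmul (npi x) (term J) else term J else 0)) /=.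
rewrite big_bool /= -!big_mkcond /= npiD -(nmul_npi coxS) -IH -/x nmul_sum.
congr (_ + _); rewrite /gate; case: ifP => lt.
  by rewrite -IH; apply: eq_bigl => J; rewrite reduced_expr_cons lt andbT.
by rewrite npi0 big1 // => J; rewrite reduced_expr_cons lt andbF.
Qed.

Theorem sum_reduced_subwords (v w : W) (l : nat) (beta : l.-tuple 'I_n)
    (beta_red : reduced_expr s (longest S * v)%g beta) :
  nquot_op R S w v =
  \sum_(J : {set 'I_l} |
      reduced_expr s (longest S * w)%g [seq tnth beta j | j <- enum (~: J)])
     \big[@nmul R W S/nunit R S]_(j <- enum J)
        nroot (wact (wprod s (rev (drop j.+1 beta))) (a_ (tnth beta j))).
Proof.
have [/eqP e red] := andP beta_red.
rewrite sum_subsets (npi_subsum _ red e) /skw -{1}(wprod_rword ggen w).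
by rewrite (nquot_opE R coxS) ?(reduced_rword ggen).
Qed.

End SubsetSum.

Theorem corollary6p13 (R : realType) (W : finGroupType) (S : {set W})
    (coxS : coxeter_system S) (v w : W) (le_vw : bruhat S v w)
    (l : nat) (beta : l.-tuple 'I_#|S|)
    (beta_red : reduced_expr (@simple W S) (longest S * v)%g beta) :
  let alpha (i : 'I_l) : 'rV[R]_#|S| :=
    wact (wprod (@simple W S) (rev (drop i.+1 beta))) (sroot R (tnth beta i)) in
  let y (i : 'I_l) : nichols R S := nroot (alpha i) in
  nquot_op R S w v =
    (\sum_(J : {set 'I_l} |
        reduced_expr (@simple W S) (longest S * w)%g
          [seq tnth beta j | j <- enum (~: J)])
      \big[@nmul R W S/nunit R S]_(j <- enum J) y j)%R.
Proof. exact: sum_reduced_subwords. Qed.
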